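(* Let $\sigma$ be a non-atomic Radon measure on $\mathbb{R}^d$, let $\mu_G^\sigma$ be the Gamma noise measure on $\mathcal{D}'$, and let $L_n^\sigma(\omega)\in\mathcal{D}'^{\widehat\otimes n}$ be the generalized Laguerre kernels. For all $n,m\in\mathbb{N}_0$ and all $\varphi^{(n)}\in\mathcal{D}^{\widehat\otimes n}$, $\psi^{(m)}\in\mathcal{D}^{\widehat\otimes m}$, the generalized Laguerre polynomials satisfy the orthogonality property $$\int_{\mathcal{D}'}\langle L_n^\sigma(\omega),\varphi^{(n)}\rangle\,\langle L_m^\sigma(\omega),\psi^{(m)}\rangle\,d\mu_G^\sigma(\omega)=\delta_{nm}\,n!\,\big(\varphi^{(n)},\psi^{(n)}\big)_{\mathrm{Exp}_n^GL^2(\sigma)},$$ where $$\big(\varphi^{(n)},\psi^{(n)}\big)_{\mathrm{Exp}_n^GL^2(\sigma)}=\sum_{\mathcal{I}^{(n)}}\ \prod_{k=1}^n\big((k-1)!\big)^{i_k}\int\varphi^{(n)}_{\mathcal{I}^{(n)}}\,\psi^{(n)}_{\mathcal{I}^{(n)}}\,d\sigma^{\otimes|\mathcal{I}^{(n)}|},$$ the sum running over all partitions $\mathcal{I}^{(n)}$ of $\{1,\dots,n\}$ into nonempty blocks.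
   Context: $\mathcal{D}=C_0^\infty(\mathbb{R}^d)$ (real-valued), $\mathcal{D}'$ is its dual, $\widehat\otimes$ is the symmetric tensor product, and $\langle f\rangle_\sigma=\int f\,d\sigma$. The Gamma noise $\mu_G^\sigma$ is the probability measure on $(\mathcal{D}',\mathcal{B}(\mathcal{D}'))$ determined by its Laplace transform $l_{\mu_G^\sigma}(\varphi)=\int_{\mathcal{D}'}e^{\langle\omega,\varphi\rangle}d\mu_G^\sigma(\omega)=\exp(-\langle\log(1-\varphi)\rangle_\sigma)$ for $\varphi\in\mathcal{D}$, $\varphi<1$. With $\alpha(\varphi)=\varphi/(\varphi-1)$, the normalized exponential is $e^\alpha_{\mu_G^\sigma}(\varphi;\omega)=\frac{e^{\langle\omega,\alpha(\varphi)\rangle}}{l_{\mu_G^\sigma}(\alpha(\varphi))}=\exp\big(\langle\omega,\tfrac{\varphi}{\varphi-1}\rangle-\langle\log(1-\varphi)\rangle_\sigma\big)$, holomorphic in $\varphi$ on a neighborhood of $0\in\mathcal{D}$. The generalized Laguerre kernels $L_n^\sigma(\omega)\in\mathcal{D}'^{\widehat\otimes n}$ are its Taylor coefficients: $e^\alpha_{\mu_G^\sigma}(\varphi;\omega)=\sum_{n\ge0}\frac1{n!}\langle L_n^\sigma(\omega),\varphi^{\otimes n}\rangle$. For a partition $\mathcal{I}^{(n)}$ of $\{1,\dots,n\}$: $|\mathcal{I}^{(n)}|$ is the number of blocks, $i_k$ is the number of blocks with exactly $k$ elements ($1\le k\le n$), and the contraction $\varphi^{(n)}_{\mathcal{I}^{(n)}}$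 is the function of $|\mathcal{I}^{(n)}|$ variables in $\mathbb{R}^d$, one per block, obtained from $\varphi^{(n)}(x_1,\dots,x_n)$ by identifying all arguments $x_j$ whose indices lie in the same block. For $n=0$ the inner product is the product of the scalars. *)

(* Defs.v *)
From HB Require Import structures.
From mathcomp Require Import all_boot all_order all_algebra perm.
From mathcomp Require Import all_classical all_reals all_analysis.

Set Implicit Arguments.
Unset Strict Implicit.
Unset Printing Implicit Defensive.

Import Order.TTheory GRing.Theory Num.Theory.
Import numFieldNormedType.Exports.

Local Open Scope classical_set_scope.
Local Open Scope ring_scope.

(* Points of (R^d)^n are the n x d matrices whose rows are the n arguments in
   R^d; R^d itself is 'rV[R]_d = 'M[R]_(1, d). *)

Section smooth.
Context {R : realType} {m n : nat}.
Local Notation V := 'M[R]_(m, n).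
Implicit Types (f g : V -> R) (s : seq ('I_m * 'I_n)) (K : set V).

(* The iterated partial derivative along the coordinates listed in s. *)
Fixpoint pderiv s f : V -> R :=
  if s is ij :: s' then
    pderiv s' (fun x => 'D_(delta_mx ij.1 ij.2 : V) f x)
  else f.

Definition smooth f := forall s x, differentiable (pderiv s f) x.

Definition supported_in K f := forall x, ~ K x -> f x = 0.

Definition test_function f :=
  smooth f /\ exists2 K : set V, compact K & supported_in K f.

(* C^k regularity, only used to show that the constructions below preserve
   smoothness. *)
Definition smooth_upto k f :=
  forall s x, (size s <= k)%N -> differentiable (pderiv s f) x.

Lemma smooth_uptoP f : smooth f <-> forall k, smooth_upto k f.
Proof. by split=> [h k s x _|h s x]; [exact: h|exact: (h (size s))]. Qed.

Lemma smooth_uptoS k f : smooth_upto k.+1 f <->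
  (forall x, differentiable f x) /\
  forall ij : 'I_m * 'I_n,
    smooth_upto k (fun x => 'D_(delta_mx ij.1 ij.2 : V) f x).
Proof.
split=> [h|[h0 h] [|ij s] x //= sk]; last exact: h.
split=> [x|ij s x sk]; first exact: (h [::]).
exact: (h (ij :: s)).
Qed.

Lemma smooth_upto_diff k f : smooth_upto k f -> forall x, differentiable f x.
Proof. by move=> h x; exact: (h [::]). Qed.

Lemma smooth_uptoW k f : smooth_upto k.+1 f -> smooth_upto k f.
Proof. by move=> h s x sk; apply: h; exact: leqW. Qed.

Lemma smooth_upto_cst k (c : R) : smooth_upto k (cst c).
Proof.
elim: k c => [c [|//] x _ /=|k IH c]; first exact: differentiable_cst.
apply/smooth_uptoS; split=> [x|ij]; first exact: differentiable_cst.
rewrite (_ : (fun x => _) = cst 0) //.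
by apply/funext => x; rewrite derive_cst.
Qed.

Lemma smooth_uptoD k f g :
  smooth_upto k f -> smooth_upto k g -> smooth_upto k (f + g).
Proof.
elim: k f g => [f g hf hg [|//] x _ /=|k IH f g].
  by apply: differentiableD; [exact: (hf [::])|exact: (hg [::])].
move=> /smooth_uptoS[df hf] /smooth_uptoS[dg hg]; apply/smooth_uptoS.
split=> [x|ij]; first exact: differentiableD.
rewrite (_ : (fun x => _) =
  (fun x => 'D_(delta_mx ij.1 ij.2 : V) f x) +
  (fun x => 'D_(delta_mx ij.1 ij.2 : V) g x)); first exact: IH.
by apply/funext => x; rewrite deriveD//; exact: diff_derivable.
Qed.

Lemma smooth_uptoM k f g :
  smooth_upto k f -> smooth_upto k g -> smooth_upto k (f * g).
Proof.
elim: k f g => [f g hf hg [|//] x _ /=|k IH f g].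
  by apply: differentiableM; [exact: (hf [::])|exact: (hg [::])].
move=> hf hg; have := hf; have := hg.
move=> /smooth_uptoS[dg dhg] /smooth_uptoS[df dhf]; apply/smooth_uptoS.
split=> [x|ij]; first exact: differentiableM.
rewrite (_ : (fun x => _) =
  f * (fun x => 'D_(delta_mx ij.1 ij.2 : V) g x) +
  g * (fun x => 'D_(delta_mx ij.1 ij.2 : V) f x)).
  by apply: smooth_uptoD; apply: IH => //; exact: smooth_uptoW.
by apply/funext => x; rewrite deriveM//; exact: diff_derivable.
Qed.

Lemma smooth_uptoV k f : (forall x, f x != 0) ->
  smooth_upto k f -> smooth_upto k (fun x => (f x)^-1).
Proof.
move=> f0; elim: k => [hf [|//] y _ /=|k IH].
  by apply: differentiableV; [exact: (hf [::])|exact: f0].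
move=> hf; have := hf; move=> /smooth_uptoS[df dhf]; apply/smooth_uptoS.
split=> [x|ij]; first by apply: differentiableV; [exact: df|exact: f0].
have hV := IH (smooth_uptoW hf).
rewrite (_ : (fun x => _) = cst (-1) *
  (((fun x => (f x)^-1) * (fun x => (f x)^-1)) *
   (fun x => 'D_(delta_mx ij.1 ij.2 : V) f x))).
  apply: smooth_uptoM; first exact: smooth_upto_cst.
  by apply: smooth_uptoM => //; exact: smooth_uptoM.
apply/funext => x; rewrite deriveV//; last exact: diff_derivable.
by rewrite !fctE mulN1r scaleNr -exprVn expr2.
Qed.

Lemma smoothM f g : smooth f -> smooth g -> smooth (f * g).
Proof.
by move=> /smooth_uptoP f_ /smooth_uptoP g_; apply/smooth_uptoP => k;
  exact: smooth_uptoM.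
Qed.

Lemma smoothD f g : smooth f -> smooth g -> smooth (f + g).
Proof.
by move=> /smooth_uptoP f_ /smooth_uptoP g_; apply/smooth_uptoP => k;
  exact: smooth_uptoD.
Qed.

Lemma smooth_cst (c : R) : smooth (cst c).
Proof. by apply/smooth_uptoP => k; exact: smooth_upto_cst. Qed.

Lemma smoothV f : (forall x, f x != 0) ->
  smooth f -> smooth (fun x => (f x)^-1).
Proof.
by move=> f0 /smooth_uptoP f_; apply/smooth_uptoP => k; exact: smooth_uptoV.
Qed.

End smooth.

Lemma mx_continuous {R : realType} {T : topologicalType} {m n : nat}
    (f : T -> 'M[R]_(m, n)) :
  (forall i j, continuous (fun x => f x i j)) -> continuous f.
Proof.
move=> hf x A [P /= hP PA]; rewrite /nbhs/=.
have : nbhs x [set y | forall i j, P i j (f y i j)].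
  apply: (@filter_forall _ _ (fun i y => forall j, P i j (f y i j))) => i.
  apply: (@filter_forall _ _ (fun j y => P i j (f y i j))) => j.
  exact: (hf i j x _ (hP i j)).
by apply: filterS => y; exact: PA.
Qed.

Lemma row_continuous {R : realType} {m n : nat} (i : 'I_m) :
  continuous (row i : 'M[R]_(m, n) -> 'rV[R]_n).
Proof.
apply: mx_continuous => k j.
rewrite (_ : (fun y => _) = fun y : 'M[R]_(m, n) => y i j).
  exact: coord_continuous.
by apply/funext => y; rewrite mxE.
Qed.

Lemma smooth_row {R : realType} {m n : nat} (i : 'I_m) (f : 'rV[R]_n -> R) :
  smooth f -> smooth (fun x : 'M[R]_(m, n) => f (row i x)).
Proof.
have rowc (x : 'M[R]_(m, n)) : differentiable (row i) x.
  by apply: linear_differentiable; exact: row_continuous.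
have rowD (x v : 'M[R]_(m, n)) (g : 'rV[R]_n -> R) :
    'D_v (g \o row i) x = 'D_(row i v) g (row i x).
  rewrite /derive; set F := fun h => _; set G := fun h => _.
  suff -> : F = G by [].
  by apply/funext => h; rewrite /F /G /= linearP.
move=> /smooth_uptoP hf; apply/smooth_uptoP => k; have {hf} := hf k.
elim: k f => [f hf [|//] x _ /=|k IH f /smooth_uptoS[df hf]].
  by apply: (@differentiable_comp _ _ _ _ (row i) f) => //; exact: (hf [::]).
apply/smooth_uptoS; split=> [x|[k' j]].
  exact: (@differentiable_comp _ _ _ _ (row i) f).
have [ik|ik] := eqVneq i k'.
  rewrite (_ : (fun x => _) = fun x : 'M[R]_(m, n) =>
    'D_(delta_mx ord0 j : 'rV[R]_n) f (row i x)).
    exact: IH (hf (ord0, j)).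
  apply/funext => x; rewrite (rowD _ _ f); congr ('D_ _ _ _).
  by apply/rowP => l; rewrite !mxE ik !eqxx.
rewrite (_ : (fun x => _) = cst (0 : R)).
  exact: (@smooth_upto_cst R m n k 0).
apply/funext => x; rewrite (rowD _ _ f) (_ : row i (delta_mx _ _) = 0); last first.
  by apply/rowP => l; rewrite !mxE (negbTE ik).
by rewrite derive0.
Qed.

Lemma mx_bounded_closed_compact {R : realType} {m n : nat}
    (A : set 'M[R]_(m, n)) : bounded_set A -> closed A -> compact A.
Proof.
move=> [M [Mreal hM]] Acl.
have vc : continuous (vec_mx : 'rV[R]_(m * n) -> 'M[R]_(m, n)).
  apply: mx_continuous => i j.
  rewrite (_ : (fun v => _) = fun v : 'rV[R]_(m * n) => v 0 (mxvec_index i j)).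
    exact: coord_continuous.
  by apply/funext => v; rewrite mxE.
have -> : A = vec_mx @` (vec_mx @^-1` A).
  apply/seteqP; split=> [x Ax|_ [y Ay <-]//].
  by exists (mxvec x); rewrite /= mxvecK.
apply: continuous_compact; first by apply: continuous_subspaceT; exact: vc.
apply: bounded_closed_compact; last exact: closed_comp.
exists M; split=> // N MN v Av; apply: le_trans (hM _ MN _ Av).
rewrite /Num.norm/= !mx_normrE; apply/bigmax_leP; split=> /=.
  by apply/bigmax_geP; left.
move=> [i k] _ /=; case/mxvec_indexP: k => i' j'.
apply/bigmax_geP; right; exists (i', j') => //=.
by rewrite mxE ord1.
Qed.

(* The space C_c^oo of matrices; testfun R 1 d is D = C_c^oo(R^d). *)
Section testfun.
Context {R : realType} (m n : nat).
Local Notation V := 'M[R]_(m, n).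

Definition is_testfun : {pred V -> R} := fun f => `[< test_function f >].

Record testfun := TestFun {
  testfun_val :> V -> R ;
  testfunP : testfun_val \in is_testfun }.

HB.instance Definition _ := [isSub for testfun_val].
HB.instance Definition _ := [Choice of testfun by <:].

Lemma is_testfun_submod : submod_closed is_testfun.
Proof.
split.
  apply/asboolP; split; first exact: (smooth_cst 0).
  by exists set0; [exact: compact0|move=> x _].
move=> a f g /asboolP[sf [K cK Kf]] /asboolP[sg [K' cK' K'g]]; apply/asboolP.
split.
  apply: smoothD => //; rewrite (_ : a *: f = cst a * f) //.
  by apply: smoothM => //; exact: smooth_cst.
exists (K `|` K'); first exact: compactU.
by move=> x /not_orP[Kx K'x]; rewrite !fctE Kf// K'g// scaler0 addr0.
Qed.

HB.instance Definition _ :=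
  GRing.isSubmodClosed.Build R (V -> R) is_testfun is_testfun_submod.
HB.instance Definition _ := [SubChoice_isSubLmodule of testfun by <:].

(* The (LF) topology: the finest locally convex topology inducing on each
   D_K = {phi | supp phi included in K} a topology coarser than the one given
   by the seminorms max_(|s| <= N) sup |pderiv s phi|. It is described by all
   the seminorms that are continuous on every D_K. *)
Definition lf_seminorm (p : testfun -> R) :=
  [/\ forall f g, p (f + g) <= p f + p g,
      forall (a : R) f, p (a *: f) = `|a| * p f
    & forall K : set V, compact K -> exists N (C : R),
        forall (f : testfun) (M : R), supported_in K f ->
          (forall s x, (size s <= N)%N -> `|pderiv s f x| <= M) ->
          p f <= C * M].

Definition lf_nbhs (f : testfun) : set_system testfun :=
  [set U | exists2 p, lf_seminorm p &
     exists2 e : R, 0 < e & [set g | p (g - f) < e] `<=` U].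

Lemma lf_seminorm0 p : lf_seminorm p -> p 0 = 0.
Proof. by case=> _ pZ _; rewrite -(scale0r (0 : testfun)) pZ normr0 mul0r. Qed.

Lemma lf_seminorm_ge0 p : lf_seminorm p -> forall f, 0 <= p f.
Proof.
move=> hp f; have p0 := lf_seminorm0 hp; case: hp => pD pZ _.
have := pD f (-1 *: f); rewrite pZ normrN1 mul1r scaleN1r subrr p0.
by rewrite -mulr2n pmulrn_lge0.
Qed.

Lemma lf_seminormD p q : lf_seminorm p -> lf_seminorm q ->
  lf_seminorm (fun f => p f + q f).
Proof.
move=> [pD pZ pK] [qD qZ qK]; split=> [f g|a f|K cK].
- by rewrite addrACA lerD.
- by rewrite pZ qZ mulrDr.
have [N [C pC]] := pK _ cK; have [N' [C' qC]] := qK _ cK.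
exists (maxn N N'), (C + C') => f M fK fM; rewrite mulrDl lerD//.
  by apply: pC => // s x sN; apply: fM; rewrite leq_max sN.
by apply: qC => // s x sN; apply: fM; rewrite leq_max sN orbT.
Qed.

HB.instance Definition _ := hasNbhs.Build testfun lf_nbhs.

Lemma lf_nbhs_filter f : ProperFilter (nbhs (f : testfun)).
Proof.
apply: Build_ProperFilter_ex => [A [p hp [e e0 pA]]|].
  by exists f; apply: pA; rewrite /= subrr lf_seminorm0.
split.
- exists (fun=> 0) => //; last by exists 1.
  split=> [||K cK] *; rewrite ?addr0 ?mulr0//.
  by exists 0, 0 => *; rewrite mul0r.
- move=> A B [p hp [e e0 pA]] [q hq [e' e'0 qB]].
  exists (fun g => p g + q g); first exact: lf_seminormD.
  exists (Num.min e e'); first by rewrite lt_min e0.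
  move=> g /=; rewrite lt_min => /andP[pe qe]; split.
    by apply: pA => /=; apply: le_lt_trans pe; rewrite lerDl lf_seminorm_ge0.
  by apply: qB => /=; apply: le_lt_trans qe; rewrite lerDr lf_seminorm_ge0.
- move=> A B AB [p hp [e e0 pA]]; exists p => //; exists e => //.
  exact: subset_trans AB.
Qed.

Lemma lf_nbhs_singleton (f : testfun) A : nbhs f A -> A f.
Proof.
by move=> [p hp [e e0 pA]]; apply: pA; rewrite /= subrr lf_seminorm0.
Qed.

Lemma lf_nbhs_nbhs (f : testfun) A : nbhs f A -> nbhs f (nbhs^~ A).
Proof.
move=> [p hp [e e0 pA]]; exists p => //; exists (e / 2); first exact: divr_gt0.
move=> g /= pg; exists p => //; exists (e / 2); first exact: divr_gt0.
move=> h /= ph; apply: pA => /=; rewrite [e]splitr.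
rewrite (_ : h - f = (h - g) + (g - f)); last by rewrite addrA subrK.
by case: hp => pD _ _; rewrite (le_lt_trans (pD _ _))// ltrD.
Qed.

HB.instance Definition _ := Nbhs_isNbhsTopological.Build testfun
  lf_nbhs_filter lf_nbhs_singleton lf_nbhs_nbhs.

Lemma lf_add_continuous : continuous (fun x : testfun * testfun => x.1 + x.2).
Proof.
move=> [f g] A [p hp [e e0 pA]].
exists ([set f' | p (f' - f) < e / 2], [set g' | p (g' - g) < e / 2]) => /=.
  by split; exists p => //; exists (e / 2) => //; exact: divr_gt0.
move=> [f' g'] /= [pf pg]; apply: pA => /=; rewrite [e]splitr.
rewrite opprD addrACA; case: hp => pD _ _.
by rewrite (le_lt_trans (pD _ _))// ltrD.
Qed.

Lemma lf_scale_continuous : continuous (fun z : R^o * testfun => z.1 *: z.2).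
Proof.
move=> [a f] A [p hp [e e0 pA]]; have p0 := lf_seminorm_ge0 hp.
have c0 : 0 < `|a| + 1 by rewrite ltr_wpDl.
have d0 : 0 < p f + 1 by rewrite ltr_wpDl.
exists ([set b : R^o | `|a - b| < Num.min 1 (e / 2 / (p f + 1))],
        [set g | p (g - f) < e / 2 / (`|a| + 1)]) => /=.
  split; last first.
    by exists p => //; exists (e / 2 / (`|a| + 1)) => //; rewrite !divr_gt0.
  apply/nbhs_ballP; exists (Num.min 1 (e / 2 / (p f + 1))).
    by rewrite /= lt_min ltr01 !divr_gt0.
  by move=> b.
move=> [b g] /= []; rewrite lt_min => /andP[ab1 ab2] pg; apply: pA => /=.
rewrite (_ : b *: g - a *: f = b *: (g - f) + (b - a) *: f); last first.
  by rewrite scalerBr scalerBl addrA subrK.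
case: hp => pD pZ _; rewrite (le_lt_trans (pD _ _))// !pZ [e]splitr.
have ba : `|b| <= `|a| + 1.
  rewrite -[b](subrK a) addrC (le_trans (ler_normD _ _))// lerD2l distrC.
  exact: ltW.
apply: ltr_leD.
  rewrite (le_lt_trans (ler_wpM2r (p0 _) ba))//.
  by rewrite mulrC -ltr_pdivlMr.
rewrite distrC (le_trans (ler_wpM2r (p0 _) (ltW ab2)))//.
rewrite mulrAC ler_pdivrMr// ler_wpM2l//; first by rewrite divr_ge0// ltW.
by rewrite lerDl.
Qed.

Lemma lf_locally_convex : exists2 B : set_system testfun,
  (forall b, b \in B -> convex_set b) & basis B.
Proof.
exists [set B | exists f p (e : R), lf_seminorm p /\
                B = [set g | p (g - f) < e]].
  move=> _ /set_mem[f [p [e [hp ->]]]]; apply/convex_setW => g h.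
  rewrite !inE /= => pg ph l l0 l1; rewrite inE /=.
  case: (hp) => pD pZ _.
  rewrite (_ : _ - f = (l%:num *: (g - f) + (1 - l%:num) *: (h - f))); last first.
    rewrite !scalerBr addrACA -opprD -scalerDl addrCA subrr addr0 scale1r.
    by [].
  rewrite (le_lt_trans (pD _ _))// !pZ.
  rewrite (ger0_norm (ltW l0)) ger0_norm ?subr_ge0 1?ltW//.
  rewrite [e](_ : _ = l%:num * e + (1 - l%:num) * e); last first.
    by rewrite -mulrDl addrCA subrr addr0 mul1r.
  by apply: ltrD; rewrite ltr_pM2l// subr_gt0.
split=> [_ [f [p [e [hp ->]]]]|f A [p hp [e e0 pA]]].
  rewrite openE => g /= pg; exists p => //; exists (e - p (g - f)).
    by rewrite subr_gt0.
  move=> h /=; rewrite ltrBrDr => ph.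
  rewrite (_ : h - f = (h - g) + (g - f)); last by rewrite addrA subrK.
  by case: hp => pD _ _; rewrite (le_lt_trans (pD _ _)).
exists [set g | p (g - f) < e] => //; split; last first.
  by rewrite /= subrr lf_seminorm0.
by exists f, p, e.
Qed.

(* The library factory PreTopologicalLmod_isTvs only produces the uniform
   structure; the remaining mixins are given separately. *)
HB.instance Definition _ := PreTopologicalLmod_isTvs.Build R testfun
  lf_add_continuous lf_scale_continuous lf_locally_convex.
HB.instance Definition _ :=
  PreTopologicalNmodule_isTopologicalNmodule.Build testfun lf_add_continuous.
HB.instance Definition _ :=
  TopologicalNmodule_isTopologicalLmodule.Build R testfun lf_scale_continuous.
HB.instance Definition _ := Uniform_isTvs.Build R testfun lf_locally_convex.

End testfun.
Arguments testfun R m n : clear implicits.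

(* Topological dual with the weak-* topology. For E = D its Borel sets are
   also those of the strong topology and the cylinder sigma-algebra. *)
Section dual.
Context {R : realType} (E : tvsType R).

Record dual := Dual {
  dual_fun :> {scalar E} ;
  dual_continuous : continuous (dual_fun : E -> R) }.

HB.instance Definition _ := gen_eqMixin dual.
HB.instance Definition _ := gen_choiceMixin dual.

Fact zero_scalar_continuous : continuous (GRing.null_fun R^o : E -> R).
Proof. by move=> x; exact: cvg_cst. Qed.

HB.instance Definition _ := isPointed.Build dual
  (@Dual [the {scalar E} of GRing.null_fun R^o] zero_scalar_continuous).

HB.instance Definition _ := Topological.copy dual
  (initial_topology (fun w : dual => (w : prod_topology (fun _ : E => R)))).

End dual.

Definition borel (T : ptopologicalType) := g_sigma_algebraType (@open T).
HB.instance Definition _ (T : ptopologicalType) := Measurable.on (borel T).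

Section measures_on_Rd.
Context {R : realType} {d : nat}.
Local Notation Rd := (borel 'rV[R]_d).
Local Open Scope ereal_scope.

Definition radon (sigma : {measure set Rd -> \bar R}) :=
  (forall K : set 'rV[R]_d, compact K -> sigma K < +oo) /\
  (forall A : set Rd, measurable A -> sigma A =
     ereal_sup [set sigma K | K in [set K : set 'rV[R]_d | compact K /\ K `<=` A]]).

Definition non_atomic (sigma : {measure set Rd -> \bar R}) :=
  forall A : set Rd, measurable A -> 0 < sigma A ->
    exists2 B : set Rd, measurable B /\ B `<=` A & 0 < sigma B < sigma A.

(* On R^d sigma-finiteness is a consequence of local finiteness, so requiring
   it below of Radon measures, as the library's product measure does, is no
   restriction. *)
Lemma radon_sigma_finite (sigma : {measure set Rd -> \bar R}) :
  radon sigma -> sigma_finite setT sigma.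
Proof.
move=> [sigmaK _]; exists (fun k => [set x : 'rV[R]_d | (`|x| <= k%:R)%R]).
  apply/seteqP; split=> // x _; exists (Num.trunc `|(x : 'rV[R]_d)|).+1 => //=.
  exact/ltW/truncnS_gt.
move=> k; have cl : closed [set x : 'rV[R]_d | (`|x| <= k%:R)%R].
  apply: (@closed_comp _ _ (fun x : 'rV[R]_d => `|x|%R) [set r | (r <= k%:R)%R]).
    by move=> x _; exact: norm_continuous.
  exact: closed_le.
split.
  rewrite -[X in measurable X]setCK; apply: measurableC.
  by apply: sub_sigma_algebra; exact: closed_openC.
apply: sigmaK; apply: bounded_closed_compact => //.
exists k%:R; split; first exact: num_real.
by move=> N kN x /= xk; rewrite (le_trans xk)// ltW.
Qed.

End measures_on_Rd.

Section product_power.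
Context {disp} {T : measurableType disp} {R : realType}.
Local Open Scope ereal_scope.
Variable sigma : {sigma_finite_measure set T -> \bar R}.

(* The product measure sigma^(tensor k) on k-tuples. *)
Fixpoint pow_measure (k : nat) : set (k.-tuple T) -> \bar R :=
  if k is k'.+1 then
    pushforward (sigma \x @pow_measure k')
      (fun p : T * k'.-tuple T => [tuple of p.1 :: p.2])
  else \d_([tuple] : 0.-tuple T).

Let cons_tuple k (p : T * k.-tuple T) : k.+1.-tuple T :=
  [tuple of p.1 :: p.2].

Let measurable_cons_tuple k : measurable_fun setT (@cons_tuple k).
Proof. by apply: measurable_cons. Qed.

Let pow_measure_sigma_finite k :
  exists m : {sigma_finite_measure set (k.-tuple T) -> \bar R},
    @pow_measure k = m.
Proof.
elim: k => [|k [m mE]].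
  by exists [the {sigma_finite_measure set _ -> \bar R} of \d_(nil_tuple T)].
pose M : {measure set (k.+1.-tuple T) -> \bar R} :=
  measure_function_pushforward__canonical__measure_function_Measure
    [the {measure set _ -> \bar R} of sigma \x m] (@measurable_cons_tuple k).
have MT : sigma_finite setT M.
  have [F [FT ndF mF]] := (sigma_finiteP _ _).1 (sigma_finiteT sigma).
  have [G [GT ndG mG]] := (sigma_finiteP _ _).1 (sigma_finiteT m).
  pose H i : set (k.+1.-tuple T) :=
    (fun t : k.+1.-tuple T => tnth t ord0) @^-1` F i `&`
    (fun t : k.+1.-tuple T => [tuple of behead t]) @^-1` G i.
  exists H => [|i].
    apply/seteqP; split=> // t _.
    have : setT (tnth t ord0) by [].
    rewrite FT => -[i _ Fi].
    have : [set: k.-tuple T] [tuple of behead t] by [].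
    rewrite GT => -[j _ Gj].
    exists (maxn i j) => //; split => /=.
      by apply: (subsetPset _ _ (ndF _ _ (leq_maxl i j))).
    by apply: (subsetPset _ _ (ndG _ _ (leq_maxr i j))).
  split.
    apply: measurableI; rewrite -[X in measurable X]setTI.
      by apply: measurable_tnth => //; exact: (mF i).1.
    by apply: measurable_behead => //; exact: (mG i).1.
  rewrite [M _](_ : _ = (sigma \x m) (F i `*` G i)).
    rewrite product_measure1E; [|exact: (mF i).1|exact: (mG i).1].
    by rewrite lte_mul_pinfty ?(mF i).2 ?(mG i).2// ge0_fin_numE ?(mF i).2.
  congr (_ \x _); apply/seteqP; split=> -[x t].
    by move=> [/= Fx Gt]; split=> //=; have <- : [tuple of behead (cons_tuple (x, t))] = t by exact: val_inj.
  move=> [/= Fx Gt]; split=> //=.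
  by have -> : [tuple of behead (cons_tuple (x, t))] = t by exact: val_inj.
pose H1 := isSFinite.Build _ _ _ (Measure.sort M)
  (sfinite_measure_sigma_finite MT).
pose H2 := isSigmaFinite.Build _ _ _ (Measure.sort M) MT.
pose M' := HB.pack_for (SigmaFiniteMeasure.type (k.+1.-tuple T) R)
  (Measure.sort M) H1 H2.
by exists M'; rewrite /= mE.
Qed.

Let m k := sval (cid (pow_measure_sigma_finite k)).

Let pow_measure0 k : @pow_measure k set0 = 0.
Proof. by rewrite (svalP (cid (pow_measure_sigma_finite k))) measure0. Qed.

Let pow_measure_ge0 k A : 0 <= @pow_measure k A.
Proof. by rewrite (svalP (cid (pow_measure_sigma_finite k))) measure_ge0. Qed.

Let pow_measure_sigma_additive k : semi_sigma_additive (@pow_measure k).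
Proof.
rewrite (svalP (cid (pow_measure_sigma_finite k))).
exact: measure_semi_sigma_additive.
Qed.

HB.instance Definition _ k := isMeasure.Build _ _ _ (@pow_measure k)
  (pow_measure0 k) (@pow_measure_ge0 k) (@pow_measure_sigma_additive k).

Let pow_measure_sigma_finiteT k : sigma_finite setT (@pow_measure k).
Proof.
rewrite (svalP (cid (pow_measure_sigma_finite k))).
exact: sigma_finiteT.
Qed.

HB.instance Definition _ k := Measure_isSigmaFinite.Build _ _ _ (@pow_measure k)
  (pow_measure_sigma_finiteT k).

End product_power.

Section laguerre.
Context {R : realType} {d : nat}.
Local Notation Rd := (borel 'rV[R]_d).
Local Notation D := (testfun R 1 d).
Local Notation D' := (borel (dual D)).

Definition tensor_pow (n : nat) (phi : D) (x : 'M[R]_(n, d)) : R :=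
  \prod_(i < n) phi (row i x).

Lemma tensor_powP n (phi : D) : tensor_pow phi \in @is_testfun R n d.
Proof.
apply/asboolP; have /asboolP[sphi [K cK Kphi]] := testfunP phi; split.
  rewrite (_ : tensor_pow phi =
    \prod_(i < n) (fun x : 'M[R]_(n, d) => phi (row i x))); last first.
    by apply/funext => x; rewrite fct_prodE.
  elim/big_ind : _ => [|f g|i _]; first exact: (smooth_cst 1).
    exact: smoothM.
  exact: smooth_row.
exists [set x | forall i, K (row i x)]; last first.
  move=> x /existsNP[i Ki]; rewrite /tensor_pow (bigD1 i)//= Kphi// mul0r.
  by [].
have [M [Mreal hM]] := compact_bounded cK.
apply: mx_bounded_closed_compact.
  exists (Num.max M 0); split; first exact: num_real.
  move=> N; rewrite gt_max => /andP[MN N0] x Kx.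
  rewrite /Num.norm/= mx_normrE; apply/bigmax_leP; split=> [|[i j] _ /=].
    exact: ltW.
  apply: le_trans (hM N MN _ (Kx i)).
  rewrite [leRHS]/Num.norm/= mx_normrE; apply/bigmax_geP; right.
  by exists (ord0, j) => //=; rewrite mxE.
rewrite (_ : mkset _ = \bigcap_i ((row i) @^-1` K)); last first.
  by apply/seteqP; split=> x h i *; exact: h.
apply: closed_bigI => i _; apply: closed_comp => [x _|].
  exact: row_continuous.
exact: compact_closed.
Qed.

Definition tensor n (phi : D) : testfun R n d := TestFun (tensor_powP n phi).

(* The (completed) symmetric tensor power of order n of D consists of the
   symmetric elements of C_c^oo((R^d)^n), and that of D' of the symmetric
   distributions on (R^d)^n. *)
Definition symmetric_testfun n (f : testfun R n d) :=
  forall s : 'S_n, f \o row_perm s =1 f.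

Definition symmetric_dual n (w : dual (testfun R n d)) :=
  forall (s : 'S_n) (f g : testfun R n d), g =1 f \o row_perm s -> w g = w f.

Lemma alphaP (phi : D) : (forall x, phi x < 1) ->
  (fun x => phi x / (phi x - 1)) \in @is_testfun R 1 d.
Proof.
move=> lt1; apply/asboolP; have /asboolP[sphi [K cK Kphi]] := testfunP phi.
split; last by exists K => // x Kx; rewrite Kphi// mul0r.
apply: (@smoothM _ _ _ phi (fun x => (phi x - 1)^-1)) => //.
apply: (@smoothV _ _ _ (fun x => phi x - 1)).
  by move=> x; rewrite subr_eq0 lt_eqF.
by apply: smoothD => //; exact: (smooth_cst (-1)).
Qed.

Definition alpha (phi : D) (phi_lt1 : forall x, phi x < 1) : D :=
  TestFun (alphaP phi_lt1).

Definition laplace (mu : probability D' R) (phi : D) : R :=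
  \int[mu]_w expR (w phi).

Definition gamma_noise (sigma : {measure set Rd -> \bar R})
    (mu : probability D' R) :=
  forall phi : D, (forall x, phi x < 1) ->
    laplace mu phi = expR (- \int[sigma]_x ln (1 - phi x)).

(* exp(<w, alpha(phi)>) / l_mu(alpha(phi)), with alpha(phi) = phi/(phi - 1). *)
Definition normalized_exp (mu : probability D' R) (phi : D)
    (phi_lt1 : forall x, phi x < 1) (w : D') : R :=
  expR (w (alpha phi_lt1)) / laplace mu (alpha phi_lt1).

(* L is the family of Taylor coefficients at 0 of the normalized exponential:
   the expansion on a neighbourhood of 0 in D (possibly depending on w) and the
   symmetry determine L n w on symmetric test functions. *)
Definition laguerre_kernels (mu : probability D' R)
    (L : forall n, D' -> dual (testfun R n d)) :=
  (forall n w, symmetric_dual (L n w)) /\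
  forall w : D', nbhs (0 : D) [set phi : D |
    exists phi_lt1 : forall x, phi x < 1,
      series (fun n => (n`!%:R)^-1 * L n w (tensor n phi)) @ \oo -->
      normalized_exp mu phi_lt1 w].

(* The #|I| variables y are attached to the blocks of I through enum I; the
   j-th argument of f is the variable of the block containing j. *)
Definition block_contraction n (I : {set {set 'I_n}}) (f : 'M[R]_(n, d) -> R)
    (y : #|I|.-tuple Rd) : R :=
  f (\matrix_(j < n) nth (0 : 'rV[R]_d) y (index (finset.pblock I j) (enum I))).

(* classical_sets also defines partition and pblock, hence the qualified
   names; blocks of a finset.partition are nonempty. *)
Definition ExpG_inner (sigma : {sigma_finite_measure set Rd -> \bar R}) n
    (phi psi : 'M[R]_(n, d) -> R) : R :=
  \sum_(I : {set {set 'I_n}} | finset.partition I [set: 'I_n])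
    (\prod_(1 <= k < n.+1) ((k.-1)`!)%:R ^+ #|[set B in I | #|B| == k]|) *
    \int[pow_measure sigma (k := #|I|)]_y
      (block_contraction (I := I) phi y * block_contraction (I := I) psi y).

End laguerre.

(* Main.v *)
(* Put e(phi) for the normalized exponential. Since
   1 - alpha(phi) - alpha(psi) = (1 - phi psi) / ((1 - phi) (1 - psi)), the
   Laplace transform gives E[e(phi) e(psi)] = exp (- <ln (1 - phi psi)>). The
   polynomial <L_n, phi^n> is the pointwise limit of difference quotients of
   t |-> e(t phi) at 0. The Gram matrices of these quotients are difference
   quotients of u |-> exp (- <ln (1 - u phi psi)>) = sum_n c_n u^n, hence
   converge, and Fatou's lemma identifies the limit of the quotients in L^2:
   E[<L_n, phi^n> <L_m, psi^m>] = delta_nm n!^2 c_n.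
   With a_k = <(phi psi)^k>, both c_n and the sum over all partitions of
   {1, ..., n} of the products of (|B| - 1)! a_|B|, divided by n!, satisfy
   (n + 1) c_(n + 1) = sum_(k <= n) a_(k + 1) c_(n - k): for partitions,
   condition on the block of a given element. This is the theorem for tensor
   powers, and by polarization for symmetrized tensor products.
   A symmetric test function is the limit in D of such combinations: apply
   Bernstein polynomials, in one coordinate after the other, to a mixed
   derivative of high order, integrate back, multiply by a product of cutoff
   functions, and symmetrize. The L^2 argument applies again. *)

Require Import Defs.
From mathcomp Require Import all_boot all_order all_algebra perm.
From mathcomp Require Import all_classical all_reals all_analysis.
From mathcomp Require Import measurable_realfun ring lra.

Set Implicit Arguments.
Unset Strict Implicit.
Unset Printing Implicit Defensive.

Import Order.TTheory GRing.Theory Num.Theory.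
Import numFieldNormedType.Exports.
Local Open Scope classical_set_scope.
Local Open Scope ring_scope.

(** * Finite differences *)

(** The expansion that defines the kernels holds on a neighbourhood of 0 that may depend on [w], and
    no integrability of [w |-> L n w f] is given, so it cannot be integrated term by term. Finite
    differences avoid this: each is a finite combination of normalized exponentials with steps
    chosen independently of [w], so its pairings are explicit, while its limit needs the expansion
    at one [w] at a time. The steps in the rows and in the columns of a Gram matrix shrink
    independently, and convergence is required along [filter_prod \oo \oo]: convergence of the
    diagonal alone would not make the quotients Cauchy. A second obstacle appears for general
    symmetric test functions: [L n w] is continuous only for the LF topology. The approximants must
    therefore converge with all their derivatives and keep their supports in one compact set, which
    forces approximation in C^N. The inner product, in contrast, needs only uniform convergence on
    that set. *)

Lemma cvg_sum {R : realType} {V : normedModType R} {T I : Type}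
    (F : set_system T) {FF : Filter F} (s : seq I) (P : pred I)
    (f : I -> T -> V) (l : I -> V) :
  (forall i, P i -> f i @ F --> l i) ->
  (fun t => \sum_(i <- s | P i) f i t) @ F --> \sum_(i <- s | P i) l i.
Proof. exact: (cvg_big (@add_continuous V)). Qed.

Section finite_differences.
Context {R : realType}.
Implicit Types (n m k : nat) (b c : nat -> R).

(** The nodes 0, ..., n are distinct, so their Vandermonde matrix is invertible, and the last column
    of the inverse gives the weights. Applied to the values [f (j * h)] and divided by [h ^ n], they
    extract the n-th Taylor coefficient itself, without a factor n!. *)
Lemma fd_weights_exist n : exists w : 'I_n.+1 -> R,
  forall k, (k <= n)%N -> \sum_j w j * j%:R ^+ k = (k == n)%:R.
Proof.
pose a : 'rV[R]_n.+1 := \row_j j%:R.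
have Vu : Vandermonde n.+1 a \in unitmx.
  rewrite unitmxE det_Vandermonde unitfE; apply/prodf_neq0 => i _.
  apply/prodf_neq0 => j ij; rewrite !mxE subr_eq0 eqr_nat.
  by rewrite neq_ltn ij orbT.
exists (fun j => (invmx (Vandermonde n.+1 a) *m delta_mx ord_max (ord0 : 'I_1)) j 0).
move=> k kn; pose k' : 'I_n.+1 := Ordinal (kn : (k < n.+1)%N).
have := mulKVmx Vu (delta_mx ord_max (ord0 : 'I_1)).
move=> /matrixP/(_ k' 0); rewrite [RHS]mxE eqxx andbT mxE => e.
transitivity ((k' == ord_max)%:R : R); last by rewrite -val_eqE.
rewrite -e; apply: eq_bigr => j _.
by rewrite [Vandermonde _ _ _ _]mxE [a _ _]mxE mulrC.
Qed.

Definition fd_weights n := sval (cid (fd_weights_exist n)).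
Arguments fd_weights n _ : clear implicits.

Lemma fd_weightsE n k : (k <= n)%N ->
  \sum_(j < n.+1) fd_weights n j * j%:R ^+ k = (k == n)%:R.
Proof. exact: (svalP (cid (fd_weights_exist n))). Qed.

Let fd_monomial n k (t : R) :=
  (\sum_(j < n.+1) fd_weights n j * j%:R ^+ k) * (t ^+ k / t ^+ n).

(** The weights annihilate [t ^ k] for [k < n] and give exactly 1 for [k = n]; for [k > n] a
    positive power of the step survives. *)
Let fd_monomial_cvg n k T (F : set_system T) {FF : Filter F} (h : T -> R) :
  (forall t, 0 < h t) -> h @ F --> 0 ->
  (fun t => fd_monomial n k (h t)) @ F --> ((k == n)%:R : R).
Proof.
move=> h0 hF; have [kn|kn] := leqP k n.
  rewrite /fd_monomial fd_weightsE //; have [->|] := eqVneq k n; last first.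
    by move=> _; under eq_fun do rewrite mul0r; exact: cvg_cst.
  under eq_fun => t do rewrite mul1r divff ?expf_neq0 ?gt_eqF//.
  exact: cvg_cst.
rewrite gtn_eqF // -[X in _ --> X](mulr0 (\sum_(j < n.+1) fd_weights n j * j%:R ^+ k)).
apply: cvgMr; rewrite (_ : (fun _ => _) = fun t => h t ^+ (k - n).-1 * h t).
  rewrite -[X in _ --> X](mulr0 (0 ^+ (k - n).-1)); apply: cvgM => //.
  have := @exprn_continuous R (k - n).-1 0.
  by move=> /(cvg_comp _ _ hF).
apply/funext => t; rewrite -exprSr prednK ?subn_gt0 //.
by rewrite -{1}(subnK (ltnW kn)) exprD mulfK // expf_neq0 ?gt_eqF.
Qed.

(** All nodes are nonnegative, so a one-sided expansion suffices. Its remainder is of order [n + 1]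
    in the step and keeps one factor [h t] after the division. *)
Lemma fd_cvg n b C r (f : R -> R) T (F : set_system T) {FF : Filter F}
    (h : T -> R) :
  0 < r ->
  (forall t, 0 <= t <= r ->
     `|f t - \sum_(k < n.+1) b k * t ^+ k| <= C * t ^+ n.+1) ->
  (forall t, 0 < h t) -> h @ F --> 0 ->
  (fun t => \sum_(j < n.+1) fd_weights n j * f (j%:R * h t) / h t ^+ n) @ F
    --> b n.
Proof.
move=> r0 fb h0 hF.
pose S := \sum_(j < n.+1) `|fd_weights n j| * (C * j%:R ^+ n.+1).
rewrite -[b n]addr0 (_ : (fun t => _) = (fun t =>
  \sum_(k < n.+1) b k * fd_monomial n k (h t) +
  \sum_(j < n.+1) fd_weights n j *
    (f (j%:R * h t) - \sum_(k < n.+1) b k * (j%:R * h t) ^+ k) / h t ^+ n)); last first.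
  apply/funext => t; under [X in _ + X]eq_bigr do rewrite mulrBr mulrBl.
  rewrite sumrB addrC -addrA [X in _ + X](_ : _ = 0) ?addr0 //.
  apply/eqP; rewrite addrC subr_eq0; apply/eqP.
  under [RHS]eq_bigr do rewrite mulr_sumr mulr_suml.
  rewrite exchange_big; apply: eq_bigr => k _ /=.
  rewrite /fd_monomial mulr_suml mulr_sumr; apply: eq_bigr => j _.
  by rewrite exprMn; ring.
apply: cvgD.
  rewrite [X in _ --> X](_ : _ = \sum_(k < n.+1) b k * (k == n :> nat)%:R).
    apply: cvg_sum => k _; apply: cvgMr; exact: fd_monomial_cvg.
  rewrite (bigD1 ord_max) //= eqxx mulr1 big1 ?addr0 // => k kn.
  by rewrite -val_eqE /= in kn; rewrite (negbTE kn) mulr0.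
apply/cvgr0Pnorm_le.
have Sh : (fun t => S * h t) @ F --> 0 by rewrite -[X in _ --> X](mulr0 S); exact: cvgMr.
move=> e e0; near=> t.
(* Keeps all the nodes [j * h t] with [j <= n] in the interval where the expansion holds. *)
have ht : h t <= r / n.+1%:R.
  near: t; move/cvgr0Pnorm_le : hF => /(_ (r / n.+1%:R)).
  rewrite divr_gt0 // => /(_ isT); apply: filterS => t; apply: le_trans.
  exact: ler_norm.
apply: (@le_trans _ _ (S * h t)); last first.
  apply: (le_trans (ler_norm _)); near: t.
  by move/cvgr0Pnorm_le : Sh; apply.
rewrite (le_trans (ler_norm_sum _ _ _)) // /S mulr_suml; apply: ler_sum => j _.
rewrite !normrM -!mulrA; apply: ler_wpM2l => //.
rewrite normfV normrX (gtr0_norm (h0 t)) ler_pdivrMr ?exprn_gt0 //.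
apply: le_trans (fb _ _) _.
  have ht0 := ltW (h0 t); rewrite mulr_ge0 ?ler0n //=.
  rewrite (@le_trans _ _ (n.+1%:R * h t)) //.
    by apply: ler_wpM2r => //; rewrite ler_nat ltnW.
  by rewrite mulrC -ler_pdivlMr.
by rewrite exprMn [h t ^+ n.+1]exprSr le_eqVlt; apply/orP; left; apply/eqP; ring.
Unshelve. all: by end_near. Qed.

(** This is the source of orthogonality: [g] is evaluated at a product of two variables, so only
    diagonal monomials [(s * t) ^ k] occur, and the two differences retain [k = n] and [k = m].
    Expanding to order [n + m] leaves a remainder [h ^ (m + 1) * h' ^ (n + 1)] after division, which
    vanishes without any relation between the two rates. *)
Lemma fd2_cvg n m c C r (g : R -> R) T (F : set_system T) {FF : Filter F}
    (h h' : T -> R) :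
  0 < r ->
  (forall u, 0 <= u <= r ->
     `|g u - \sum_(k < (n + m).+1) c k * u ^+ k| <= C * u ^+ (n + m).+1) ->
  (forall t, 0 < h t) -> h @ F --> 0 ->
  (forall t, 0 < h' t) -> h' @ F --> 0 ->
  (fun t => \sum_(i < n.+1) \sum_(j < m.+1) fd_weights n i * fd_weights m j *
      g ((i%:R * h t) * (j%:R * h' t)) / (h t ^+ n * h' t ^+ m)) @ F
    --> (n == m)%:R * c n.
Proof.
move=> r0 gc h0 hF h'0 h'F.
pose S := \sum_(i < n.+1) \sum_(j < m.+1)
  `|fd_weights n i * fd_weights m j| * (C * (i%:R * j%:R) ^+ (n + m).+1).
rewrite -[_ * c n]addr0 (_ : (fun t => _) = (fun t =>
  \sum_(k < (n + m).+1) c k * (fd_monomial n k (h t) * fd_monomial m k (h' t)) +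
  \sum_(i < n.+1) \sum_(j < m.+1) fd_weights n i * fd_weights m j *
    (g ((i%:R * h t) * (j%:R * h' t)) -
     \sum_(k < (n + m).+1) c k * ((i%:R * h t) * (j%:R * h' t)) ^+ k)
     / (h t ^+ n * h' t ^+ m))); last first.
  apply/funext => t.
  under [X in _ + X]eq_bigr do under eq_bigr do rewrite mulrBr mulrBl.
  under [X in _ + X]eq_bigr do rewrite sumrB.
  rewrite sumrB addrC -addrA [X in _ + X](_ : _ = 0) ?addr0 //.
  apply/eqP; rewrite addrC subr_eq0; apply/eqP.
  under [RHS]eq_bigr => i _ do (under eq_bigr => j _ do rewrite mulr_sumr mulr_suml;
    rewrite exchange_big).
  rewrite exchange_big; apply: eq_bigr => k _ /=.
  rewrite /fd_monomial !mulr_suml mulr_sumr; apply: eq_bigr => i _.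
  rewrite !mulr_sumr; apply: eq_bigr => j _.
  rewrite !exprMn; field.
  by rewrite !expf_neq0 ?gt_eqF.
apply: cvgD.
  rewrite [X in _ --> X](_ : _ = \sum_(k < (n + m).+1)
      c k * ((k == n :> nat)%:R * (k == m :> nat)%:R)).
    apply: cvg_sum => k _; apply: cvgMr; apply: cvgM; exact: fd_monomial_cvg.
  have nlt : (n < (n + m).+1)%N by rewrite ltnS leq_addr.
  rewrite (bigD1 (Ordinal nlt)) //= eqxx mul1r big1 ?addr0 ?(mulrC (c n)) // => k kn.
  by rewrite -val_eqE /= in kn; rewrite (negbTE kn) mul0r mulr0.
apply/cvgr0Pnorm_le.
have Sh : (fun t => S * (h t ^+ m.+1 * h' t ^+ n.+1)) @ F --> 0.
  rewrite -[X in _ --> X](mulr0 S); apply: cvgMr.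
  rewrite -[X in _ --> X](mulr0 0); apply: cvgM.
    have := @exprn_continuous R m.+1 0; rewrite /continuous_at expr0n /=.
    by move=> /(cvg_comp _ _ hF).
  have := @exprn_continuous R n.+1 0; rewrite /continuous_at expr0n /=.
  by move=> /(cvg_comp _ _ h'F).
have hle (a : T -> R) (q : R) : a @ F --> 0 -> 0 < q -> \forall t \near F, a t <= q.
  move=> aF q0; move/cvgr0Pnorm_le : aF => /(_ _ q0).
  by apply: filterS => s; apply: le_trans; exact: ler_norm.
move=> e e0; near=> t.
(* The first node is then at most 1 and the second at most [r], so their product stays in
   [[0, r]]. *)
have ht : h t <= n.+1%:R^-1 by near: t; apply: hle => //; rewrite invr_gt0.
have h't : h' t <= r / m.+1%:R by near: t; apply: hle => //; rewrite divr_gt0.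
apply: (@le_trans _ _ (S * (h t ^+ m.+1 * h' t ^+ n.+1))); last first.
  apply: (le_trans (ler_norm _)); near: t.
  by move/cvgr0Pnorm_le : Sh; apply.
rewrite (le_trans (ler_norm_sum _ _ _)) // /S mulr_suml; apply: ler_sum => i _.
rewrite (le_trans (ler_norm_sum _ _ _)) // mulr_suml; apply: ler_sum => j _.
have hh0 : 0 < h t ^+ n * h' t ^+ m by rewrite mulr_gt0 ?exprn_gt0.
rewrite normrM [`|_ * _ * (_ - _)|]normrM -!mulrA; apply: ler_wpM2l => //.
rewrite normfV (gtr0_norm hh0) ler_pdivrMr // [i%:R * (h t * _)]mulrA.
apply: le_trans (gc _ _) _.
  have ht0 := ltW (h0 t); have h't0 := ltW (h'0 t).
  rewrite !mulr_ge0 ?ler0n //= -[r]mul1r; apply: ler_pM; rewrite ?mulr_ge0 ?ler0n //.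
    rewrite (@le_trans _ _ (n.+1%:R * h t)) //.
      by apply: ler_wpM2r => //; rewrite ler_nat ltnW.
    by rewrite mulrC -ler_pdivlMr // div1r.
  rewrite (@le_trans _ _ (m.+1%:R * h' t)) //.
    by apply: ler_wpM2r => //; rewrite ler_nat ltnW.
  by rewrite mulrC -ler_pdivlMr.
rewrite le_eqVlt; apply/orP; left; apply/eqP.
by rewrite !exprMn !exprS !exprD; ring.
Unshelve. all: by end_near. Qed.

End finite_differences.
Arguments fd_weights {R} n _.

(** * Sums over set partitions *)

Section partition_sums.
Import mathcomp.boot.fintype mathcomp.boot.finset.
Context {R : realType} {T : finType}.
Implicit Types (A B D : {set T}) (P : {set {set T}}).

Definition partition_sum (f : nat -> R) A : R :=
  \sum_(P : {set {set T}} | partition P A) \prod_(B in P) f #|B|.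

Lemma partition_sum_rec (f : nat -> R) (x : T) A : x \in A ->
  partition_sum f A =
  \sum_(B : {set T} | (x \in B) && (B \subset A)) f #|B| * partition_sum f (A :\: B).
Proof.
move=> xA; rewrite /partition_sum.
rewrite (partition_big (fun P : {set {set T}} => pblock P x)
  (fun B : {set T} => (x \in B) && (B \subset A))) /=; last first.
  move=> P PA; have cP := cover_partition PA.
  by rewrite mem_pblock cP xA (partitionS PA) ?pblock_mem ?cP.
apply: eq_bigr => B /andP[xB BA].
rewrite big_distrr /= (reindex_onto (fun P : {set {set T}} => B |: P) (fun P : {set {set T}} => P :\ B)) /=; last first.
  move=> P /andP[PA /eqP PB]; rewrite setD1K // -PB pblock_mem //.
  by rewrite (cover_partition PA).
have B0 : B != set0 by apply/set0Pn; exists x.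
apply: eq_big => [P|P /andP[_ /eqP BP]]; last first.
  by rewrite big_setU1 //= -BP !inE eqxx.
apply/idP/idP => [/andP[/andP[PA _] /eqP <-]|PAB].
  by apply: partitionD1 => //; rewrite !inE eqxx.
have disB : [disjoint B & A :\: B]%B.
  by rewrite disjoint_sym -setI_eq0 setDE -setIA [~: B :&: B]setIC setICr setI0.
have BnP : B \notin P.
  apply/negP => BP; have := partitionS PAB BP.
  move=> /subsetP/(_ x xB); by rewrite !inE xB.
have PA : partition (B |: P) A.
  rewrite (_ : A = B :|: (A :\: B)); first exact: partitionU1.
  by apply/setP => y; rewrite !inE; case: (boolP (y \in B)) => // /(subsetP BA) ->.
rewrite PA /= setU1K // eqxx andbT; apply/eqP.
by apply: (def_pblock (partition_trivIset PA)) => //; rewrite !inE eqxx.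
Qed.

Lemma sum_subset_card (f : nat -> R) D :
  \sum_(B : {set T} | B \subset D) f #|B| = \sum_(k < #|D|.+1) 'C(#|D|, k)%:R * f k.
Proof.
rewrite (partition_big (fun B : {set T} => inord #|B| : 'I_#|D|.+1) predT) //=.
apply: eq_bigr => k _; rewrite -cards_draws -[X in _ = X%:R * _]sum1_card natr_sum mulr_suml.
apply: eq_big => [B|B /andP[BD /eqP <-]].
  rewrite inE; case: (boolP (B \subset D)) => //= BD.
  by rewrite -val_eqE /= inordK // ltnS subset_leq_card.
by rewrite inordK ?mul1r // ltnS subset_leq_card.
Qed.

(** Induction on the size of [A]. With [n + 1] elements, a block of size [k + 1] around [x] carries
    [k!], the rest gives [(n - k)!] by induction, and the ['C(n, k)] choices of the block turn both
    into [n!]; what is left is the recursion for [c]. *)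
Lemma partition_sumE (a c : nat -> R) A :
  c 0%N = 1 ->
  (forall n, n.+1%:R * c n.+1 = \sum_(k < n.+1) a k.+1 * c (n - k)%N) ->
  partition_sum (fun k => (k.-1)`!%:R * a k) A = (#|A|)`!%:R * c #|A|.
Proof.
move=> c0 cS; move: {2}#|A|.+1 (ltnSn #|A|) => N.
elim: N A => // N IH A; rewrite ltnS => AN.
have [->|[x xA]] := set_0Vmem A.
  rewrite cards0 c0 mul1r /partition_sum (big_pred1 set0) => [|P].
    by rewrite big_set0.
  by rewrite partition_set0.
rewrite (partition_sum_rec _ xA).
rewrite (reindex_onto (fun B : {set T} => x |: B) (fun B : {set T} => B :\ x)) /=; last first.
  by move=> B /andP[xB _]; rewrite setD1K.
have cA : #|A| = #|A :\ x|.+1 by rewrite (cardsD1 x) xA.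
set n := #|A :\ x| in cA.
pose F k := k`!%:R * a k.+1 * ((n - k)`!%:R * c (n - k)%N).
transitivity (\sum_(B : {set T} | B \subset A :\ x) F #|B|).
  apply: eq_big => [B|B].
    rewrite !inE eqxx /= subUset sub1set xA /= subsetD1.
    case: (boolP (B \subset A)) => //= BA.
    apply/eqP/idP => [<-|xB]; first by rewrite !inE eqxx.
    by rewrite setU1K.
  move=> /andP[/andP[_ BA] /eqP Bx].
  have xB : x \notin B by rewrite -Bx !inE eqxx.
  have BA' : B \subset A by apply: subset_trans BA; exact: subsetUr.
  rewrite cardsU1 xB add1n /=; congr (_ * _).
  have cAB : #|A :\: (x |: B)| = (n - #|B|)%N.
    by rewrite cardsD (setIidPr BA) cardsU1 xB add1n cA subSS.
  rewrite IH cAB // (leq_ltn_trans (leq_subr _ _)) //.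
  by rewrite cA in AN.
rewrite (sum_subset_card F) -/n /F cA factS natrM -mulrA mulrCA cS !mulr_sumr.
apply: eq_bigr => -[k kn] _ /=; rewrite ltnS in kn.
by rewrite -(bin_fact kn) !natrM; ring.
Qed.

Lemma prod_partition_size n (g : nat -> R) P A :
  partition P A -> #|A| = n ->
  \prod_(1 <= k < n.+1) g k ^+ #|[set B in P | #|B| == k]| = \prod_(B in P) g #|B|.
Proof.
move=> PA An.
rewrite [RHS](partition_big (fun B : {set T} => inord #|B| : 'I_n.+1) predT) //=.
have szB B : B \in P -> (0 < #|B| < n.+1)%N.
  move=> BP; rewrite card_gt0 (partition_neq0 PA BP) ltnS -An.
  exact: subset_leq_card (partitionS PA BP).
(* The sizes on the left start at 1, those in ['I_n.+1] at 0; blocks are nonempty, so the extra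
   factor is an empty product. *)
rewrite big_add1 big_mkord big_ord_recl [X in _ = X * _]big1 ?mul1r; last first.
  move=> B /andP[BP]; rewrite -val_eqE /=.
  by have /andP[B0 Bn] := szB _ BP; rewrite inordK // => /eqP B0'; rewrite B0' in B0.
apply: eq_bigr => k _; rewrite -prodr_const.
apply: eq_big => [B|B].
  rewrite !inE; case: (boolP (B \in P)) => //= /szB /andP[B0 Bn].
  by rewrite -val_eqE /= inordK.
by rewrite !inE => /andP[_ /eqP ->].
Qed.

End partition_sums.

(** * Limits of products in L^2 *)

Section has_integral.
Context {disp : measure_display} {T : measurableType disp} {R : realType}.
Variable mu : {measure set T -> \bar R}.
Implicit Types (f g : T -> R) (c a b : R).

(** Integrability travels with the value: an equation between real-valued integrals would not
    exclude a divergent one, whose [fine] is 0. *)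
Definition has_integral f c :=
  mu.-integrable setT (EFin \o f) /\ (\int[mu]_t (f t)%:E)%E = c%:E.

Lemma has_integral_ext f g c : f =1 g -> has_integral f c -> has_integral g c.
Proof. by move=> /funext ->. Qed.

Lemma has_integral_Rintegral f c : has_integral f c -> \int[mu]_t f t = c.
Proof. by move=> [_ fc]; rewrite /Rintegral fc. Qed.

Lemma integrable_has_integral f :
  mu.-integrable setT (EFin \o f) -> has_integral f (\int[mu]_t f t).
Proof. by move=> fi; split => //; rewrite fineK //; exact: integrable_fin_num. Qed.

Lemma has_integral_measurable f c : has_integral f c -> measurable_fun setT f.
Proof. by move=> [/integrableP[/measurable_EFinP]]. Qed.

Lemma has_integral0 : has_integral (fun=> 0) 0.
Proof. by split; [exact: integrable0|exact: integral0]. Qed.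

Lemma has_integralD f g a b : has_integral f a -> has_integral g b ->
  has_integral (fun t => f t + g t) (a + b).
Proof.
move=> [fi fa] [gi gb]; split; first exact: (integrableD _ fi gi).
by rewrite EFinD -fa -gb; exact: (integralD_EFin _ fi gi).
Qed.

Lemma has_integralZ f a k : has_integral f a ->
  has_integral (fun t => k * f t) (k * a).
Proof.
move=> [fi fa]; split; first exact: (integrableZl _ k fi).
by rewrite EFinM -fa; exact: (integralZl _ fi k).
Qed.

Lemma has_integral_sum (I : Type) (s : seq I) (P : pred I) (f : I -> T -> R)
    (c : I -> R) : (forall i, P i -> has_integral (f i) (c i)) ->
  has_integral (fun t => \sum_(i <- s | P i) f i t) (\sum_(i <- s | P i) c i).
Proof.
move=> fc; elim: s => [|i s IH].
  rewrite big_nil; apply: has_integral_ext has_integral0 => t.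
  by rewrite big_nil.
rewrite big_cons; case: ifPn => [Pi|nPi].
  apply: has_integral_ext (has_integralD (fc _ Pi) IH) => t.
  by rewrite big_cons Pi.
by apply: has_integral_ext IH => t; rewrite big_cons (negbTE nPi).
Qed.

Lemma ge0_has_integral f c : (forall t, 0 <= f t) -> measurable_fun setT f ->
  (\int[mu]_t (f t)%:E)%E = c%:E -> has_integral f c.
Proof.
move=> f0 mf fc; split => //; apply/integrableP; split; first exact/measurable_EFinP.
under eq_integral => t _ do rewrite /= ger0_norm //.
by rewrite fc ltry.
Qed.

End has_integral.

Section L2_limits.
Context {disp : measure_display} {T : measurableType disp} {R : realType}.
Variable mu : {measure set T -> \bar R}.
Local Notation hasint := (has_integral mu).

Let limn_einf_le (u : (\bar R)^nat) (C : \bar R) :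
  (forall n, u n <= C)%E -> (limn_einf u <= C)%E.
Proof.
move=> uC; rewrite limn_einf_lim; apply: lime_le; first exact: is_cvg_einfs.
by apply: nearW => n; apply: le_trans (uC n); apply: ereal_inf_lbound; exists n => /=.
Qed.

Let fatou_le (f : nat -> T -> R) (g : T -> R) (C : R) :
  (forall n t, 0 <= f n t) -> (forall n, measurable_fun setT (f n)) ->
  (forall t, f ^~ t @ \oo --> g t) ->
  (forall n, (\int[mu]_t (f n t)%:E)%E <= C%:E)%E ->
  (\int[mu]_t (g t)%:E <= C%:E)%E.
Proof.
move=> f0 mf fg fC.
have mf' n : measurable_fun setT (EFin \o f n) by exact/measurable_EFinP.
have := @fatou _ _ _ mu _ measurableT (fun n => EFin \o f n) mf'.
move=> /(_ (fun n t _ => f0 n t)) fat.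
have -> : (\int[mu]_t (g t)%:E = \int[mu]_t limn_einf ((EFin \o f ^~ t)))%E.
  apply: eq_integral => t _; apply/esym.
  have fgE : (EFin \o f ^~ t) @ \oo --> (g t)%:E.
    by apply/fine_cvgP; split; [exact: nearW|exact: fg].
  by have [-> _] := cvg_limn_einf_sup fgE.
by apply: le_trans fat _; exact: limn_einf_le.
Qed.

Lemma cvg_filter_prodP (u : nat * nat -> R) (c : R) :
  u @ filter_prod \oo \oo --> c -> forall e, 0 < e ->
  exists K, forall k l, (K <= k)%N -> (K <= l)%N -> `|u (k, l) - c| <= e.
Proof.
move=> /cvgr_distC_le uc e e0; have := uc _ e0.
move=> [[A B] /= [[N _ NA] [M _ MB]] AB]; exists (maxn N M) => k l.
rewrite !geq_max => /andP[Nk Mk] /andP[Nl Ml].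
by apply: (AB (k, l)); split; [exact: NA|exact: MB].
Qed.

(* If the Gram matrix of X converges, then X is Cauchy in L^2 and Fatou's lemma
   identifies the limit with the pointwise one. *)
Lemma L2_limit (X : nat -> T -> R) (x : T -> R) (c : nat -> nat -> R) (l : R) :
  (forall t, X ^~ t @ \oo --> x t) ->
  (forall k, measurable_fun setT (X k)) ->
  (forall j k, hasint (fun t => X j t * X k t) (c j k)) ->
  (fun jk => c jk.1 jk.2) @ filter_prod \oo \oo --> l ->
  hasint (fun t => x t * x t) l.
Proof.
move=> Xx mX Xc cl.
have mx : measurable_fun setT x by apply: measurable_fun_cvg mX _ => t _; exact: Xx.
have mxx : measurable_fun setT (fun t => x t * x t) by exact: measurable_funM.
have xx0 t : 0 <= x t * x t by rewrite -expr2 sqr_ge0.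
pose A := (\int[mu]_t (x t * x t)%:E)%E.
have A0 : (0 <= A)%E by apply: integral_ge0 => t _; rewrite lee_fin.
(* The square norm of [X k - X j] is [c k k - 2 * c k j + c j j], and each entry is within [e] of
   [l]: hence [4 * e]. Fatou's lemma then lets [j] tend to infinity. *)
have Xle e : 0 < e -> exists K, forall k, (K <= k)%N ->
    (\int[mu]_t ((X k t - x t) ^+ 2)%:E <= (4 * e)%:E)%E /\
    (A <= (l + e)%:E)%E /\ (l - e <= c k k).
  move=> e0; have [K hK] := cvg_filter_prodP cl e0.
  exists K => k Kk; split; last split.
  - apply: (@fatou_le (fun j t => (X k t - X (j + K)%N t) ^+ 2)).
    + by move=> *; exact: sqr_ge0.
    + by move=> j; apply: measurable_funX; exact: measurable_funB.
    + move=> t; under eq_fun do rewrite expr2; rewrite expr2.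
      have h : (fun j => X k t - X (j + K)%N t) @ \oo --> X k t - x t.
        apply: cvgB; first exact: cvg_cst.
        by have := Xx t; rewrite -(cvg_shiftn K).
      exact: cvgM.
    + move=> j; set j' := (j + K)%N.
      have Kj : (K <= j')%N by rewrite leq_addl.
      have [_ ->] : hasint (fun t => (X k t - X j' t) ^+ 2)
          (c k k + (-2 * c k j' + c j' j')).
        apply: has_integral_ext
          (has_integralD (Xc k k) (has_integralD (has_integralZ (-2) (Xc k j')) (Xc j' j'))).
        by move=> t; ring.
      rewrite lee_fin.
      have := hK _ _ Kk Kk; have := hK _ _ Kk Kj; have := hK _ _ Kj Kj.
      by rewrite /= !ler_norml; lra.
  - apply: (@fatou_le (fun j t => X (j + K)%N t * X (j + K)%N t)).
    + by move=> *; rewrite -expr2 sqr_ge0.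
    + by move=> j; exact: measurable_funM.
    + by move=> t; apply: cvgM; have := Xx t; rewrite -(cvg_shiftn K).
    + move=> j; have [_ ->] := Xc (j + K)%N (j + K)%N.
      have Kj : (K <= j + K)%N by rewrite leq_addl.
      by rewrite lee_fin; have := hK _ _ Kj Kj; rewrite /= ler_norml; lra.
  - by have := hK _ _ Kk Kk; rewrite /= ler_norml; lra.
have Al : (A <= l%:E)%E.
  apply/lee_addgt0Pr => e e0; have [K /(_ K (leqnn _))[_ [+ _]]] := Xle _ e0.
  by rewrite EFinD.
have Afin : A \is a fin_num.
  by rewrite ge0_fin_numE // (le_lt_trans Al) // ltry.
apply: ge0_has_integral => //.
apply/eqP; rewrite eq_le Al /= -/A -(fineK Afin) lee_fin.
set a := fine A; have a0 : 0 <= a by exact: fine_ge0.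
apply/ler_addgt0Pr => e e0.
(* With tolerance [d * d] in [Xle] the estimate below reads [l <= a + d * a + 5 * d * d + 4 * d],
   and [d <= 1] bounds the excess by [d * (a + 9)]. *)
pose d := Num.min 1 (e / (a + 9)).
have d0 : 0 < d by rewrite lt_min ltr01 divr_gt0 // ltr_wpDl.
have d1 : d <= 1 by rewrite ge_min lexx.
have de : d * (a + 9) <= e.
  by rewrite -ler_pdivlMr ?ltr_wpDl // ge_min lexx orbT.
have [K /(_ K (leqnn _))[XK [_ lK]]] := Xle _ (mulr_gt0 d0 d0).
have mY : measurable_fun setT (fun t => (X K t - x t) ^+ 2).
  by apply: measurable_funX; exact: measurable_funB.
have cK : ((c K K)%:E <= (1 + d)%:E * A + (1 + d^-1)%:E * (4 * (d * d))%:E)%E.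
  have [_ <-] := Xc K K.
  apply: (@le_trans _ _ (\int[mu]_t ((1 + d)%:E * (x t * x t)%:E +
     (1 + d^-1)%:E * ((X K t - x t) ^+ 2)%:E)))%E.
    apply: ge0_le_integral => //.
    - by move=> t _; rewrite lee_fin -expr2 sqr_ge0.
    - by apply/measurable_EFinP; exact: measurable_funM.
    - apply: emeasurable_funD; apply: measurable_funeM; exact/measurable_EFinP.
    move=> t _; rewrite -!EFinM -EFinD lee_fin -subr_ge0.
    (* Young's inequality with weight [d] for [X K = x + (X K - x)]: the defect is a square. *)
    rewrite (_ : _ - _ = (d * x t - (X K t - x t)) ^+ 2 / d).
      by rewrite divr_ge0 ?sqr_ge0 // ltW.
    by field; rewrite gt_eqF.
  have dV0 : 0 <= 1 + d^-1 by rewrite addr_ge0 // invr_ge0 ltW.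
  have d10 : 0 <= 1 + d by rewrite addr_ge0 // ltW.
  rewrite ge0_integralD //; first last.
  - by apply: measurable_funeM; exact/measurable_EFinP.
  - by move=> t _; rewrite -EFinM lee_fin mulr_ge0 ?sqr_ge0.
  - by apply: measurable_funeM; exact/measurable_EFinP.
  - by move=> t _; rewrite -EFinM lee_fin mulr_ge0.
  have Z k (f : T -> R) : 0 <= k -> (forall t, 0 <= f t) -> measurable_fun setT f ->
      (\int[mu]_t (k%:E * (f t)%:E) = k%:E * \int[mu]_t (f t)%:E)%E.
    move=> k0 f0 mf; apply: ge0_integralZl => //; first exact/measurable_EFinP.
    by move=> t _; rewrite lee_fin.
  rewrite !Z //; last by move=> t; exact: sqr_ge0.
  by apply: leeD => //; apply: lee_wpmul2l; rewrite ?lee_fin.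
move: cK; rewrite -(fineK Afin) -/a -!EFinM -EFinD lee_fin.
rewrite (_ : (1 + d^-1) * _ = 4 * (d * d) + 4 * d); last by field; rewrite gt_eqF.
have dd : d * d <= d by rewrite ger_pMr.
move: lK dd de; rewrite !mulrDl !mulrDr; lra.
Qed.

(** Polarization: [L2_limit] applies to [X + s * Y] for [s = 1] and [s = -1], and [4 * x * y] is the
    difference of the two squares. Expanding the Gram matrix produces the mixed entries in both
    orders, hence the swapped limit. *)
Lemma L2_limit2 (X Y : nat -> T -> R) (x y : T -> R)
    (cX cY c : nat -> nat -> R) (lX lY l : R) :
  (forall t, X ^~ t @ \oo --> x t) -> (forall t, Y ^~ t @ \oo --> y t) ->
  (forall k, measurable_fun setT (X k)) -> (forall k, measurable_fun setT (Y k)) ->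
  (forall j k, hasint (fun t => X j t * X k t) (cX j k)) ->
  (forall j k, hasint (fun t => Y j t * Y k t) (cY j k)) ->
  (forall j k, hasint (fun t => X j t * Y k t) (c j k)) ->
  (fun jk => cX jk.1 jk.2) @ filter_prod \oo \oo --> lX ->
  (fun jk => cY jk.1 jk.2) @ filter_prod \oo \oo --> lY ->
  (fun jk => c jk.1 jk.2) @ filter_prod \oo \oo --> l ->
  hasint (fun t => x t * y t) l.
Proof.
move=> Xx Yy mX mY XX YY XY cXl cYl cl.
have cl' : (fun jk => c jk.2 jk.1) @ filter_prod \oo \oo --> l.
  apply: (@cvg_comp _ _ _ (fun jk => (jk.2, jk.1)) (fun jk => c jk.1 jk.2) _
    (filter_prod \oo \oo)) => //.
  move=> P [[A B] /= [A1 B1] AB]; exists (B, A) => //= -[j k] [/= Bj Ak].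
  exact: AB.
have pm (s : R) : hasint (fun t => (x t + s * y t) * (x t + s * y t))
    (lX + (s * l + (s * l + (s * s) * lY))).
  apply: (@L2_limit (fun k t => X k t + s * Y k t) _
    (fun j k => cX j k + (s * c j k + (s * c k j + (s * s) * cY j k)))).
  - by move=> t; apply: cvgD => //; apply: cvgMr.
  - by move=> k; apply: measurable_funD => //; apply: measurable_funM.
  - move=> j k.
    apply: has_integral_ext (has_integralD (XX j k) (has_integralD
      (has_integralZ s (XY j k)) (has_integralD (has_integralZ s (XY k j))
      (has_integralZ (s * s) (YY j k))))) => t; ring.
  - by apply: cvgD => //; apply: cvgD; [|apply: cvgD]; apply: cvgMr.
have -> : l = 4^-1 * (lX + (1 * l + (1 * l + (1 * 1) * lY))) +
  (- 4^-1) * (lX + (-1 * l + (-1 * l + (-1 * -1) * lY))) by field.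
by apply: has_integral_ext (has_integralD (has_integralZ 4^-1 (pm 1))
  (has_integralZ (- 4^-1) (pm (-1)))) => t; field.
Qed.

End L2_limits.

(** * Smooth functions of a matrix *)

Section partial_derivatives.
Context {R : realType} {m n : nat}.
Local Notation V := 'M[R]_(m, n).
Implicit Types (f g : V -> R) (s t : seq ('I_m * 'I_n)) (x y u v : V).
Implicit Types (c : 'I_m * 'I_n) (K : set V).

Local Notation "''d_' c f" := (fun x => 'D_(delta_mx c.1 c.2 : V) f x)
  (at level 10, c at level 0, f at level 9, format "''d_' c  f").

Lemma eq_smooth f g : f =1 g -> smooth f -> smooth g.
Proof. by move=> /funext ->. Qed.

Lemma smooth_differentiable f x : smooth f -> differentiable f x.
Proof. by move=> /(_ [::] x). Qed.

Lemma smooth_partial f c : smooth f -> smooth ('d_c f).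
Proof. by move=> sf s; exact: (sf (c :: s)). Qed.

Lemma smooth_pderiv f s : smooth f -> smooth (pderiv s f).
Proof. by elim: s f => [//|c s IH] f sf; apply: IH; exact: smooth_partial. Qed.

Lemma smooth_continuous f : smooth f -> continuous f.
Proof. by move=> sf x; exact/differentiable_continuous/smooth_differentiable. Qed.

Lemma pderiv_cat s t f : pderiv (s ++ t) f = pderiv t (pderiv s f).
Proof. by elim: s f => //= c s IH f; rewrite IH. Qed.

Lemma pderiv_rcons s c f : pderiv (rcons s c) f = 'd_c (pderiv s f).
Proof. by rewrite -cats1 pderiv_cat. Qed.

Lemma smoothZ (a : R) f : smooth f -> smooth (a *: f).
Proof. by move=> sf; apply: (smoothM (smooth_cst a)). Qed.

Lemma smoothB f g : smooth f -> smooth g -> smooth (f - g).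
Proof.
by move=> sf sg; apply: smoothD => //; rewrite -scaleN1r; exact: smoothZ.
Qed.

Lemma smooth_sum (I : Type) (r : seq I) (P : pred I) (F : I -> V -> R) :
  (forall i, P i -> smooth (F i)) -> smooth (fun x => \sum_(i <- r | P i) F i x).
Proof.
move=> sF; rewrite (_ : (fun x => _) = \sum_(i <- r | P i) F i); last first.
  by apply/funext => x; rewrite fct_sumE.
by elim/big_ind : _ => //; [exact: (smooth_cst 0)|exact: smoothD].
Qed.

Lemma smooth_prod (I : Type) (r : seq I) (P : pred I) (F : I -> V -> R) :
  (forall i, P i -> smooth (F i)) -> smooth (fun x => \prod_(i <- r | P i) F i x).
Proof.
move=> sF; rewrite (_ : (fun x => _) = \prod_(i <- r | P i) F i); last first.
  by apply/funext => x; rewrite fct_prodE.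
by elim/big_ind : _ => //; [exact: (smooth_cst 1)|exact: smoothM].
Qed.

Lemma pderivD s f g : smooth f -> smooth g ->
  pderiv s (f + g) = pderiv s f + pderiv s g.
Proof.
elim: s f g => [//|c s IH] f g sf sg /=.
rewrite -IH; try exact: smooth_partial.
congr (pderiv s _); apply/funext => x; rewrite deriveD //; apply: diff_derivable;
  exact: smooth_differentiable.
Qed.

Lemma pderivZ s (a : R) f : smooth f -> pderiv s (a *: f) = a *: pderiv s f.
Proof.
elim: s f => [//|c s IH] f sf /=; rewrite -IH; last exact: smooth_partial.
congr (pderiv s _); apply/funext => x; rewrite deriveZ //; apply: diff_derivable.
exact: smooth_differentiable.
Qed.

Lemma pderivB s f g : smooth f -> smooth g ->
  pderiv s (f - g) = pderiv s f - pderiv s g.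
Proof.
move=> sf sg; rewrite -scaleN1r pderivD //; last exact: smoothZ.
by rewrite pderivZ // scaleN1r.
Qed.

Lemma supported_in_pderiv K s f : closed K -> supported_in K f ->
  supported_in K (pderiv s f).
Proof.
move=> clK; elim: s f => [//|c s IH] f fK; apply: IH => x Kx.
rewrite (@near_eq_derive _ _ _ _ (cst 0)).
  by rewrite derive_cst.
have : nbhs x (~` K) by apply: open_nbhs_nbhs; split => //; exact: closed_openC.
by apply: filterS => y Ky; rewrite fK.
Qed.

Lemma is_derive_line f x v (r : R) : differentiable f (x + r *: v) ->
  is_derive r 1 (fun r : R => f (x + r *: v)) ('D_v f (x + r *: v)).
Proof.
move=> df; have dfv : derivable f (x + r *: v) v := diff_derivable df.
have e : (fun h : R => h^-1 *: ((f \o shift (x + r *: v)) (h *: v) - f (x + r *: v))) =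
  (fun h : R => h^-1 *: (((fun r : R => f (x + r *: v)) \o shift r) (h *: 1) - f (x + r *: v))).
  apply/funext => h /=; congr (_ *: (f _ - _)).
  by rewrite scalerDl addrCA /GRing.scale /= mulr1.
apply: DeriveDef; first by move: dfv; rewrite /derivable e.
by rewrite /derive e.
Qed.

Lemma line_MVT f x v (r : R) : 0 <= r -> (forall y, differentiable f y) ->
  exists2 q, 0 <= q <= r & f (x + r *: v) - f x = r * 'D_v f (x + q *: v).
Proof.
move=> r0 df.
have cf : {within `[0, r], continuous (fun r => f (x + r *: v))}.
  apply: continuous_subspaceT => q.
  have [+ _] := is_derive_line (df (x + q *: v)).
  by move=> /derivable1_diffP/differentiable_continuous.
have [q + ] := MVT_segment r0 (fun q _ => is_derive_line (df (x + q *: v))) cf.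
rewrite in_itv /= => qr; rewrite scale0r addr0 subr0 => ->; exists q => //.
by rewrite mulrC.
Qed.

Lemma derive_shift f v y (w : V) : 'D_v (fun y => f (y + w)) y = 'D_v f (y + w).
Proof.
rewrite /derive; set F := fun h => _; set G := fun h => _.
suff -> : F = G by [].
by apply/funext => h; rewrite /F /G /= addrA.
Qed.

Lemma Schwarz f u v x : (forall y, differentiable f y) ->
  (forall y, differentiable ('D_u f) y) -> (forall y, differentiable ('D_v f) y) ->
  {for x, continuous ('D_v ('D_u f))} -> {for x, continuous ('D_u ('D_v f))} ->
  'D_v ('D_u f) x = 'D_u ('D_v f) x.
Proof.
move=> df du dv cvu cuv.
(* The second difference is symmetric in the two directions, and two
   applications of the mean value theorem turn it into a mixed derivative. *)
have key a b r : 0 <= r -> (forall y, differentiable ('D_a f) y) ->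
    exists q p, [/\ 0 <= q <= r, 0 <= p <= r &
      f (x + r *: a + r *: b) - f (x + r *: a) - (f (x + r *: b) - f x) =
      r * r * 'D_b ('D_a f) (x + q *: a + p *: b)].
  move=> r0 da; pose g y := f (y + r *: b) - f y.
  have dsh y : differentiable (fun y => f (y + r *: b)) y.
    by apply: (@differentiable_comp _ _ _ _ (fun y => y + r *: b) f).
  have dg y : differentiable g y by apply: differentiableB.
  have [q q0r e1] := line_MVT x a r0 dg.
  have [p p0r e2] := line_MVT (x + q *: a) b r0 da.
  have e3 : 'D_a g (x + q *: a) =
      'D_a f (x + q *: a + r *: b) - 'D_a f (x + q *: a).
    rewrite /g deriveB; [|exact: diff_derivable..].
    by rewrite derive_shift.
  exists q, p; split => //.
  by rewrite -[LHS]/(g (x + r *: a) - g x) e1 e3 e2 mulrA.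
apply/eqP; rewrite -subr_eq0 -normr_le0; apply/ler_addgt0Pr => e e0; rewrite add0r.
have e20 : 0 < e / 2 by rewrite divr_gt0.
have /cvgr_distC_le/(_ _ e20)/nbhs_ballP[d1 d10 h1] := cvu.
have /cvgr_distC_le/(_ _ e20)/nbhs_ballP[d2 d20 h2] := cuv.
pose d := Num.min d1 d2.
have d0 : 0 < d by rewrite lt_min d10.
pose r := d / (`|u| + `|v| + 1).
have uv0 : 0 < `|u| + `|v| + 1 by rewrite ltr_wpDl // addr_ge0.
have r0 : 0 < r by rewrite divr_gt0.
have near_x a b q p : (a = u /\ b = v) \/ (a = v /\ b = u) ->
    0 <= q <= r -> 0 <= p <= r -> ball x d (x + q *: a + p *: b).
  move=> ab /andP[q0 qr] /andP[p0 pr]; rewrite -ball_normE /ball_.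
  suff: `|x - (x + q *: a + p *: b)| < d by [].
  rewrite -addrA opprD addNKr normrN (le_lt_trans (ler_normD _ _)) // !normrZ !ger0_norm //.
  rewrite (@le_lt_trans _ _ (r * (`|u| + `|v|))) //.
    rewrite mulrDr; case: ab => -[-> ->]; last rewrite addrC; apply: lerD; exact: ler_wpM2r.
  by rewrite /r mulrAC ltr_pdivrMr // ltr_pM2l // ltrDl.
have [q [p [qr pr E1]]] := key u v r (ltW r0) du.
have [q' [p' [q'r p'r E2]]] := key v u r (ltW r0) dv.
have E : 'D_v ('D_u f) (x + q *: u + p *: v) = 'D_u ('D_v f) (x + q' *: v + p' *: u).
  have rr : r * r != 0 by rewrite gt_eqF // mulr_gt0.
  rewrite [x + r *: v + r *: u]addrAC in E2.
  move: E1 E2; move: ('D_v _ _) ('D_u _ _) (f (x + r *: u + r *: v))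
    (f (x + r *: u)) (f (x + r *: v)) (f x) => A B f1 f2 f3 f4 E1 E2.
  apply: (mulfI rr); apply: etrans (etrans (esym E1) _) E2; ring.
have dd1 : d <= d1 by rewrite ge_min lexx.
have dd2 : d <= d2 by rewrite ge_min lexx orbT.
have N1 : `|'D_v ('D_u f) (x + q *: u + p *: v) - 'D_v ('D_u f) x| <= e / 2.
  exact: (h1 _ (le_ball dd1 (near_x u v q p (or_introl (conj erefl erefl)) qr pr))).
have N2 : `|'D_u ('D_v f) (x + q' *: v + p' *: u) - 'D_u ('D_v f) x| <= e / 2.
  exact: (h2 _ (le_ball dd2 (near_x v u q' p' (or_intror (conj erefl erefl)) q'r p'r))).
move: N1 N2; rewrite {}E.
move: ('D_v ('D_u f) x) ('D_u ('D_v f) x) ('D_u _ _) => a b B N1 N2.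
by clear -N1 N2; move: N1 N2; rewrite !ler_norml; lra.
Qed.

Lemma pderiv_swap c c' f : smooth f -> 'd_c ('d_c' f) = 'd_c' ('d_c f).
Proof.
move=> sf; apply/funext => x; apply: Schwarz.
- by move=> y; exact: smooth_differentiable.
- by move=> y; apply: smooth_differentiable; exact: smooth_partial.
- by move=> y; apply: smooth_differentiable; exact: smooth_partial.
- by apply: smooth_continuous; do 2 apply: smooth_partial.
- by apply: smooth_continuous; do 2 apply: smooth_partial.
Qed.

Lemma pderiv_rem c s f : smooth f -> c \in s -> pderiv s f = pderiv (c :: rem c s) f.
Proof.
elim: s f => [//|c' s IH] f sf; rewrite inE /=; case: eqVneq => [->|_] //= cs.
exact: (etrans (IH _ (smooth_partial c' sf) cs)
  (congr1 (pderiv (rem c s)) (pderiv_swap c c' sf))).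
Qed.

(** Only the multiplicity of each coordinate matters, which lets [CN_poly_approx] argue with
    [count_mem]. *)
Lemma perm_pderiv s t f : smooth f -> perm_eq s t -> pderiv s f = pderiv t f.
Proof.
elim: s t f => [|c s IH] t f sf st.
  by move: st; rewrite perm_sym => /perm_nilP ->.
have ct : c \in t by rewrite -(perm_mem st) mem_head.
rewrite (pderiv_rem sf ct) /=; apply: IH; first exact: smooth_partial.
by rewrite -(perm_cons c) (perm_trans st) // perm_to_rem.
Qed.

(** A crude Leibniz rule: every derivative doubles the number of products. *)
Lemma pderivM_le s f g x (A B : R) : smooth f -> smooth g -> 0 <= A -> 0 <= B ->
  (forall t, (size t <= size s)%N -> `|pderiv t f x| <= A) ->
  (forall t, (size t <= size s)%N -> `|pderiv t g x| <= B) ->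
  `|pderiv s (f * g) x| <= 2 ^+ size s * (A * B).
Proof.
move=> + + A0 B0; elim: s f g => [|c s IH] f g sf sg fA gB /=.
  by rewrite expr0 mul1r normrM ler_pM //; [exact: (fA [::])|exact: (gB [::])].
rewrite (_ : 'd_c (f * g) = f * 'd_c g + g * 'd_c f); last first.
  by apply/funext => y; rewrite deriveM //; apply: diff_derivable;
    exact: smooth_differentiable.
rewrite pderivD; [|by apply: smoothM => //; exact: smooth_partial..].
rewrite (le_trans (ler_normD _ _)) // exprS mulrDl mul1r mulrDl.
apply: lerD; last rewrite mulrC; apply: IH => //; try exact: smooth_partial.
- by move=> t ts; apply: fA; exact: leqW.
- by move=> t ts; exact: (gB (c :: t)).
- by move=> t ts; exact: (fA (c :: t)).
- by move=> t ts; apply: gB; exact: leqW.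
Qed.

Lemma pderiv_bounded K f N : compact K -> smooth f -> supported_in K f ->
  exists2 M : R, 0 <= M & forall s x, (size s <= N)%N -> `|pderiv s f x| <= M.
Proof.
move=> cK; have clK : closed K by apply: compact_closed => //; exact: norm_hausdorff.
elim: N f => [|N IH] f sf fK.
  have /compact_bounded[M [_ hM]] : compact (f @` K).
    by apply: continuous_compact => //; apply: continuous_subspaceT; exact: smooth_continuous.
  exists (`|M| + 1) => [|[|//] x _ /=]; first by rewrite addr_ge0.
  have [Kx|Kx] := pselect (K x); last by rewrite fK // normr0 addr_ge0.
  apply: hM; last by exists x.
  by rewrite (le_lt_trans (ler_norm _)) // ltrDl.
have [M0 M00 hM0] := IH _ sf fK.
have /choice[M hM] c : exists M : R, 0 <= M /\
    forall s x, (size s <= N)%N -> `|pderiv s ('d_c f) x| <= M.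
  have [M M0' hM] := IH ('d_c f) (smooth_partial c sf) (@supported_in_pderiv K [:: c] f clK fK).
  by exists M.
exists (M0 + \sum_c M c) => [|[|c s] x sN].
- by rewrite addr_ge0 // sumr_ge0 // => c _; exact: (hM c).1.
- apply: le_trans (hM0 [::] x _) _ => //.
  by rewrite lerDl sumr_ge0 // => c _; exact: (hM c).1.
- apply: le_trans ((hM c).2 s x sN) _; rewrite (bigD1 c) //= addrCA lerDl.
  by rewrite addr_ge0 // sumr_ge0 // => c' _; exact: (hM c').1.
Qed.

End partial_derivatives.

(** * Functions of single entries and coordinate boxes *)

Section coordinate_functions.
Context {R : realType} {m n : nat}.
Local Notation V := 'M[R]_(m, n).
Local Notation coord := ('I_m * 'I_n)%type.
Implicit Types (x y : V) (c : coord) (Q : coord -> {poly R}).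

Local Notation "''d_' c f" := (fun x => 'D_(delta_mx c.1 c.2 : V) f x)
  (at level 10, c at level 0, f at level 9, format "''d_' c  f").

Lemma coord_line x v c (h : R) : (h *: v + x) c.1 c.2 = h * v c.1 c.2 + x c.1 c.2.
Proof. by rewrite !mxE. Qed.

Lemma is_derive_coord (F F' : R -> R) c x v :
  is_derive (x c.1 c.2) 1 F (F' (x c.1 c.2)) ->
  is_derive x v (fun x => F (x c.1 c.2)) (F' (x c.1 c.2) * v c.1 c.2).
Proof.
move=> [dF <-].
have dc : differentiable (fun x : V => x c.1 c.2) x by exact: differentiable_coord.
have dF' : differentiable F (x c.1 c.2) by exact/derivable1_diffP.
have dFc : differentiable (F \o (fun x : V => x c.1 c.2)) x.
  exact: differentiable_comp.
apply: DeriveDef; first exact: diff_derivable.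
rewrite deriveE // diff_comp //= diff1E // -deriveE //.
have -> : 'D_v (fun x : V => x c.1 c.2) x = v c.1 c.2.
  rewrite /derive; apply: (@cvg_lim) => //; apply: cvg_near_cst.
  near=> h; rewrite /= coord_line addrK /GRing.scale /= mulKf //.
  by near: h; exact: nbhs_dnbhs_neq.
by rewrite derive1E mulrC.
Unshelve. all: by end_near. Qed.

(** [H] lists the successive derivatives of [H 0]; the induction on the order of smoothness moves
    along this list. *)
Lemma smooth_coord (H : nat -> R -> R) c :
  (forall k (r : R), is_derive r 1 (H k) (H k.+1 r)) ->
  smooth (fun x : V => H 0%N (x c.1 c.2)).
Proof.
move=> dH; apply/smooth_uptoP => N; elim: N 0%N => [|N IH] k.
  move=> [|//] x _ /=; apply: (@differentiable_comp _ _ _ _ (fun x : V => x c.1 c.2) (H k)).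
    exact: differentiable_coord.
  by apply/derivable1_diffP; have [] := dH k (x c.1 c.2).
apply/smooth_uptoS; split => [x|c'].
  apply: (@differentiable_comp _ _ _ _ (fun x : V => x c.1 c.2) (H k)).
    exact: differentiable_coord.
  by apply/derivable1_diffP; have [] := dH k (x c.1 c.2).
rewrite (_ : (fun x => _) = (fun x => H k.+1 (x c.1 c.2)) *
    cst (delta_mx c'.1 c'.2 c.1 c.2 : R)).
  by apply: smooth_uptoM => //; exact: smooth_upto_cst.
apply/funext => x.
by have [_ ->] := is_derive_coord (delta_mx c'.1 c'.2) (dH k (x c.1 c.2)).
Qed.

Definition coord_monomial Q x := \prod_c (Q c).[x c.1 c.2].

Lemma smooth_horner (p : {poly R}) c : smooth (fun x : V => p.[x c.1 c.2]).
Proof.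
apply: (@smooth_coord (fun k r => p^`(k).[r]) c) => k r.
by rewrite derivnS; exact: is_derive_poly.
Qed.

Lemma smooth_coord_monomial Q : smooth (coord_monomial Q).
Proof. by apply: smooth_prod => c _; exact: smooth_horner. Qed.

Lemma partial_coord_monomial Q c : 'd_c (coord_monomial Q) =
  coord_monomial (fun c' => if c' == c then (Q c)^`() else Q c').
Proof.
apply/funext => x.
pose rest (x : V) := \prod_(c' | c' != c) (Q c').[x c'.1 c'.2].
have -> : coord_monomial Q = (fun x => (Q c).[x c.1 c.2]) * rest.
  by apply/funext => y; rewrite /coord_monomial (bigD1 c).
have srest : smooth rest by apply: smooth_prod => c' _; exact: smooth_horner.
have drest : 'd_c rest x = 0.
  rewrite /derive; apply: cvg_lim => //; apply: cvg_near_cst; apply: nearW => h.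
  rewrite (_ : _ (h *: _) = rest x) ?subrr ?scaler0 //=.
  apply: eq_bigr => c' cc'; rewrite coord_line mxE -xpair_eqE -!surjective_pairing.
  by rewrite (negbTE cc') mulr0 add0r.
rewrite deriveM; try (apply: diff_derivable; apply: smooth_differentiable => //;
  exact: smooth_horner).
rewrite drest scaler0 add0r.
have [_ ->] := is_derive_coord (delta_mx c.1 c.2) (is_derive_poly (Q c) (x c.1 c.2)).
rewrite mxE !eqxx mulr1 /coord_monomial [RHS](bigD1 c) //= eqxx mulrC.
congr (_ * _); apply: eq_bigr => c' /negbTE -> //.
Qed.

Lemma pderiv_coord_monomial t Q : pderiv t (coord_monomial Q) =
  coord_monomial (fun c => (Q c)^`(count_mem c t)).
Proof.
elim: t Q => [//|c t IH] Q /=; rewrite partial_coord_monomial IH.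
congr coord_monomial; apply/funext => c'; rewrite [c == _]eq_sym.
by case: eqVneq => [->|_] /=; rewrite -?derivSn ?eqxx.
Qed.

(** Stated entry by entry, a form that passes to rows and survives changing one coordinate,
    permuting the rows and identifying arguments. *)
Definition box (A : R) : set V := [set x | forall i j, `|x i j| <= A].

Lemma boxP (A : R) x : box A x <-> forall c, `|x c.1 c.2| <= A.
Proof. by split=> [h c|h i j]; [exact: h|exact: (h (i, j))]. Qed.

Lemma box_compact (A : R) : compact (box A).
Proof.
apply: mx_bounded_closed_compact.
  exists (Num.max A 0); split; first exact: num_real.
  move=> M; rewrite gt_max => /andP[AM M0] x xA.
  rewrite /Num.norm/= mx_normrE; apply/bigmax_leP; split=> [|[i j] _ /=].
    exact: ltW.
  by rewrite (le_trans (xA i j)) // ltW.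
rewrite (_ : box A = \bigcap_i \bigcap_j [set x : V | `|x i j| <= A]); last first.
  by apply/seteqP; split=> x h i; [move=> _ j _; exact: h|move=> j; exact: (h i Logic.I j Logic.I)].
apply: closed_bigI => i _; apply: closed_bigI => j _.
apply: (@preimage_closed _ _ (fun x : V => `|x i j|) [set r | r <= A]).
  move=> x _; apply: (@continuous_comp _ _ _ (fun x : V => x i j) Num.norm).
    exact: coord_continuous.
  exact: norm_continuous.
exact: closed_le.
Qed.

Lemma box_closed (A : R) : closed (box A).
Proof. by apply: compact_closed; [exact: norm_hausdorff|exact: box_compact]. Qed.

Lemma compact_sub_box (K : set V) : compact K -> exists2 A, 0 < A & K `<=` box A.
Proof.
move=> /compact_bounded[M [_ hM]]; exists (`|M| + 1); first by rewrite ltr_wpDl.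
move=> x Kx i j; have MM : M < `|M| + 1 by rewrite (le_lt_trans (ler_norm _)) // ltrDl.
apply: le_trans (hM _ MM _ Kx).
rewrite [leRHS]/Num.norm/= mx_normrE; apply/bigmax_geP; right.
by exists (i, j).
Qed.

End coordinate_functions.

(** * Smooth cutoff functions *)

Section cutoff.
Context {R : realType}.
Implicit Types (p q : {poly R}) (a b r t : R).

(* The functions p(1/t) exp(-1/t) on t > 0, extended by 0, are closed under
   differentiation. *)
Definition flat p t := if 0 < t then p.[t^-1] * expR (- t^-1) else 0.

Lemma horner_bound p : exists2 C, 0 <= C &
  forall r, 1 <= r -> `|p.[r]| <= C * r ^+ size p.
Proof.
exists (\sum_(i < size p) `|p`_i|) => [|r r1]; first exact: sumr_ge0.
rewrite horner_coef (le_trans (ler_norm_sum _ _ _)) // mulr_suml.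
apply: ler_sum => i _; rewrite normrM ler_wpM2l // normrX ger0_norm ?(le_trans ler01) //.
by apply: ler_weXn2l => //; exact: ltnW.
Qed.

(** The inequality [1 + x <= expR x] at [x = r / (k + 1)], raised to the power [k + 1]. *)
Lemma expR_ge_expn r k : 0 <= r -> (r / k.+1%:R) ^+ k.+1 <= expR r.
Proof.
move=> r0; have k0 : k.+1%:R != 0 :> R by rewrite pnatr_eq0.
rewrite [X in expR X](_ : r = k.+1%:R * (r / k.+1%:R)); last first.
  by rewrite mulrC divfK.
rewrite expRM_natl; apply: lerXn2r; rewrite ?nnegrE ?divr_ge0 ?expR_ge0 //.
by apply: le_trans (expR_ge1Dx _); rewrite lerDr.
Qed.

(** For [0 < t <= 1] and [n = size p], the polynomial factor is at most [C / t ^ n] and the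
    exponential at most [((n + 2) * t) ^ (n + 2)]. The quadratic bound forces derivative 0 at 0. *)
Lemma flat_bound p : exists2 C, 0 <= C &
  forall t, `|t| <= 1 -> `|flat p t| <= C * t ^+ 2.
Proof.
have [C C0 hC] := horner_bound p; set n := size p in hC.
exists (C * n.+2%:R ^+ n.+2) => [|t t1]; first by rewrite mulr_ge0 // exprn_ge0.
rewrite /flat; case: ltP => t0; last first.
  by rewrite normr0 mulr_ge0 ?sqr_ge0 // mulr_ge0 // exprn_ge0.
rewrite gtr0_norm // in t1.
have y1 : 1 <= t^-1 by rewrite invf_ge1.
have tV0 : 0 < t^-1 by rewrite invr_gt0.
rewrite normrM (gtr0_norm (expR_gt0 _)) expRN.
have e1 := expR_ge_expn n.+1 (ltW tV0).
rewrite ler_pdivrMr ?expR_gt0 //; apply: le_trans (hC _ y1) _.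
move: e1; set N := n.+2%:R ^+ n.+2; set t2 := t ^+ 2; set y := expR _ => e1.
have N0 : 0 < N by rewrite exprn_gt0.
have mul4 (a b c d : R) : a * b * c * d = a * (b * (c * d)) by ring.
rewrite mul4; apply: ler_wpM2l => //.
apply: (@le_trans _ _ (N * (t2 * (t^-1 / n.+2%:R) ^+ n.+2))); last first.
  apply: ler_wpM2l; first exact: ltW.
  by apply: ler_wpM2l => //; exact: sqr_ge0.
rewrite expr_div_n [t^-1 ^+ n.+2]exprSr [t^-1 ^+ n.+1]exprSr -/N /t2.
move: (t^-1 ^+ n) N N0 {e1} => a N N0.
rewrite le_eqVlt; apply/orP; left; apply/eqP; field.
by rewrite !gt_eqF.
Qed.

Lemma is_derive_flat p r : is_derive r 1 (flat p) (flat ('X^2 * (p - p^`())) r).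
Proof.
have [r0|r0|<-] := ltrgtP 0 r.
- apply: (@near_eq_is_derive _ _ _ (fun t => p.[t^-1] * expR (- t^-1))).
    by near=> t; rewrite /flat ifT //; near: t; exact: lt_nbhsr.
  have rn0 : r != 0 by rewrite gt_eqF.
  have di : is_derive r 1 (fun t : R => t^-1) (- r ^- 2 *: 1) by apply: is_deriveV.
  have dp := is_derive1_comp (is_derive_poly p r^-1) di.
  have de := @is_derive1_comp _ expR (fun t => - t^-1) r _ _
    (is_derive_expR (- r^-1)) (is_deriveN di).
  apply: (is_derive_eq (is_deriveM dp de)).
  rewrite /flat r0 !hornerE /GRing.scale /=; field.
  exact: rn0.
- apply: (@near_eq_is_derive _ _ _ (cst 0)).
    by near=> t; rewrite /flat ifF //; apply/negbTE; rewrite -leNgt ltW //; near: t; exact: lt_nbhsl.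
  by rewrite /flat ifF; [exact: is_derive_cst|apply/negbTE; rewrite -leNgt ltW].
have f0 q : flat q 0 = 0 by rewrite /flat ltxx.
have [C C0 hC] := flat_bound p.
have C1 : 0 < C + 1 by rewrite ltr_wpDl.
(* At 0 the quadratic bound makes the difference quotient at most [C * |h|]. *)
have c0 : (fun h : R => h^-1 *: ((flat p \o shift 0) (h *: 1) - flat p 0)) @ 0^' --> (0 : R).
  apply/cvgr0Pnorm_le => e e0; near=> h.
  rewrite /= addr0 f0 subr0 [h *: 1]mulr1 /GRing.scale /= normrM normfV.
  have h0 : h != 0 by near: h; exact: nbhs_dnbhs_neq.
  rewrite mulrC ler_pdivrMr ?normr_gt0 //.
  apply: (@le_trans _ _ (C * h ^+ 2)).
    apply: hC; near: h; apply: nbhs_dnbhs.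
    have := @nbhs0_le R R^o 1 ltr01; exact.
  rewrite -real_normK ?num_real // expr2 mulrA ler_wpM2r //.
  apply: (@le_trans _ _ ((C + 1) * `|h|)); first by rewrite ler_wpM2r // lerDl.
  rewrite mulrC -ler_pdivlMr //; near: h; apply: nbhs_dnbhs.
  have := @nbhs0_le R R^o (e / (C + 1)) (divr_gt0 e0 C1); exact.
rewrite f0; apply: DeriveDef; last exact: cvg_lim.
by apply/cvg_ex; exists 0.
Unshelve. all: by end_near. Qed.

(** [flat (flat_poly k)] is the k-th derivative of [flat 1]. *)
Fixpoint flat_poly k : {poly R} :=
  if k is k'.+1 then 'X^2 * (flat_poly k' - (flat_poly k')^`()) else 1.

Definition smooth_step t := flat 1 t / (flat 1 t + flat 1 (1 - t)).

Definition cutoff (A : R) t := smooth_step (A + 1 - t) * smooth_step (A + 1 + t).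

Lemma flat1_gt0 t : 0 < t -> 0 < flat 1 t.
Proof. by rewrite /flat => ->; rewrite hornerC mul1r expR_gt0. Qed.

Lemma flat1_le0 t : t <= 0 -> flat 1 t = 0.
Proof. by rewrite /flat leNgt => /negbTE ->. Qed.

Lemma flat1_ge0 t : 0 <= flat 1 t.
Proof. by case: (leP t 0) => [/flat1_le0 -> //|/flat1_gt0/ltW]. Qed.

Lemma smooth_step_denom t : flat 1 t + flat 1 (1 - t) != 0.
Proof.
rewrite gt_eqF //; have [t0|t0] := leP t 0.
  by rewrite ltr_wpDl ?flat1_ge0 // flat1_gt0 // subr_gt0 (le_lt_trans t0).
by rewrite ltr_wpDr ?flat1_ge0 // flat1_gt0.
Qed.

Lemma smooth_step1 t : 1 <= t -> smooth_step t = 1.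
Proof.
move=> t1; have := smooth_step_denom t; rewrite /smooth_step.
by rewrite (@flat1_le0 (1 - t)) ?subr_le0 // addr0 => /divff.
Qed.

Lemma smooth_step0 t : t <= 0 -> smooth_step t = 0.
Proof. by move=> t0; rewrite /smooth_step flat1_le0 // mul0r. Qed.

Lemma cutoff1 A t : `|t| <= A -> cutoff A t = 1.
Proof.
by rewrite ler_norml => /andP[At tA]; rewrite /cutoff !smooth_step1 ?mulr1 //; lra.
Qed.

Lemma cutoff0 A t : 0 <= A -> A + 1 < `|t| -> cutoff A t = 0.
Proof.
move=> A0; rewrite ltr_normr /cutoff => /orP[At|At].
  by rewrite smooth_step0 ?mul0r //; lra.
by rewrite [smooth_step (_ + t)]smooth_step0 ?mulr0 //; lra.
Qed.

Lemma smooth_cutoff m n (A : R) (c : 'I_m * 'I_n) :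
  smooth (fun x : 'M[R]_(m, n) => cutoff A (x c.1 c.2)).
Proof.
have sflat a b : smooth (fun x : 'M[R]_(m, n) => flat 1 (a + b * x c.1 c.2)).
  have := @smooth_coord _ m n (fun k r => b ^+ k * flat (flat_poly k) (a + b * r)) c.
  rewrite /= (_ : (fun x => _) = (fun x : 'M[R]_(m, n) => flat 1 (a + b * x c.1 c.2))); last first.
    by apply/funext => x; rewrite expr0 mul1r.
  apply => k r.
  have da : is_derive r 1 (fun r => a + b * r) b.
    apply: (is_derive_eq (is_deriveD (is_derive_cst a r 1) (is_deriveZ b (is_derive_id r 1)))).
    by rewrite add0r [LHS]mulr1.
  have df := @is_derive1_comp _ _ _ r _ _ (is_derive_flat (flat_poly k) (a + b * r)) da.
  apply: (is_derive_eq (is_deriveZ (b ^+ k) df)).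
  by rewrite /GRing.scale /= [b ^+ k.+1]exprSr -mulrA [_ * b]mulrC.
have sstep a b : smooth (fun x : 'M[R]_(m, n) => smooth_step (a + b * x c.1 c.2)).
  apply: (smoothM (sflat a b)); apply: smoothV => [x|]; first exact: smooth_step_denom.
  apply: smoothD => //.
  by apply: eq_smooth (sflat (1 - a) (- b)) => x; congr flat; ring.
apply: eq_smooth (smoothM (sstep (A + 1) (-1)) (sstep (A + 1) 1)) => x.
by rewrite /cutoff !fctE mulN1r mul1r.
Qed.

End cutoff.

(** * Polynomial approximation with derivatives *)

Section one_variable.
Context {R : realType}.
Implicit Types (F G : nat -> R) (x a : R) (p q : {poly R}).

(* Expectation of F at a binomial (k, x) variable, by conditioning on the first
   trial. *)
Fixpoint bernstein k F x : R :=
  if k is k'.+1 then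
    x * bernstein k' (fun j => F j.+1) x + (1 - x) * bernstein k' F x
  else F 0%N.

Lemma bernstein_poly k : exists b : nat -> {poly R},
  forall F x, bernstein k F x = \sum_(j < k.+1) F j * (b j).[x].
Proof.
elim: k => [|k [b IH]].
  by exists (fun=> 1) => F x; rewrite big_ord1 hornerC mulr1.
exists (fun j => (if j is j'.+1 then 'X * b j' else 0) +
                 (if (j < k.+1)%N then (1 - 'X) * b j else 0)) => F x.
rewrite /= !IH; under [RHS]eq_bigr do rewrite hornerD mulrDr.
rewrite big_split /= [X in _ = X + _]big_ord_recl hornerC mulr0 add0r.
rewrite [X in _ = _ + X]big_ord_recr /= ltnn hornerC mulr0 addr0 !mulr_sumr.
congr (_ + _); apply: eq_bigr => j _; first by rewrite hornerM hornerX [bump 0 j]add1n; ring.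
by rewrite ltn_ord hornerM hornerD hornerN hornerX hornerC; ring.
Qed.

Lemma bernsteinD k F G x :
  bernstein k (fun j => F j + G j) x = bernstein k F x + bernstein k G x.
Proof.
have [b bE] := bernstein_poly k; rewrite !bE -big_split /=.
by apply: eq_bigr => j _; rewrite mulrDl.
Qed.

Lemma bernsteinZ k a F x : bernstein k (fun j => a * F j) x = a * bernstein k F x.
Proof.
have [b bE] := bernstein_poly k; rewrite !bE mulr_sumr.
by apply: eq_bigr => j _; rewrite mulrA.
Qed.

Lemma bernstein_cst k a x : bernstein k (fun=> a) x = a.
Proof. by elim: k => //= k ->; ring. Qed.

Lemma bernstein_le k F G x : 0 <= x <= 1 ->
  (forall j, (j <= k)%N -> F j <= G j) -> bernstein k F x <= bernstein k G x.
Proof.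
move=> /andP[x0 x1]; elim: k F G => [|k IH] F G FG /=; first exact: FG.
apply: lerD; apply: ler_wpM2l; rewrite ?subr_ge0 //; apply: IH => j jk; apply: FG => //.
exact: leqW.
Qed.

(** The offset [a] makes the statement inductive: the first trial moves the centre by [1 - x] or by
    [- x]. *)
Lemma bernstein_variance k x a :
  bernstein k (fun j => (j%:R + a - k%:R * x) ^+ 2) x = a ^+ 2 + k%:R * (x * (1 - x)).
Proof.
elim: k a => [|k IH] a /=; first by ring.
rewrite (_ : (fun j => _) = (fun j => (j%:R + (a + 1 - x) - k%:R * x) ^+ 2)); last first.
  by apply/funext => j; rewrite -!natr1; ring.
rewrite [X in _ + (1 - x) * X](_ : _ =
  bernstein k (fun j => (j%:R + (a - x) - k%:R * x) ^+ 2) x); last first.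
  by congr bernstein; apply/funext => j; rewrite -!natr1; ring.
by rewrite !IH -natr1; ring.
Qed.

(** Chebyshev's argument: [|t| <= d + t ^ 2 / d], and for [t = j / k - x] the binomial mean of
    [t ^ 2] is [x * (1 - x) / k], at most [1 / k]. *)
Lemma bernstein_lipschitz k (f : R -> R) (C d : R) x :
  (0 < k)%N -> 0 < d -> 0 <= C -> 0 <= x <= 1 ->
  (forall y, 0 <= y <= 1 -> `|f y - f x| <= C * `|y - x|) ->
  `|bernstein k (fun j => f (j%:R / k%:R)) x - f x| <= C * (d + (k%:R * d)^-1).
Proof.
move=> k0 d0 C0 x01 fC; have k0' : 0 < k%:R :> R by rewrite ltr0n.
pose E j := C * d + C / (d * k%:R ^+ 2) * (j%:R + 0 - k%:R * x) ^+ 2.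
have EE : bernstein k E x <= C * (d + (k%:R * d)^-1).
  rewrite (bernsteinD k (fun=> C * d)
    (fun j => C / (d * k%:R ^+ 2) * (j%:R + 0 - k%:R * x) ^+ 2)) bernstein_cst.
  rewrite (bernsteinZ k _ (fun j => (j%:R + 0 - k%:R * x) ^+ 2)) bernstein_variance.
  rewrite expr0n /= add0r [C * (d + _)]mulrDr lerD2l.
  rewrite (_ : C / _ * _ = C * (x * (1 - x)) / (k%:R * d)); last first.
    by field; rewrite !gt_eqF.
  apply: ler_wpM2r; first by rewrite invr_ge0 mulr_ge0 // ltW.
  rewrite -[leRHS]mulr1; apply: ler_wpM2l => //.
  by move: x01 => /andP[x0 x1]; nra.
have fE j : (j <= k)%N -> `|f (j%:R / k%:R) - f x| <= E j.
  move=> jk; apply: le_trans (fC _ _) _.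
    by rewrite divr_ge0 ?ler0n //= ler_pdivrMr // mul1r ler_nat.
  rewrite /E -mulrA -mulrDr ler_wpM2l // addr0.
  set t := j%:R / k%:R - x.
  rewrite (_ : _ * (_ - _) ^+ 2 = t ^+ 2 / d); last first.
    by rewrite /t; field; rewrite !gt_eqF.
  have [td|td] := leP `|t| d; first by rewrite (le_trans td) // lerDl divr_ge0 ?sqr_ge0 // ltW.
  rewrite (@le_trans _ _ (t ^+ 2 / d)) //; last by rewrite lerDr ltW.
  by rewrite ler_pdivlMr // -real_normK ?num_real // expr2 ler_wpM2l // ltW.
rewrite ler_norml -[X in _ <= X - f x]addr0; apply/andP; split.
  rewrite addr0 lerBrDr addrC.
  apply: (@le_trans _ _ (bernstein k (fun j => f x + (-1) * E j) x)).
    by rewrite (bernsteinD k (fun=> f x) (fun j => -1 * E j)) bernsteinZ bernstein_cst; lra.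
  apply: bernstein_le => // j /fE; rewrite ler_norml; lra.
rewrite lerBlDr addrC.
apply: (@le_trans _ _ (bernstein k (fun j => f x + E j) x)).
  apply: bernstein_le => // j /fE; rewrite ler_norml; lra.
by rewrite (bernsteinD k (fun=> f x)) bernstein_cst lerD2l.
Qed.

(* The nodes and the weights do not depend on f, so that functions of several
   variables can be approximated one coordinate at a time. *)
Lemma bernstein_approx (A C e : R) : 0 < A -> 0 <= C -> 0 < e ->
  exists k (y : nat -> R) (b : nat -> {poly R}),
  [/\ forall j, (j < k)%N -> `|y j| <= A,
      forall j x, (j < k)%N -> `|x| <= A -> 0 <= (b j).[x],
      forall x, \sum_(j < k) (b j).[x] = 1 &
      forall (f : R -> R) x, `|x| <= A ->
        (forall z, `|z| <= A -> `|f z - f x| <= C * `|z - x|) ->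
        `|f x - \sum_(j < k) f (y j) * (b j).[x]| <= e].
Proof.
move=> A0 C0 e0; have A20 : 0 < 2 * A by rewrite mulr_gt0.
(* [D] dominates the Lipschitz constant after rescaling [[- A, A]] to [[0, 1]]. With
   [d = e / (2 * D)] and [k >= 1 / d ^ 2] the error [D * (d + 1 / (k * d))] is at most [e]. *)
pose D := C * (2 * A) + 1; have D0 : 0 < D by rewrite ltr_wpDl // mulr_ge0 // ltW.
pose d := e / (2 * D); have d0 : 0 < d by rewrite divr_gt0 // mulr_gt0.
pose k := (Num.truncn (d * d)^-1).+1.
have kd : (k%:R * d)^-1 <= d.
  rewrite -[_^-1]div1r ler_pdivrMr; last by rewrite mulr_gt0 // ltr0n.
  have dd0 : 0 < d * d by rewrite mulr_gt0.
  have kV : (d * d)^-1 <= k%:R by rewrite ltW // truncnS_gt.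
  have := ler_wpM2r (ltW dd0) kV; rewrite mulVf ?gt_eqF //.
  by move/le_trans; apply; rewrite mulrCA.
have [b bE] := bernstein_poly k.
pose u := (2 * A)^-1%:P * ('X + A%:P).
have uE x : u.[x] = (x + A) / (2 * A) by rewrite !hornerE mulrC.
have u01 x : `|x| <= A -> 0 <= u.[x] <= 1.
  rewrite ler_norml uE => /andP[Ax xA]; apply/andP; split.
    by apply: divr_ge0; [lra|exact: ltW].
  by rewrite ler_pdivrMr //; lra.
(* Degree [k] uses [k + 1] nodes. *)
exists k.+1, (fun j => j%:R / k%:R * (2 * A) - A), (fun j => b j \Po u); split.
- move=> j jk; rewrite ler_norml.
  have t0 : 0 <= j%:R / k%:R :> R by rewrite divr_ge0 ?ler0n.
  have t1 : j%:R / k%:R <= 1 :> R by rewrite ler_pdivrMr ?ltr0n // mul1r ler_nat.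
  by move: (j%:R / k%:R) t0 t1 => t t0 t1; nra.
- move=> j x jk xA; rewrite horner_comp.
  (* The j-th weight is the Bernstein mean of the indicator of [j], so monotonicity gives its
     sign. *)
  have := @bernstein_le k (fun=> 0) (fun i => (i == j)%:R) u.[x] (u01 x xA).
  rewrite bernstein_cst bE (bigD1 (Ordinal jk)) //= eqxx mul1r big1 ?addr0.
    by apply=> *; exact: ler0n.
  by move=> i ij; rewrite -val_eqE /= in ij; rewrite (negbTE ij) mul0r.
- move=> x; rewrite -[RHS](bernstein_cst k 1 u.[x]) bE.
  by apply: eq_bigr => j _; rewrite horner_comp mul1r.
move=> f x xA fC; pose g t := f (t * (2 * A) - A).
have x01 := u01 x xA.
have ux : u.[x] * (2 * A) - A = x by rewrite uE divfK ?gt_eqF //; ring.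
have gC y : 0 <= y <= 1 -> `|g y - g u.[x]| <= (C * (2 * A)) * `|y - u.[x]|.
  move=> /andP[y0 y1]; rewrite /g ux (le_trans (fC _ _)) //.
    by rewrite ler_norml; nra.
  rewrite -mulrA ler_wpM2l // -[X in _ - X]ux opprB addrA subrK -mulrBl normrM.
  by rewrite (gtr0_norm A20) mulrC.
have := bernstein_lipschitz (ltn0Sn _ : (0 < k)%N) d0 (mulr_ge0 C0 (ltW A20)) x01 gC.
rewrite distrC {1}/g ux bE; under eq_bigr => j _ do rewrite -(horner_comp (b j) u).
move=> /le_trans; apply.
rewrite (@le_trans _ _ (D * (d + d))) //.
  have kd0 : 0 <= (k%:R * d)^-1 by rewrite invr_ge0 mulr_ge0 // ltW.
  apply: ler_pM; [by rewrite mulr_ge0 // ltW|by rewrite addr_ge0 // ltW| |by rewrite lerD2l].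
  by rewrite /D lerDl.
by rewrite /d le_eqVlt; apply/orP; left; apply/eqP; field; rewrite gt_eqF.
Qed.

Lemma poly_antiderivative q a : exists2 p, p^`() = q & p.[a] = 0.
Proof.
(* At [i = 0] the division by 0 yields 0; the constant term is fixed afterwards by subtracting
   [p.[a]]. *)
pose p := \poly_(i < (size q).+1) (q`_i.-1 / i%:R).
exists (p - p.[a]%:P); last by rewrite !hornerE subrr.
rewrite derivB derivC subr0; apply/polyP => i.
rewrite coef_deriv coef_poly ltnS /=; case: ltnP => [_|qi].
  by rewrite -[LHS]mulr_natr divfK // pnatr_eq0.
by rewrite mul0rn nth_default.
Qed.

Lemma poly_antiderivn N q a : exists2 p, p^`(N) = q &
  forall k, (k < N)%N -> (p^`(k)).[a] = 0.
Proof.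
elim: N q => [|N IH] q; first by exists q.
have [q' q'E q'a] := poly_antiderivative q a; have [p pE pa] := IH q'.
exists p => [|k]; first by rewrite derivnS pE.
by rewrite ltnS leq_eqVlt => /predU1P[->|/pa //]; rewrite pE.
Qed.

End one_variable.

(** * Simultaneous approximation of derivatives in several variables *)

Section polynomial_approximation.
Context {R : realType} {m n : nat}.
Local Notation V := 'M[R]_(m, n).
Local Notation coord := ('I_m * 'I_n)%type.
Implicit Types (x y : V) (c : coord) (s t : seq coord).
Implicit Types (P : seq (R * (coord -> {poly R}))).

Local Notation "''d_' c f" := (fun x => 'D_(delta_mx c.1 c.2 : V) f x)
  (at level 10, c at level 0, f at level 9, format "''d_' c  f").

(** Written as a translate, so that changing one coordinate is a motion along a line and [line_MVT]
    applies. *)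
Definition set_coord x c (r : R) : V := x + (r - x c.1 c.2) *: delta_mx c.1 c.2.

Lemma set_coordE x c r c' :
  set_coord x c r c'.1 c'.2 = if c' == c then r else x c'.1 c'.2.
Proof.
rewrite !mxE -xpair_eqE -!surjective_pairing.
by case: eqVneq => [->|_]; rewrite ?mulr1 ?mulr0 ?addr0 // addrC subrK.
Qed.

Lemma coord_ext x y : (forall c, x c.1 c.2 = y c.1 c.2) -> x = y.
Proof. by move=> xy; apply/matrixP => i j; exact: (xy (i, j)). Qed.

Lemma set_coord_id x c : set_coord x c (x c.1 c.2) = x.
Proof. by rewrite /set_coord subrr scale0r addr0. Qed.

Lemma set_coordC x c r c' r' : c != c' ->
  set_coord (set_coord x c r) c' r' = set_coord (set_coord x c' r') c r.
Proof.
move=> cc'; apply: coord_ext => d; rewrite !set_coordE.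
by have [->|//] := eqVneq d c'; rewrite eq_sym (negbTE cc').
Qed.

Lemma set_coord_idem x c r r' : set_coord (set_coord x c r) c r' = set_coord x c r'.
Proof. by apply: coord_ext => d; rewrite !set_coordE; case: eqVneq. Qed.

Lemma set_coord_box A x c r : box A x -> `|r| <= A -> box A (set_coord x c r).
Proof.
by move=> /boxP xA rA; apply/boxP => d; rewrite set_coordE; case: eqP.
Qed.

(** A polynomial kept as a list of products of one-variable factors: differentiation and integration
    act factor by factor, and each product later splits over the rows into a tensor product. *)
Definition poly_comb P x : R := \sum_(q <- P) q.1 * coord_monomial q.2 x.

Lemma smooth_poly_comb P : smooth (poly_comb P).
Proof.
apply: smooth_sum => q _; apply: (smoothM (smooth_cst q.1)).
exact: smooth_coord_monomial.
Qed.

Lemma pderiv_poly_comb s P x : pderiv s (poly_comb P) x =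
  \sum_(q <- P) q.1 * coord_monomial (fun c => (q.2 c)^`(count_mem c s)) x.
Proof.
elim: P => [|q P IH].
  have -> : poly_comb [::] = 0 *: cst 0.
    by apply/funext => y; rewrite /poly_comb big_nil [RHS]mul0r.
  by rewrite pderivZ ?big_nil ?[LHS]mul0r //; exact: (smooth_cst 0).
have -> : poly_comb (q :: P) = q.1 *: coord_monomial q.2 + poly_comb P.
  by apply/funext => y; rewrite /poly_comb big_cons.
have sq := smooth_coord_monomial q.2.
rewrite pderivD; [|exact: smoothZ|exact: smooth_poly_comb].
by rewrite pderivZ // pderiv_coord_monomial big_cons -IH.
Qed.

Lemma poly_combM P (b : {poly R}) c :
  exists P', forall x, poly_comb P' x = poly_comb P x * b.[x c.1 c.2].
Proof.
exists [seq (q.1, fun c' => if c' == c then q.2 c' * b else q.2 c') | q <- P] => x.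
rewrite /poly_comb big_map mulr_suml; apply: eq_bigr => q _ /=.
rewrite -mulrA /coord_monomial (bigD1 c) //= [in RHS](bigD1 c) //= eqxx hornerM.
rewrite (eq_bigr (fun d : coord => (q.2 d).[x d.1 d.2])) => [|d /negbTE ->] //.
by ring.
Qed.

Lemma poly_comb_sum k (P : nat -> seq (R * (coord -> {poly R})))
    (b : nat -> {poly R}) c : exists P',
  forall x, poly_comb P' x = \sum_(j < k) poly_comb (P j) x * (b j).[x c.1 c.2].
Proof.
elim: k => [|k [P' P'E]].
  by exists [::] => x; rewrite big_ord0 /poly_comb big_nil.
have [P'' P''E] := poly_combM (P k) (b k) c.
by exists (P' ++ P'') => x; rewrite big_ord_recr /= -P'E -P''E /poly_comb big_cat.
Qed.

(** Induction on the coordinates on which [f] depends. Freezing one of them at a node preserves the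
    Lipschitz bound, and since the weights are nonnegative with sum 1, the errors for the different
    nodes are averaged rather than added. *)
Lemma uniform_approx s (A C e : R) (f : V -> R) : 0 < A -> 0 <= C -> 0 < e ->
  (forall x y, (forall c, c \in s -> x c.1 c.2 = y c.1 c.2) -> f x = f y) ->
  (forall x c r, box A x -> `|r| <= A ->
     `|f (set_coord x c r) - f x| <= C * `|r - x c.1 c.2|) ->
  exists P, forall x, box A x -> `|f x - poly_comb P x| <= e.
Proof.
move=> A0 C0; elim: s f e => [|c s IH] f e e0 fs fC.
  exists [:: (f 0, fun=> 1)] => x _; rewrite /poly_comb big_seq1 /=.
  rewrite /coord_monomial big1 ?mulr1 => [|d _]; last by rewrite hornerC.
  by rewrite (fs x 0) // subrr normr0 ltW.
have e20 : 0 < e / 2 by rewrite divr_gt0.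
have [k [y [b [yA b0 b1 bf]]]] := bernstein_approx A0 C0 e20.
have /choice[P hP] j : exists P, (j < k)%N -> forall x, box A x ->
    `|f (set_coord x c (y j)) - poly_comb P x| <= e / 2.
  have [jk|_] := ltnP j k; last by exists [::].
  have [||P hP] := IH (fun x => f (set_coord x c (y j))) _ e20; last by exists P.
    move=> x x' xx'; apply: fs => d; rewrite inE !set_coordE.
    by case: eqP => //= _; exact: xx'.
  move=> x d r xA rA; have [->|dc] := eqVneq d c.
    by rewrite set_coord_idem subrr normr0 mulr_ge0.
  rewrite set_coordC //; apply: le_trans (fC _ _ _ _ rA) _.
    by apply: set_coord_box => //; exact: yA.
  by rewrite set_coordE (negbTE dc).
have [P' P'E] := poly_comb_sum k P b c.
exists P' => x xA; rewrite P'E.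
have xcA : `|x c.1 c.2| <= A by move/boxP : xA; apply.
have h1 := bf (fun r => f (set_coord x c r)) _ xcA.
rewrite set_coord_id in h1.
rewrite -(subrK (\sum_(j < k) f (set_coord x c (y j)) * (b j).[x c.1 c.2]) (f x)).
rewrite -addrA [e]splitr (le_trans (ler_normD _ _)) // lerD //.
  by apply: h1 => z zA; exact: fC.
rewrite -sumrB (le_trans (ler_norm_sum _ _ _)) //.
rewrite -[leRHS]mulr1 -[X in _ <= _ * X](b1 (x c.1 c.2)) mulr_sumr; apply: ler_sum => j _.
have bj0 := b0 j _ (ltn_ord j) xcA.
by rewrite -mulrBl normrM (ger0_norm bj0); apply: ler_wpM2r => //; exact: (hP j (ltn_ord j) x xA).
Qed.

Lemma bounded_partials_lipschitz (f : V -> R) (C : R) x c r : smooth f ->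
  (forall c x, `|'d_c f x| <= C) ->
  `|f (set_coord x c r) - f x| <= C * `|r - x c.1 c.2|.
Proof.
move=> sf fC.
have key y h : 0 <= h -> `|f (y + h *: delta_mx c.1 c.2) - f y| <= C * h.
  move=> h0; have [q _ ->] := line_MVT y (delta_mx c.1 c.2) h0
    (fun z => smooth_differentiable z sf).
  by rewrite normrM (ger0_norm h0) mulrC; apply: ler_wpM2r => //; exact: fC.
rewrite /set_coord; have [h0|h0] := leP 0 (r - x c.1 c.2).
  by rewrite (ger0_norm h0); exact: key.
rewrite (ltr0_norm h0) distrC.
set h := r - x c.1 c.2 in h0 *; have := key (x + h *: delta_mx c.1 c.2) (- h).
by rewrite scaleNr addrK; apply; rewrite oppr_ge0 ltW.
Qed.

(** The integration starts from the faces [x c = - A']. There [f] vanishes with all its derivatives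
    because [A < A'], and the antiderivatives are chosen to vanish up to order [N - 1]; so every
    integration starts at 0 and multiplies the error by at most the width of the box. *)
Lemma CN_poly_approx (A A' : R) (f : V -> R) N (e : R) :
  0 < A -> A < A' -> smooth f -> supported_in (box A) f -> 0 < e ->
  exists P, forall s x, (size s <= N)%N -> box A' x ->
    `|pderiv s (f - poly_comb P) x| <= e.
Proof.
move=> A0 AA' sf fA e0; have A'0 := lt_trans A0 AA'.
(* The mixed derivative that is approximated: every coordinate occurs exactly [N] times. *)
pose S : seq coord := flatten [seq nseq N c | c <- enum {: 'I_m * 'I_n}].
have S_count c : count_mem c S = N.
  rewrite count_flatten -map_comp sumnE big_map /= big_enum /= (bigD1 c) //=.
  rewrite count_nseq /= eqxx mul1n big1 ?addn0 // => d dc.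
  by rewrite count_nseq /= (negbTE dc) mul0n.
pose D := (\sum_(c : coord) N)%N.
(* [2 * A'] is the width of the box; the added 1 makes the powers of [W] increase, so the exponent
   [D] covers every [s]. *)
pose W := 1 + 2 * A'; have W1 : 1 <= W by rewrite lerDl mulr_ge0 // ltW.
have W0 : 0 < W by exact: lt_le_trans W1.
pose e' := e / W ^+ D; have e'0 : 0 < e' by rewrite divr_gt0 // exprn_gt0.
have clA : closed (box A : set V) by exact: box_closed.
have [M M0 hM] := pderiv_bounded (size S).+1 (@box_compact R m n A) sf fA.
have sg : smooth (pderiv S f) by exact: smooth_pderiv.
have [||Q hQ] := @uniform_approx (enum {: 'I_m * 'I_n}) A' M e' (pderiv S f) A'0 M0 e'0.
- move=> x y xy; congr (pderiv _ _ _); apply: coord_ext => c.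
  by apply: xy; rewrite mem_enum.
- move=> x c r _ _; apply: bounded_partials_lipschitz => // d z.
  by have := hM (rcons S d) z; rewrite pderiv_rcons size_rcons; apply.
have /choice[I hI] (q : {poly R}) : exists p, p^`(N) = q /\
    forall k, (k < N)%N -> (p^`(k)).[- A'] = 0.
  by have [p pE p0] := poly_antiderivn N q (- A'); exists p.
pose P := [seq (q.1, fun c => I (q.2 c)) | q <- Q].
have sP := smooth_poly_comb P.
have sh : smooth (f - poly_comb P) by exact: smoothB.
have face t c x : (count_mem c t < N)%N -> x c.1 c.2 = - A' ->
    pderiv t (f - poly_comb P) x = 0.
  move=> tN xc; rewrite pderivB // !fctE pderiv_poly_comb big_map.
  rewrite (supported_in_pderiv _ clA fA) ?big1 ?subrr // => [q _|/boxP/(_ c)].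
    rewrite /coord_monomial (bigD1 c) //= xc (hI (q.2 c)).2 //.
    by rewrite mul0r mulr0.
  by rewrite xc normrN gtr0_norm // leNgt AA'.
(* Here [d] counts the derivatives that [t] lacks compared with [S]. The mean value theorem, started
   at a face, adds one of them and costs a factor at most [W]. *)
have bound d t x : (forall c, (count_mem c t <= N)%N) ->
    (\sum_c (N - count_mem c t) = d)%N -> box A' x ->
    `|pderiv t (f - poly_comb P) x| <= e' * W ^+ d.
  elim: d t x => [|d IH] t x tN td xA.
    have tS : perm_eq t S.
      rewrite /perm_eq; apply/allP => c _ /=; rewrite S_count eqn_leq tN /=.
      by have /eqP := td; rewrite sum_nat_eq0 => /forallP/(_ c); rewrite subn_eq0.
    rewrite expr0 mulr1 pderivB // (perm_pderiv sf tS) (perm_pderiv sP tS).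
    rewrite !fctE pderiv_poly_comb big_map.
    rewrite (eq_bigr (fun q => q.1 * coord_monomial q.2 x)) ?hQ // => q _ /=.
    congr (_ * coord_monomial _ _); apply/funext => c.
    by rewrite S_count (hI (q.2 c)).1.
  have [c cN] : exists c, (count_mem c t < N)%N.
    apply: contrapT => /forallNP tN'; move: td; rewrite big1 // => c _.
    by apply/eqP; rewrite subn_eq0 leqNgt; apply/negP/tN'.
  pose y := set_coord x c (- A'); pose r := x c.1 c.2 + A'.
  have xcA : `|x c.1 c.2| <= A' by move/boxP : xA; apply.
  have r0 : 0 <= r by move: xcA; rewrite ler_norml /r; lra.
  have xE : x = y + r *: delta_mx c.1 c.2.
    have r00 : - A' - x c.1 c.2 + r = 0 by rewrite /r; ring.
    by rewrite /y /set_coord -addrA -scalerDl r00 scale0r addr0.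
  have [q qr] := line_MVT y (delta_mx c.1 c.2) r0
    (fun z => smooth_differentiable z (smooth_pderiv t sh)).
  rewrite -xE (face t c y) ?subr0 //; last by rewrite set_coordE eqxx.
  move=> ->; rewrite -[X in r * X]/('d_c (pderiv t (f - poly_comb P)) _).
  rewrite -(pderiv_rcons t c) normrM (ger0_norm r0).
  have cr c' : count_mem c' (rcons t c) = (count_mem c' t + (c == c'))%N.
    by rewrite -cats1 count_cat /= addn0.
  have rW : r <= W by move: xcA; rewrite ler_norml /r /W; lra.
  rewrite exprS mulrCA; apply: ler_pM => //; apply: IH.
  - by move=> c'; rewrite cr; case: eqP => [<-|_]; rewrite ?addn1 ?addn0.
  - move: td; rewrite (bigD1 c) //= => td; rewrite (bigD1 c) //= cr eqxx addn1 subnS.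
    rewrite [X in (_ + X)%N](_ : _ = (\sum_(c' | c' != c) (N - count_mem c' t))%N).
      by rewrite -subn_gt0 in cN; move: cN td; case: (N - _)%N => //= k _ [].
    by apply: eq_bigr => c' /negbTE cc'; rewrite cr eq_sym cc' addn0.
  - rewrite (_ : y + _ = set_coord x c (q - A')); last first.
      have qE : - A' - x c.1 c.2 + q = q - A' - x c.1 c.2 by ring.
      by rewrite /y /set_coord -addrA -scalerDl qE.
    apply: set_coord_box => //; move: qr xcA => /andP[q0].
    by rewrite !ler_norml /r; lra.
exists P => s x sN xA.
have cN c : (count_mem c s <= N)%N by rewrite (leq_trans (count_size _ _)).
apply: le_trans (bound _ s x cN erefl xA) _.
rewrite /e' -mulrA ger_pMr // mulrC ler_pdivrMr ?exprn_gt0 // mul1r.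
by apply: ler_weXn2l => //; apply: leq_sum => c _; exact: leq_subr.
Qed.

End polynomial_approximation.

(** * Tensor products and polarization *)

Section polarization.
Context {R : comRingType} {n : nat}.
Import mathcomp.boot.fintype mathcomp.boot.finset.

(* Ryser's formula: inclusion-exclusion over the range of f : 'I_n -> 'I_n. *)
Lemma permanent_inclusion_exclusion (a : 'I_n -> 'I_n -> R) :
  \sum_(s : 'S_n) \prod_i a i (s i) =
  \sum_(T : {set 'I_n}) (-1) ^+ #|~: T| * \prod_i \sum_(j in T) a i j.
Proof.
pose F := {ffun 'I_n -> 'I_n}.
(* The product of the [1 - miss f j] is the indicator of surjectivity, which on a finite set is
   injectivity; expanding it over subsets produces the signs. *)
pose miss (f : F) j : R := ((j \notin codom f)%:R)%R.
transitivity (\sum_(f : F) \prod_j (1 - miss f j) * \prod_i a i (f i)).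
  rewrite [RHS](bigID (fun f : F => injectiveb f)) /= [X in _ + X]big1 ?addr0; last first.
    move=> f finj; have [j fj] : exists j, j \notin codom f.
      apply/existsP; rewrite -negb_forall; apply: contra finj => /forallP fsurj.
      apply/card_uniqP; rewrite size_map -cardE.
      by apply: eq_card => z; rewrite !inE fsurj.
    by rewrite (bigD1 j) //= /miss fj subrr !mul0r.
  rewrite [RHS](reindex (@pval _)) /=; last first.
    pose in_Sn := insubd (1%g : 'S_n).
    by exists in_Sn => /= f Uf; first apply: val_inj; apply: insubdK.
  apply: eq_big => [s|s _]; first by rewrite (valP s).
  rewrite [X in _ = X * _]big1 ?mul1r => [|j _]; first by apply: eq_bigr => i _; rewrite pvalE.
  rewrite /miss (_ : j \in codom (pval s)) ?subr0 //.
  by apply/codomP; exists ((s^-1)%g j); rewrite pvalE permKV.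
under eq_bigr do rewrite bigA_distr mulr_suml.
rewrite exchange_big /=; apply: eq_bigr => T _.
rewrite bigA_distr_big big_distrr /= [RHS]big_mkcond /=; apply: eq_bigr => f _.
case: ifPn => [/ffun_onP fT|fT].
  congr (_ * _); rewrite (bigID [in T]) /= big1 ?mul1r => [|j ->//].
  rewrite -[RHS]prodr_const; apply: eq_big => [j|j jT]; first by rewrite inE.
  rewrite (negbTE jT) /miss (_ : j \notin codom f) //.
  by apply: contra jT => /codomP[i ->].
have [i fi] : exists i, f i \notin T.
  apply/existsP; rewrite -negb_forall; apply: contra fT => /forallP fT.
  by apply/ffun_onP.
by rewrite (bigD1 (f i)) //= (negbTE fi) /miss codom_f oppr0 !mul0r.
Qed.

End polarization.

(** * Test functions and tensor products of several factors *)

Section tensor_families.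
Context {R : realType} {d : nat}.
Local Notation D := (testfun R 1 d).

Lemma testfun_smooth m n (f : testfun R m n) : smooth f.
Proof. by have /asboolP[] := testfunP f. Qed.

Lemma testfun_box m n (f : testfun R m n) : exists2 A, 0 < A & supported_in (box A) f.
Proof.
have /asboolP[_ [K cK fK]] := testfunP f.
have [A A0 KA] := compact_sub_box cK.
by exists A => // x xA; apply: fK => Kx; apply: xA; exact: KA.
Qed.

Lemma box_testfun m n (f : 'M[R]_(m, n) -> R) (A : R) :
  smooth f -> supported_in (box A) f -> f \in @is_testfun R m n.
Proof.
by move=> sf fA; apply/asboolP; split => //; exists (box A) => //; exact: box_compact.
Qed.

Lemma testfunD m n (f g : testfun R m n) x : (f + g) x = f x + g x.
Proof.
exact: (congr1 (@^~ x) (raddfD (\val : testfun R m n -> 'M[R]_(m, n) -> R) f g)).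
Qed.

Lemma testfunZ m n (a : R) (f : testfun R m n) x : (a *: f) x = a * f x.
Proof.
have e : (\val (a *: f) : 'M[R]_(m, n) -> R) = a *: (\val f : 'M[R]_(m, n) -> R).
  exact: linearZZ.
by rewrite -[LHS]/((\val (a *: f) : 'M[R]_(m, n) -> R) x) e fctE.
Qed.

Lemma testfunB m n (f g : testfun R m n) x : (f - g) x = f x - g x.
Proof.
exact: (congr1 (@^~ x) (raddfB (\val : testfun R m n -> 'M[R]_(m, n) -> R) f g)).
Qed.

Lemma testfun_sum m n (I : Type) (s : seq I) (P : pred I) (f : I -> testfun R m n) x :
  (\sum_(i <- s | P i) f i) x = \sum_(i <- s | P i) f i x.
Proof.
have /(congr1 (@^~ x)) := raddf_sum (\val : testfun R m n -> 'M[R]_(m, n) -> R) s P f.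
by rewrite fct_sumE.
Qed.

Lemma testfun_ext m n (f g : testfun R m n) : f =1 g -> f = g.
Proof. by move=> fg; apply: val_inj; apply/funext. Qed.

Lemma tensor_family_subproof n (phi : 'I_n -> D) :
  (fun x : 'M[R]_(n, d) => \prod_i phi i (row i x)) \in @is_testfun R n d.
Proof.
have /choice[A hA] i : exists A, 0 < A /\ supported_in (box A) (phi i).
  by have [A A0 hA] := testfun_box (phi i); exists A.
apply: (@box_testfun _ _ _ (\sum_i A i)).
  by apply: smooth_prod => i _; apply: smooth_row; exact: testfun_smooth.
move=> x xA; have [i xi] : exists i, ~ box (A i) (row i x).
  apply: contrapT => /forallNP xA'; apply: xA => i j.
  have xi : box (A i) (row i x) by apply: contrapT; exact: xA'.
  have := xi ord0 j; rewrite mxE => /le_trans; apply.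
  by rewrite (bigD1 i) //= lerDl sumr_ge0 // => k _; rewrite ltW // (hA k).1.
by rewrite (bigD1 i) //= ((hA i).2 _ xi) mul0r.
Qed.

Definition tensor_family n (phi : 'I_n -> D) : testfun R n d :=
  TestFun (tensor_family_subproof phi).

Lemma tensor_familyE n (phi : 'I_n -> D) x :
  tensor_family phi x = \prod_i phi i (row i x).
Proof. by []. Qed.

(** Ryser's formula for the matrix [phi j (row i x)]. It expresses the sum over all permuted tensor
    products through tensor powers, the only arguments at which the Taylor expansion determines the
    kernels directly. *)
Definition polarize n (phi : 'I_n -> D) : testfun R n d :=
  \sum_(T : {set 'I_n}) (-1) ^+ #|(~: T)%SET| *: tensor n (\sum_(j in T) phi j).

Lemma polarizeE n (phi : 'I_n -> D) :
  polarize phi = \sum_(s : 'S_n) tensor_family (phi \o s).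
Proof.
apply: testfun_ext => x; rewrite /polarize !testfun_sum.
under [RHS]eq_bigr do rewrite tensor_familyE.
rewrite (permanent_inclusion_exclusion (fun i j => phi j (row i x))).
apply: eq_bigr => T _; rewrite testfunZ; congr (_ * _).
by apply: eq_bigr => i _; rewrite testfun_sum.
Qed.

Lemma tensor_family_perm n (phi : 'I_n -> D) (s : 'S_n) x :
  tensor_family (phi \o s) x = tensor_family phi (row_perm (s^-1)%g x).
Proof.
rewrite !tensor_familyE (reindex_perm (s^-1)%g) /=; apply: eq_bigr => i _.
by rewrite permKV; congr (phi i _); apply/rowP => j; rewrite !mxE.
Qed.

Lemma symmetric_dual_polarize n (w : dual (testfun R n d)) (phi : 'I_n -> D) :
  symmetric_dual w -> w (polarize phi) = n`!%:R * w (tensor_family phi).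
Proof.
move=> sw; rewrite polarizeE raddf_sum /=.
rewrite (eq_bigr (fun=> w (tensor_family phi))) => [|s _]; last first.
  by apply: (sw (s^-1)%g) => x; exact: tensor_family_perm.
by rewrite sumr_const card_Sn mulr_natl.
Qed.

(** The cutoff [X] is itself a product over the entries, so multiplying by it turns every polynomial
    product into a tensor product of test functions. Since [X = 1] on the box carrying [phi], the
    error is the polynomial error times [X]. One box serves all approximants, as convergence in D
    requires. *)
Lemma tensor_family_dense n (phi : testfun R n d) : exists A : R,
  [/\ 0 < A, supported_in (box A) phi &
    forall N (e : R), 0 < e -> exists s : seq (R * ('I_n -> D)),
      let g := \sum_(q <- s) q.1 *: tensor_family q.2 in
      supported_in (box A) g /\
      forall t x, (size t <= N)%N -> `|pderiv t (g - phi) x| <= e].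
Proof.
have [A A0 phiA] := testfun_box phi.
have sphi := testfun_smooth phi.
have AA : A < A + 1 by rewrite ltrDl.
exists (A + 1); split; first exact: lt_trans AA.
  by move=> x xA; apply: phiA => xA'; apply: xA => i j; rewrite (le_trans (xA' i j)) // ltW.
move=> N e e0.
pose X (x : 'M[R]_(n, d)) := \prod_(c : 'I_n * 'I_d) cutoff A (x c.1 c.2).
have sX : smooth X by apply: smooth_prod => c _; exact: smooth_cutoff.
have X0 m k (x : 'M[R]_(m, k)) : ~ box (A + 1) x ->
    exists c : 'I_m * 'I_k, cutoff A (x c.1 c.2) = 0.
  move=> xA; have [c xc] : exists c : 'I_m * 'I_k, A + 1 < `|x c.1 c.2|.
    apply: contrapT => /forallNP xA'; apply: xA; apply/boxP => c.
    by rewrite leNgt; apply/negP/xA'.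
  by exists c; rewrite cutoff0 // ltW.
have XA : supported_in (box (A + 1)) X.
  by move=> x /X0[c xc]; rewrite /X (bigD1 c) //= xc mul0r.
have [M M0 hM] := pderiv_bounded N (@box_compact R n d (A + 1)) sX XA.
(* Compensates the Leibniz factor for multiplication by [X]; [1 + M] keeps the denominator
   positive. *)
pose e' := e / (2 ^+ N * (1 + M)).
have M1 : 0 < 1 + M by rewrite ltr_pwDl.
have e'0 : 0 < e' by rewrite divr_gt0 // mulr_gt0 // exprn_gt0.
have [P hP] := CN_poly_approx N A0 AA sphi phiA e'0.
have stf (Q : 'I_n * 'I_d -> {poly R}) i : (fun x : 'rV[R]_d =>
    \prod_j ((Q (i, j)).[x 0 j] * cutoff A (x 0 j))) \in @is_testfun R 1 d.
  apply: (@box_testfun _ _ _ (A + 1)).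
    apply: smooth_prod => j _; apply: smoothM.
      exact: (smooth_horner (Q (i, j)) (0, j)).
    exact: (smooth_cutoff A (0, j)).
  move=> x /X0[[i' j] /= xc]; rewrite (bigD1 j) //= -[0](ord1 i') xc.
  by rewrite mulr0 mul0r.
exists [seq (q.1, fun i => TestFun (stf q.2 i)) | q <- P] => g.
have gE : g = poly_comb P * X :> ('M[R]_(n, d) -> R).
  apply/funext => x; rewrite /g testfun_sum big_map !fctE /poly_comb mulr_suml.
  apply: eq_bigr => q _; rewrite testfunZ tensor_familyE -mulrA; congr (_ * _).
  rewrite /coord_monomial /X -big_split /= pair_bigA /=.
  by apply: eq_bigr => -[i j] _; rewrite !mxE.
have gA : supported_in (box (A + 1)) g by move=> x xA; rewrite gE !fctE XA // mulr0.
split=> // t x tN.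
have gphi : (g - phi : testfun R n d) = -1 *: ((testfun_val phi - poly_comb P) * X)
    :> ('M[R]_(n, d) -> R).
  apply/funext => y; rewrite testfunB gE !fctE /GRing.scale /=.
  have phiX : phi y = phi y * X y.
    have [yA|yA] := pselect (box A y); last by rewrite phiA // mul0r.
    suff -> : X y = 1 by rewrite mulr1.
    by apply: big1 => c _; apply: cutoff1; exact: (boxP A y).1.
  by rewrite [in LHS]phiX; ring.
have sP := smooth_poly_comb P.
have sh : smooth (testfun_val phi - poly_comb P : 'M[R]_(n, d) -> R) by exact: smoothB.
rewrite gphi pderivZ; last exact: smoothM.
rewrite scaleN1r -[X in `|X|]/(- (pderiv t _ x)) normrN.
have [xA|xA] := pselect (box (A + 1) x); last first.
  rewrite (@supported_in_pderiv _ _ _ (box (A + 1))) ?normr0 ?ltW //.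
    exact: box_closed.
  by move=> y yA; rewrite !fctE XA // mulr0.
apply: le_trans (pderivM_le sh sX (ltW e'0) M0 _ _) _.
- by move=> t' t't; apply: hP => //; exact: leq_trans tN.
- by move=> t' t't; apply: hM => //; exact: leq_trans tN.
apply: (@le_trans _ _ (2 ^+ N * (e' * (1 + M)))).
  have eM : e' * M <= e' * (1 + M) by apply: ler_wpM2l; [exact: ltW|rewrite lerDr].
  have p2 : 2 ^+ size t <= 2 ^+ N :> R by apply: ler_weXn2l => //; rewrite ler1n.
  apply: ler_pM => //.
  by apply: mulr_ge0 => //; exact: ltW.
rewrite /e' le_eqVlt; apply/orP; left; apply/eqP; field.
by rewrite gt_eqF //= expf_neq0.
Qed.

End tensor_families.

(** * Taylor expansions of the logarithm and the exponential *)

Section taylor.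
Context {R : realType}.
Implicit Types (p : {poly R}) (a c : nat -> R) (r u C : R).

Lemma le_pow_of_derive (h dh : R -> R) C N r : 0 <= C ->
  h 0 = 0 -> (forall u, 0 <= u <= r -> is_derive u 1 h (dh u)) ->
  (forall u, 0 <= u <= r -> `|dh u| <= C * u ^+ N) ->
  forall u, 0 <= u <= r -> `|h u| <= C * u ^+ N.+1.
Proof.
move=> C0 h0 dhE dhC u /andP[u0 ur].
have dhu z : z \in `]0, u[ -> is_derive z 1 h (dh z).
  rewrite in_itv /= => /andP[z0 zu]; apply: dhE.
  by rewrite (ltW z0) (le_trans (ltW zu)).
have ch : {within `[0, u], continuous h}.
  apply: derivable_within_continuous => z; rewrite in_itv /= => /andP[z0 zu].
  by have [] := dhE z; rewrite // z0 (le_trans zu).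
have [z] := MVT_segment u0 dhu ch; rewrite in_itv /= => /andP[z0 zu].
rewrite h0 !subr0 => ->; rewrite normrM (ger0_norm u0) exprSr mulrA.
apply: ler_wpM2r => //; apply: le_trans (dhC z _) _.
  by rewrite z0 (le_trans zu).
by apply: ler_wpM2l => //; apply: lerXn2r; rewrite ?nnegrE.
Qed.

Lemma low_coef0_le p N : (forall i, (i < N)%N -> p`_i = 0) ->
  exists2 C, 0 <= C & forall u, 0 <= u <= 1 -> `|p.[u]| <= C * u ^+ N.
Proof.
move=> p0; exists (\sum_(i < size p) `|p`_i|) => [|u /andP[u0 u1]]; first exact: sumr_ge0.
rewrite horner_coef (le_trans (ler_norm_sum _ _ _)) // mulr_suml.
apply: ler_sum => i _; have [iN|Ni] := ltnP i N.
  by rewrite p0 // mul0r normr0 mul0r.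
rewrite normrM ler_wpM2l // normrX ger0_norm //.
exact: ler_wiXn2l.
Qed.

(** The derivative of the left side is the geometric remainder [- b * (u * b) ^ N / (1 - u * b)],
    and the denominator is at least 1/2. The bound is explicit in [b] because [b] will be a value of
    [phi * psi], over which the remainder is integrated. *)
Lemma ln_taylor N (b : R) u : 0 <= u -> u * `|b| <= 2^-1 ->
  `|ln (1 - u * b) + \sum_(k < N) b ^+ k.+1 * (u ^+ k.+1 / k.+1%:R)| <=
  2 * `|b| ^+ N.+1 * u ^+ N.+1.
Proof.
(* The coefficient at [k = 0] is [1 / 0], that is 0. *)
move=> u0 ub; pose q := \poly_(k < N.+1) (b ^+ k / k%:R).
have qE v : q.[v] = \sum_(k < N) b ^+ k.+1 * (v ^+ k.+1 / k.+1%:R).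
  rewrite horner_poly big_ord_recl expr0 invr0 mulr0 mul0r add0r.
  by apply: eq_bigr => k _; rewrite lift0; ring.
have dqE v : q^`().[v] = b * \sum_(k < N) (v * b) ^+ k.
  rewrite (@horner_coef_wide _ N) => [|]; last first.
    by apply: leq_trans (size_poly _ _) _; rewrite -subn1 leq_subLR add1n size_poly.
  rewrite mulr_sumr; apply: eq_bigr => k _.
  rewrite coef_deriv coef_poly ltnS ltn_ord -[X in X * _]mulr_natr divfK ?pnatr_eq0 //.
  by rewrite exprS exprMn; ring.
pose h v := ln (1 - v * b) + q.[v].
pose dh v := (1 - v * b)^-1 * (- b) + q^`().[v].
have vb v : 0 <= v <= u -> v * `|b| <= 2^-1.
  by move=> /andP[v0 vu]; apply: le_trans ub; exact: ler_wpM2r.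
have pos v : 0 <= v <= u -> 2^-1 <= 1 - v * b.
  move=> vu; have := vb _ vu; move: vu => /andP[v0 _].
  rewrite -{1}(ger0_norm v0) -normrM ler_norml; lra.
have hd v : 0 <= v <= u -> is_derive v 1 h (dh v).
  move=> vu; have p1 : 0 < 1 - v * b by rewrite (lt_le_trans _ (pos _ vu)) // invr_gt0.
  have d1 : is_derive v 1 (fun v => 1 - v * b) (- b).
    rewrite (_ : (fun v => _) = (fun v => 1 + (- b) * v)); last first.
      by apply/funext => w; rewrite mulNr mulrC.
    apply: (is_derive_eq (is_deriveD (is_derive_cst (1 : R) v 1) (is_deriveZ (- b) (is_derive_id v 1)))).
    by rewrite add0r [LHS]mulr1.
  have d2 := @is_derive1_comp _ _ _ v _ _ (is_derive1_ln p1) d1.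
  exact: is_deriveD d2 (is_derive_poly q v).
rewrite -qE -/(h u); apply: (@le_pow_of_derive h dh _ N u _ _ hd); last by rewrite u0 lexx.
- by rewrite mulr_ge0 // exprn_ge0.
- by rewrite /h mul0r subr0 ln1 add0r qE big1 // => k _; rewrite expr0n mul0r mulr0.
move=> v vu; have p1 := pos v vu.
have p0 : 0 < 1 - v * b by rewrite (lt_le_trans _ p1) // invr_gt0.
rewrite /dh dqE.
have geom : (1 - v * b) * \sum_(k < N) (v * b) ^+ k = 1 - (v * b) ^+ N.
  by rewrite -[in RHS](expr1n _ N) subrXX; congr (_ * _); apply: eq_bigr => k _;
    rewrite expr1n mul1r.
move: (\sum_(k < N) _) geom => S geom.
have SE : S = (1 - (v * b) ^+ N) / (1 - v * b).
  by rewrite -geom mulrAC mulfV ?mul1r // gt_eqF.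
rewrite (_ : (1 - v * b)^-1 * - b + b * S = - (b * (v * b) ^+ N) / (1 - v * b)); last first.
  by rewrite SE; move: (_ ^+ N) => w; field; rewrite gt_eqF.
rewrite normrM normrN normfV (gtr0_norm p0) ler_pdivrMr //.
rewrite normrM normrX normrM exprMn.
have /andP[v0 _] := vu; rewrite (ger0_norm v0).
rewrite (_ : 2 * _ * _ * _ = (`|b| * (v ^+ N * `|b| ^+ N)) * (2 * (1 - v * b))); last first.
  by rewrite exprS; ring.
rewrite ler_peMr //; last by lra.
by rewrite !mulr_ge0 // exprn_ge0.
Qed.

(* The recursion for c is the one satisfied by the coefficients of the power
   series exp (sum_(k > 0) a_k u^k / k). *)
Lemma exp_taylor a c N C r (Lam : R -> R) : 0 < r ->
  c 0%N = 1 ->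
  (forall n, n.+1%:R * c n.+1 = \sum_(k < n.+1) a k.+1 * c (n - k)%N) ->
  (forall u, 0 <= u <= r ->
    `|Lam u - \sum_(k < N) a k.+1 * (u ^+ k.+1 / k.+1%:R)| <= C * u ^+ N.+1) ->
  exists C' r', 0 < r' /\ forall u, 0 <= u <= r' ->
    `|expR (Lam u) - \sum_(k < N.+1) c k * u ^+ k| <= C' * u ^+ N.+1.
Proof.
move=> r0 c0 cS LamC.
pose P := \poly_(k < N.+1) (a k / k%:R).
pose q := \poly_(k < N.+1) c k.
have PE u : P.[u] = \sum_(k < N) a k.+1 * (u ^+ k.+1 / k.+1%:R).
  rewrite horner_poly big_ord_recl invr0 mulr0 mul0r add0r.
  by apply: eq_bigr => k _; rewrite lift0; ring.
(* The recursion says that [q' = q * P'] below degree [N]. Hence [q * expR (- P)], which is 1 at 0,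
   has a derivative of order [u ^ N]. *)
have low i : (i < N)%N -> (q^`() - q * P^`())`_i = 0.
  move=> iN; rewrite coefB coef_deriv coefMr coef_poly ltnS iN.
  apply/eqP; rewrite subr_eq0 -mulr_natl cS; apply/eqP.
  apply: eq_bigr => -[k ki] _ /=; rewrite ltnS in ki.
  have kN : (k < N)%N by exact: leq_ltn_trans iN.
  have ikN : (i - k <= N)%N by rewrite (leq_trans (leq_subr _ _)) // ltnW.
  rewrite coef_deriv !coef_poly !ltnS kN ikN.
  by rewrite -[X in _ = _ * X]mulr_natr divfK ?pnatr_eq0 // mulrC.
have [C1 C10 hC1] := low_coef0_le low.
have [C2 C20 hC2] := @low_coef0_le P 0 (fun i => fun h => ltac:(by [])).
have [C3 C30 hC3] := @low_coef0_le q 0 (fun i => fun h => ltac:(by [])).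
have PC2 u : 0 <= u <= 1 -> `|P.[u]| <= C2 by move=> /hC2; rewrite mulr1.
pose K := expR C2.
have K0 : 0 < K := expR_gt0 _.
have main u : 0 <= u <= 1 -> `|q.[u] * expR (- P.[u]) - 1| <= (C1 * K) * u ^+ N.+1.
  apply: (@le_pow_of_derive (fun u => q.[u] * expR (- P.[u]) - 1)
    (fun u => (q^`() - q * P^`()).[u] * expR (- P.[u]))).
  - by rewrite mulr_ge0 // ltW.
  - rewrite PE big1 ?oppr0 ?expR0 ?mulr1; last by move=> k _; rewrite expr0n mul0r mulr0.
    by rewrite horner_coef0 coef_poly /= c0 subrr.
  - move=> v _.
    have de := @is_derive1_comp _ expR (fun t => - P.[t]) v _ _
      (is_derive_expR (- P.[v])) (is_deriveN (is_derive_poly P v)).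
    apply: (is_derive_eq (is_deriveB (is_deriveM (is_derive_poly q v) de) (is_derive_cst (1 : R) v 1))).
    by rewrite subr0 /GRing.scale /= hornerD hornerN hornerM; ring.
  - move=> v v01; rewrite normrM (gtr0_norm (expR_gt0 _)) [C1 * K * _]mulrAC.
    apply: ler_pM; [by []|exact: expR_ge0|exact: hC1|].
    rewrite /K ler_expR; have := PC2 v v01; rewrite ler_norml; lra.
pose r' := Num.min r 1.
have CC : 0 <= `|C| by [].
exists (K * (C1 * K) + K * (2 * expR (`|C|) * `|C|)), r'; split; first by rewrite lt_min r0 ltr01.
move=> u /andP[u0]; rewrite le_min => /andP[ur u1].
have u01 : 0 <= u <= 1 by rewrite u0 u1.
have u0r : 0 <= u <= r by rewrite u0 ur.
have uN : 0 <= u ^+ N.+1 by exact: exprn_ge0.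
have uN1 : u ^+ N.+1 <= 1 by exact: exprn_ile1.
have e1 := LamC u u0r; rewrite -PE in e1.
pose E := Lam u - P.[u].
have EC : `|E| <= `|C| * u ^+ N.+1.
  by apply: le_trans e1 _; apply: ler_wpM2r => //; exact: ler_norm.
have EC1 : `|E| <= `|C| by apply: le_trans EC _; rewrite ler_piMr.
have expE : `|expR E - 1| <= 2 * expR `|C| * `|E|.
  have eC : 1 <= expR `|C| by apply: le_trans (expR_ge1Dx _); rewrite lerDl.
  have := expR_ge1Dx E; have := expR_ge1Dx (- E); rewrite expRN => h1 h2.
  have eE0 := expR_gt0 E.
  have eEC : expR E <= expR `|C|.
    by rewrite ler_expR; move: EC1; rewrite ler_norml; lra.
  have h3 : expR E - 1 <= E * expR E.
    have := ler_wpM2r (ltW eE0) h1; rewrite mulVf ?gt_eqF //; lra.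
  have eE : expR E * `|E| <= expR `|C| * `|E| by exact: ler_wpM2r.
  have eE' : `|E| <= expR `|C| * `|E| by rewrite ler_peMl.
  have h4 : E * expR E <= expR E * `|E|.
    by rewrite mulrC; apply: ler_wpM2l; [exact: ltW|exact: ler_norm].
  have h5 : - `|E| <= E by rewrite lerNl -normrN ler_norm.
  by clear -h2 h3 h4 h5 eE eE'; rewrite ler_norml; apply/andP; split; lra.
rewrite (_ : \sum_(k < N.+1) _ = q.[u]); last by rewrite horner_poly.
have ePK : expR P.[u] <= K.
  by rewrite ler_expR; have := PC2 u u01; rewrite ler_norml; lra.
have eP0 := expR_gt0 P.[u].
(* Factoring out [expR P] separates the error of [Lam] from that of the truncation [q]. *)
rewrite (_ : expR (Lam u) - q.[u] =
  expR P.[u] * (expR E - 1) - expR P.[u] * (q.[u] * expR (- P.[u]) - 1)); last first.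
  rewrite (_ : Lam u = P.[u] + E); last by rewrite /E; ring.
  by rewrite expRD expRN; field; rewrite gt_eqF.
rewrite (le_trans (ler_normB _ _)) // addrC mulrDl.
apply: lerD; rewrite normrM (gtr0_norm eP0) -mulrA; apply: ler_pM => //; try exact: ltW.
  exact: main.
by apply: (le_trans expE); rewrite -[leRHS]mulrA; apply: ler_wpM2l => //.
Qed.

End taylor.

(** * Integrals over powers of sigma *)

Section product_integrals.
Context {R : realType}.

Lemma has_integral_eq_measure disp (T : measurableType disp)
    (mu nu : {measure set T -> \bar R}) (f : T -> R) (c : R) :
  (forall A, measurable A -> mu A = nu A) ->
  has_integral mu f c -> has_integral nu f c.
Proof.
move=> munu [/integrableP[mf fi] fc]; split.
  apply/integrableP; split => //.
  by rewrite (eq_measure_integral mu) // => A mA _; rewrite munu.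
by rewrite (eq_measure_integral mu) // => A mA _; rewrite munu.
Qed.

Lemma has_integral_pushforward d1 d2 (X : measurableType d1) (Y : measurableType d2)
    (mu : {measure set X -> \bar R}) (phi : X -> Y)
    (mphi : measurable_fun setT phi) (f : Y -> R) (c : R) :
  measurable_fun setT f -> has_integral mu (f \o phi) c ->
  has_integral (measure_function_pushforward__canonical__measure_function_Measure
    mu mphi) f c.
Proof.
move=> mf [fi fc]; have mf' : measurable_fun setT (EFin \o f) by exact/measurable_EFinP.
split; first exact: (@integrable_pushforward _ _ _ _ _ _ mphi mu setT (EFin \o f) mf' fi).
rewrite -fc.
exact: (@integral_pushforward _ _ _ _ _ _ mphi mu setT (EFin \o f) mf' fi measurableT).
Qed.

Lemma has_integral_prod d1 d2 (T1 : measurableType d1) (T2 : measurableType d2)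
    (m1 : {sigma_finite_measure set T1 -> \bar R})
    (m2 : {sigma_finite_measure set T2 -> \bar R})
    (f : T1 -> R) (g : T2 -> R) (a b : R) :
  has_integral m1 f a -> has_integral m2 g b ->
  has_integral (m1 \x m2)%E (fun p => f p.1 * g p.2) (a * b).
Proof.
move=> [fi fa] [gi gb].
have mf : measurable_fun setT f by have /integrableP[/measurable_EFinP] := fi.
have mg : measurable_fun setT g by have /integrableP[/measurable_EFinP] := gi.
have mfg : measurable_fun setT (fun p : T1 * T2 => f p.1 * g p.2).
  by apply: measurable_funM; apply: measurableT_comp.
have norm_int d (T : measurableType d) (m : {measure set T -> \bar R}) (h : T -> R) :
    m.-integrable setT (EFin \o h) -> exists c, has_integral m (fun x => `|h x|) c.
  move=> hi; exists (\int[m]_x `|h x|); apply: integrable_has_integral.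
  exact: (integrable_abse hi).
have [A fA] := norm_int _ _ _ _ fi; have [B gB] := norm_int _ _ _ _ gi.
have ifg : (m1 \x m2)%E.-integrable setT (EFin \o (fun p => f p.1 * g p.2)).
  apply/integrable12ltyP; first exact/measurable_EFinP.
  rewrite (eq_integral (fun x => (B * `|f x|)%:E)) => [|x _].
    by have [_ ->] := has_integralZ B fA; rewrite ltry.
  rewrite mulrC; have [_ <-] := has_integralZ `|f x| gB.
  by apply: eq_integral => y _ /=; rewrite normrM.
split => //; rewrite -integral12_prod_meas1 // /fubini_F.
rewrite (eq_integral (fun x => (b * f x)%:E)) => [|x _].
  by have [_ ->] := has_integralZ b (conj fi fa); rewrite mulrC.
by rewrite mulrC; have [_ <-] := has_integralZ (f x) (conj gi gb).
Qed.

(** The factors are indexed by [nat], so that the induction drops the first one by a shift. *)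
Lemma has_integral_pow disp (T : measurableType disp)
    (sigma : {sigma_finite_measure set T -> \bar R}) k (g : nat -> T -> R) (c : nat -> R) :
  (forall i, (i < k)%N -> has_integral sigma (g i) (c i)) ->
  has_integral (pow_measure sigma (k := k))
    (fun y => \prod_(i < k) g i (tnth y i)) (\prod_(i < k) c i).
Proof.
elim: k g c => [|k IH] g c gc.
  rewrite big_ord0 (_ : (fun y => _) = cst 1); last first.
    by apply/funext => y; rewrite big_ord0.
  apply: (@has_integral_eq_measure _ _ \d_([tuple] : 0.-tuple T)) => //.
  apply: ge0_has_integral => //.
  rewrite integral_dirac //; last exact: (measurable_cst (1%:E : \bar R)).
  exact: (etrans (congr1 (fun z => z * 1)%E (diracT R _)) (mul1e _)).
have cons_m : measurable_fun setT (fun p : T * k.-tuple T => [tuple of p.1 :: p.2]).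
  by apply: measurable_cons.
apply: (@has_integral_eq_measure _ _
  (measure_function_pushforward__canonical__measure_function_Measure
    [the {measure set _ -> \bar R} of (sigma \x pow_measure sigma (k := k))%E] cons_m)) => //.
have mF : measurable_fun setT (fun y : k.+1.-tuple T => \prod_(i < k.+1) g i (tnth y i)).
  apply: measurable_prod => i _; apply: measurableT_comp.
    exact: (has_integral_measurable (gc i (ltn_ord i))).
  exact: measurable_tnth.
apply: has_integral_pushforward => //.
have := has_integral_prod (gc 0%N (ltn0Sn k)) (IH (fun i => g i.+1) (fun i => c i.+1)
  (fun i ik => gc i.+1 ik)).
rewrite -[X in _ -> has_integral _ _ X](_ : c 0%N * \prod_(i < k) c i.+1 = _); last first.
  by rewrite big_ord_recl; congr (_ * _).
apply: has_integral_ext => -[x t] /=; rewrite big_ord_recl.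
congr (_ * _); apply: eq_bigr => i _; by rewrite lift0 (tnth_nth x) /= (tnth_nth x).
Qed.

End product_integrals.

Lemma continuous_borel_measurable {R : realType} (T : ptopologicalType) (f : T -> R) :
  continuous f -> measurable_fun setT (f : borel T -> R).
Proof.
move=> cf; apply: (measurability _ (RGenOInfty.measurableE R)) => //.
move=> _ [_ [x ->] <-]; rewrite setTI; apply: sub_sigma_algebra.
rewrite set_itvE; have := @open_comp _ _ f [set y | x < y].
by apply; [move=> t _; exact: cf|exact: open_gt].
Qed.

(** * Uniform limits of integrals over a set of finite measure *)

Section uniform_convergence.
Context {disp : measure_display} {T : measurableType disp} {R : realType}.
Variables (mu : {measure set T -> \bar R}) (B : set T).
Hypotheses (mB : measurable B) (muB : (mu B < +oo)%E).

Lemma bounded_supported_integrable (f : T -> R) (M : R) :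
  measurable_fun setT f -> (forall t, `|f t| <= M) -> (forall t, ~ B t -> f t = 0) ->
  mu.-integrable setT (EFin \o f) /\ `|\int[mu]_t f t| <= M * fine (mu B).
Proof.
move=> mf fM fB.
have [iB iBE] : has_integral mu (fun t => M * \1_B t) (M * fine (mu B)).
  apply: has_integralZ; apply: ge0_has_integral => //.
  by rewrite integral_indic // setIT fineK // ge0_fin_numE.
have fle t : `|f t| <= M * \1_B t.
  rewrite indicE; have [Bt|Bt] := pselect (B t); first by rewrite mem_set // mulr1.
  by rewrite fB // normr0 memNset // mulr0.
have M0 t : 0 <= M * \1_B t by apply: le_trans (fle t).
have fi : mu.-integrable setT (EFin \o f).
  apply: (@le_integrable _ _ _ mu setT measurableT _ (EFin \o (fun t => M * \1_B t))) => //.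
    exact/measurable_EFinP.
  by move=> t _; rewrite /= lee_fin (ger0_norm (M0 t)).
split => //; apply: le_trans (le_normr_Rintegral measurableT fi) _.
rewrite -(has_integral_Rintegral (conj iB iBE)); apply: le_Rintegral => //.
exact: (integrable_abse fi).
Qed.

(** Stated for an arbitrary filter, since it is applied along [filter_prod \oo \oo] rather than to a
    sequence. *)
Lemma uniform_integral_cvg (I : Type) (F : set_system I) {FF : Filter F}
    (f_ : I -> T -> R) (f : T -> R) (M : R) :
  (forall i, measurable_fun setT (f_ i)) -> measurable_fun setT f ->
  (forall i t, ~ B t -> f_ i t = 0) -> (forall t, ~ B t -> f t = 0) ->
  (forall t, `|f t| <= M) ->
  (forall e : R, 0 < e -> \forall i \near F, forall t, `|f_ i t - f t| <= e) ->
  (fun i => \int[mu]_t f_ i t) @ F --> \int[mu]_t f t.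
Proof.
move=> mf_ mf f_B fB fM f_f; apply/cvgrPdist_le => e e0.
have [fi _] := bounded_supported_integrable mf fM fB.
have c0 : 0 < fine (mu B) + 1 by rewrite ltr_wpDl // fine_ge0.
near=> i; have fe : forall t, `|f_ i t - f t| <= e / (fine (mu B) + 1).
  by near: i; apply: f_f; rewrite divr_gt0.
have mfi : measurable_fun setT (fun t => f_ i t - f t) by exact: measurable_funB.
have fiB t : ~ B t -> f_ i t - f t = 0 by move=> Bt; rewrite f_B // fB // subrr.
have [ii hi] := bounded_supported_integrable mfi fe fiB.
have -> : \int[mu]_t f_ i t = \int[mu]_t ((f_ i t - f t) + f t).
  by apply: eq_Rintegral => t _; rewrite subrK.
rewrite (RintegralD measurableT ii fi) opprD addrCA subrr addr0 normrN.
apply: le_trans hi _; rewrite -mulrA ger_pMr // mulrC ler_pdivrMr // mul1r.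
by rewrite lerDl.
Unshelve. all: by end_near. Qed.

End uniform_convergence.

(** * The inner product of Exp_n^G L^2(sigma) *)

Section Exp_inner.
Context {R : realType} {d : nat}.
Local Notation Rd := (borel 'rV[R]_d).
Local Notation D := (testfun R 1 d).
Variable sigma : {sigma_finite_measure set Rd -> \bar R}.
Hypothesis rsigma : radon sigma.
Implicit Types (phi psi : D).

Lemma box_measurable (A : R) : measurable (box A : set Rd).
Proof.
rewrite -[X in measurable X]setCK; apply: measurableC.
by apply: sub_sigma_algebra; apply: closed_openC; exact: box_closed.
Qed.

Lemma box_finite (A : R) : (sigma (box A) < +oo)%E.
Proof. by apply: rsigma.1; exact: box_compact. Qed.

Lemma testfun_measurable phi : measurable_fun setT (phi : Rd -> R).
Proof. by apply: continuous_borel_measurable; exact/smooth_continuous/testfun_smooth. Qed.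

Lemma testfun_bounded m n (f : testfun R m n) : exists2 M : R, 0 <= M & forall x, `|f x| <= M.
Proof.
have [A A0 fA] := testfun_box f.
have [M M0 hM] := pderiv_bounded 0 (@box_compact R m n A) (testfun_smooth f) fA.
by exists M => // x; exact: (hM [::]).
Qed.

Lemma testfunM_has_integral phi psi k : (0 < k)%N ->
  has_integral sigma (fun x : Rd => (phi x * psi x) ^+ k)
    (\int[sigma]_x (phi x * psi x) ^+ k).
Proof.
move=> k0; apply: integrable_has_integral.
have [A A0 phiA] := testfun_box phi.
have [M M0 phiM] := testfun_bounded phi; have [N N0 psiN] := testfun_bounded psi.
have mf : measurable_fun setT (fun x : Rd => (phi x * psi x) ^+ k).
  by apply: measurable_funX; apply: measurable_funM; exact: testfun_measurable.
apply: (bounded_supported_integrable (box_measurable A) (box_finite A) (M := (M * N) ^+ k) mf _ _).1.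
  by move=> x; rewrite normrX normrM lerXn2r ?nnegrE ?mulr_ge0 // ler_pM.
by move=> x xA; rewrite phiA // mul0r expr0n eqn0Ngt k0.
Qed.

Lemma block_contraction_tensor n (I : {set {set 'I_n}}) phi psi (y : #|I|.-tuple Rd) :
  finset.partition I [set: 'I_n] ->
  block_contraction (tensor n phi) y * block_contraction (tensor n psi) y =
  \prod_(l < #|I|) (phi (tnth y l) * psi (tnth y l)) ^+ #|nth finset.set0 (enum I) l|.
Proof.
move=> PI; rewrite /block_contraction /= /tensor_pow -big_split /=.
pose H l := phi (nth (0 : 'rV[R]_d) y l) * psi (nth (0 : 'rV[R]_d) y l).
transitivity (\prod_j H (index (finset.pblock I j) (enum I))).
  by apply: eq_bigr => j _; rewrite !rowK.
transitivity (\prod_(j in finset.cover I) H (index (finset.pblock I j) (enum I))).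
  by apply: eq_bigl => j; rewrite (finset.cover_partition PI) inE.
rewrite (finset.big_trivIset _ (finset.partition_trivIset PI)) /=.
transitivity (\prod_(B in I) H (index B (enum I)) ^+ #|B|).
  apply: eq_bigr => B BI; rewrite -prodr_const; apply: eq_bigr => j jB.
  by rewrite (finset.def_pblock (finset.partition_trivIset PI) BI jB).
rewrite -big_enum /= (big_nth finset.set0) big_mkord -cardE.
apply: eq_bigr => l _; rewrite index_uniq -?cardE ?enum_uniq //.
by rewrite /H (tnth_nth 0).
Qed.

Lemma block_contraction_has_integral n (I : {set {set 'I_n}}) phi psi :
  finset.partition I [set: 'I_n] ->
  has_integral (pow_measure sigma (k := #|I|))
    (fun y => block_contraction (tensor n phi) y * block_contraction (tensor n psi) y)
    (\prod_(B in I) \int[sigma]_x (phi x * psi x) ^+ #|B|).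
Proof.
move=> PI.
pose c l := \int[sigma]_x (phi x * psi x) ^+ #|nth finset.set0 (enum I) l|.
have -> : \prod_(B in I) \int[sigma]_x (phi x * psi x) ^+ #|B| = \prod_(l < #|I|) c l.
  by rewrite -big_enum /= (big_nth finset.set0) big_mkord -cardE.
pose g l (x : Rd) := (phi x * psi x) ^+ #|nth finset.set0 (enum I) l|.
have gc l : (l < #|I|)%N -> has_integral sigma (g l) (c l); last first.
  apply: has_integral_ext (has_integral_pow gc) => y.
  by rewrite block_contraction_tensor.
move=> lI; apply: testfunM_has_integral; rewrite card_gt0.
apply: (finset.partition_neq0 PI); rewrite -mem_enum; apply: mem_nth.
by rewrite -cardE.
Qed.

Lemma ExpG_inner_tensor n phi psi (c : nat -> R) : c 0%N = 1 ->
  (forall n, n.+1%:R * c n.+1 =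
     \sum_(k < n.+1) \int[sigma]_x (phi x * psi x) ^+ k.+1 * c (n - k)%N) ->
  ExpG_inner sigma (tensor n phi) (tensor n psi) = n`!%:R * c n.
Proof.
move=> c0 cS.
pose a k := \int[sigma]_x (phi x * psi x) ^+ k.
have := @partition_sumE R 'I_n a c [set: 'I_n] c0 cS.
rewrite cardsT card_ord => <-; rewrite /ExpG_inner /partition_sum.
apply: eq_bigr => I PI.
rewrite (prod_partition_size (fun k => (k.-1)`!%:R) PI) ?cardsT ?card_ord //.
by rewrite (has_integral_Rintegral (block_contraction_has_integral _ _ PI)) -big_split.
Qed.

Definition tensor_comb n (s : seq (R * D)) : testfun R n d :=
  \sum_(q <- s) q.1 *: tensor n q.2.

Lemma tensor_combE n s x : tensor_comb n s x = \sum_(q <- s) q.1 * tensor n q.2 x.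
Proof. by rewrite /tensor_comb testfun_sum; apply: eq_bigr => q _; rewrite testfunZ. Qed.

Lemma ExpG_inner_tensor_comb n (s t : seq (R * D)) :
  ExpG_inner sigma (tensor_comb n s) (tensor_comb n t) =
  \sum_(p <- s) \sum_(q <- t)
    p.1 * q.1 * ExpG_inner sigma (tensor n p.2) (tensor n q.2).
Proof.
rewrite /ExpG_inner; under [RHS]eq_bigr do under eq_bigr do rewrite mulr_sumr.
under [RHS]eq_bigr do rewrite exchange_big.
rewrite [RHS]exchange_big; apply: eq_bigr => I PI /=.
have h : has_integral (pow_measure sigma (k := #|I|))
    (fun y => block_contraction (tensor_comb n s) y * block_contraction (tensor_comb n t) y)
    (\sum_(p <- s) \sum_(q <- t) (p.1 * q.1) *
      \prod_(B in I) \int[sigma]_x (p.2 x * q.2 x) ^+ #|B|).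
  apply: (@has_integral_ext _ _ _ _ (fun y => \sum_(p <- s) \sum_(q <- t) (p.1 * q.1) *
    (block_contraction (tensor n p.2) y * block_contraction (tensor n q.2) y))).
    move=> y; rewrite /block_contraction !tensor_combE mulr_suml; apply: eq_bigr => p _.
    by rewrite mulr_sumr; apply: eq_bigr => q _; ring.
  apply: has_integral_sum => p _; apply: has_integral_sum => q _.
  by apply: has_integralZ; exact: block_contraction_has_integral.
rewrite (has_integral_Rintegral h) mulr_sumr; apply: eq_bigr => p _.
rewrite mulr_sumr; apply: eq_bigr => q _.
by rewrite (has_integral_Rintegral (block_contraction_has_integral _ _ PI)); ring.
Qed.

Lemma block_contraction_measurable n (I : {set {set 'I_n}}) (s : seq (R * D)) :
  measurable_fun setT (fun y : #|I|.-tuple Rd => block_contraction (tensor_comb n s) y).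
Proof.
rewrite (_ : (fun y => _) = (fun y : #|I|.-tuple Rd => \sum_(q <- s) q.1 * \prod_(j < n)
    q.2 (nth (0 : 'rV[R]_d) y (index (finset.pblock I j) (enum I))))); last first.
  apply/funext => y; rewrite /block_contraction tensor_combE; apply: eq_bigr => q _.
  by congr (_ * _); apply: eq_bigr => j _; rewrite rowK.
apply: measurable_sum => q; apply: measurable_funM => //; apply: measurable_prod => j _.
(* [I] is an arbitrary family here, so the index may run past the end, where [nth] returns the
   default row 0. *)
set l := index _ _; have [lI|lI] := ltnP l #|I|.
  rewrite (_ : (fun y => _) = (q.2 : Rd -> R) \o
      (fun y : #|I|.-tuple Rd => tnth y (Ordinal lI))); last first.
    by apply/funext => y /=; rewrite (tnth_nth 0).
  by apply: measurableT_comp; [exact: testfun_measurable|exact: measurable_tnth].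
rewrite (_ : (fun y => _) = cst (q.2 0)) //.
by apply/funext => y; rewrite nth_default // size_tuple.
Qed.

(** The indicator of [B] is a product of indicators of [box A], so [has_integral_pow] computes its
    integral. *)
Lemma box_tuple_measurable_finite k (A : R) :
  let B := [set y : k.-tuple Rd | forall l, box A (tnth y l)] in
  measurable B /\ (pow_measure sigma B < +oo)%E.
Proof.
move=> B; have BE : B = \bigcap_(l in [set: 'I_k]) ((fun y : k.-tuple Rd => tnth y l) @^-1` box A).
  by apply/seteqP; split => [y yB l _|y yB l]; exact: yB.
have mB : measurable B.
  rewrite BE; apply: fin_bigcap_measurable => // l _.
  rewrite -[X in measurable X]setTI.
  by apply: measurable_tnth => //; exact: box_measurable.
split => //.
have h l : (l < k)%N -> has_integral sigma (\1_(box A : set Rd) : Rd -> R) (fine (sigma (box A))).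
  move=> _; apply: ge0_has_integral => //.
    by apply: measurable_indic; exact: box_measurable.
  rewrite integral_indic ?setIT ?fineK //; last exact: box_measurable.
  by rewrite ge0_fin_numE // box_finite.
have [_] := has_integral_pow h.
rewrite (eq_integral (fun y => (\1_B y)%:E)) => [|y _].
  by rewrite integral_indic // setIT => ->; rewrite ltry.
congr EFin; rewrite indicE; have [yB|yB] := pselect (B y).
  rewrite mem_set // big1 // => l _; rewrite indicE mem_set //; exact: yB.
rewrite memNset //; have [l yl] : exists l, ~ box A (tnth y l) by exact/existsNP.
by rewrite (bigD1 l) //= indicE memNset // mul0r.
Qed.

(** The tuples carry a product sigma-algebra. Passing to the limit from tensor combinations avoids
    comparing it with the Borel sets of the space of matrices. *)
Lemma block_contraction_uniform_measurable n (I : {set {set 'I_n}})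
    (s : nat -> seq (R * D)) (f : testfun R n d) :
  (forall e : R, 0 < e -> \forall k \near \oo, forall x, `|tensor_comb n (s k) x - f x| <= e) ->
  measurable_fun setT (fun y : #|I|.-tuple Rd => block_contraction f y).
Proof.
move=> sf; apply: (measurable_fun_cvg (h := fun k (y : #|I|.-tuple Rd) =>
    block_contraction (tensor_comb n (s k)) y)).
  by move=> k; exact: block_contraction_measurable.
move=> y _; apply/cvgrPdist_le => e e0; have := sf _ e0.
by apply: filterS => k hk; rewrite distrC; exact: hk.
Qed.

Lemma ExpG_inner_cvg n (s t : nat -> seq (R * D)) (f g : testfun R n d) (A : R) :
  (forall k, supported_in (box A) (tensor_comb n (s k))) ->
  (forall k, supported_in (box A) (tensor_comb n (t k))) ->
  supported_in (box A) f -> supported_in (box A) g ->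
  (forall e : R, 0 < e -> \forall k \near \oo, forall x, `|tensor_comb n (s k) x - f x| <= e) ->
  (forall e : R, 0 < e -> \forall k \near \oo, forall x, `|tensor_comb n (t k) x - g x| <= e) ->
  (fun k : nat * nat =>
    ExpG_inner sigma (tensor_comb n (s k.1)) (tensor_comb n (t k.2))) @ filter_prod \oo \oo
    --> ExpG_inner sigma f g.
Proof.
move=> sA tA fA gA sf tg; rewrite /ExpG_inner; apply: cvg_sum => I PI; apply: cvgMr.
have [M M0 fM] := testfun_bounded f; have [N N0 gN] := testfun_bounded g.
have [mB Bfin] := box_tuple_measurable_finite #|I| A.
(* Blocks are nonempty, so each variable [tnth y l] is a row of the contracted matrix, and one row
   outside the box already makes [h] vanish. *)
have zero (h : testfun R n d) (y : #|I|.-tuple Rd) : supported_in (box A) h ->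
    ~ (forall l, box A (tnth y l)) -> block_contraction h y = 0.
  move=> hA /existsNP[l yl]; apply: hA => yA; apply: yl => i j.
  have BI : nth finset.set0 (enum I) l \in I.
    by rewrite -mem_enum; apply: mem_nth; rewrite -cardE.
  have /finset.set0Pn[j0 j0B] := finset.partition_neq0 PI BI.
  have := yA j0 j; rewrite mxE (finset.def_pblock (finset.partition_trivIset PI) BI j0B).
  by rewrite index_uniq -?cardE ?enum_uniq // -tnth_nth (ord1 i).
apply: (uniform_integral_cvg mB Bfin (M := M * N)).
- by move=> k; apply: measurable_funM; exact: block_contraction_measurable.
- by apply: measurable_funM; [exact: block_contraction_uniform_measurable sf|
    exact: block_contraction_uniform_measurable tg].
- by move=> k y yB; rewrite zero // mul0r.
- by move=> y yB; rewrite zero // mul0r.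
- by move=> y; rewrite normrM ler_pM //; [exact: fM|exact: gN].
(* If both factors err by at most [d0 <= 1], the product errs by at most
   [d0 * d0 + d0 * N + M * d0], hence by [d0 * (M + N + 1)]. *)
move=> e e0; pose d0 := Num.min 1 (e / (M + N + 1)).
have MN : 0 < M + N + 1 by rewrite ltr_wpDl // addr_ge0.
have d00 : 0 < d0 by rewrite lt_min ltr01 divr_gt0.
have de : d0 * (M + N + 1) <= e by rewrite -ler_pdivlMr // ge_min lexx orbT.
have d1 : d0 <= 1 by rewrite ge_min lexx.
exists ([set k | forall x, `|tensor_comb n (s k) x - f x| <= d0],
        [set k | forall x, `|tensor_comb n (t k) x - g x| <= d0]).
  by split; [exact: sf|exact: tg].
move=> [k l] [/= kf lg] y; rewrite /block_contraction; set x := \matrix_(_ < _) _.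
have := kf x; have := lg x; have := fM x; have := gN x.
move: (tensor_comb n (s k) x) (tensor_comb n (t l) x) (f x) (g x) => a b a' b' hb' ha' hb ha.
rewrite (_ : a * b - a' * b' = (a - a') * (b - b') + (a - a') * b' + a' * (b - b')); last by ring.
apply: le_trans de; rewrite (le_trans (ler_normD _ _)) //.
rewrite (_ : d0 * (M + N + 1) = (d0 * 1 + d0 * N) + M * d0); last by ring.
apply: lerD; last by rewrite normrM ler_pM.
rewrite (le_trans (ler_normD _ _)) //; apply: lerD; rewrite normrM ler_pM //.
exact: le_trans d1.
Qed.

End Exp_inner.

(** * Power series remainders and sequences given by recursion *)

Section power_series.
Context {R : realType}.

(** Convergence at [r] bounds [|b k| * r ^ k]; for [t <= r / 2] the tail is then dominated by a
    geometric series of ratio at most 1/2. *)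
Lemma power_series_remainder (b : nat -> R) (f : R -> R) (r : R) n : 0 < r ->
  (forall t, 0 <= t <= r -> series (fun k => b k * t ^+ k) @ \oo --> f t) ->
  exists C, forall t, 0 <= t <= r / 2 ->
    `|f t - \sum_(k < n.+1) b k * t ^+ k| <= C * t ^+ n.+1.
Proof.
move=> r0 bf.
have [M hM] : exists M, forall k, `|b k| * r ^+ k <= M.
  have rr : 0 <= r <= r by rewrite lexx ltW.
  have /cvg_seq_bounded[M [_ hM]] : cvgn (fun k => b k * r ^+ k).
    by apply/cvg_ex; exists 0; apply: cvg_series_cvg_0; apply/cvg_ex; exists (f r); exact: bf.
  exists (`|M| + 1) => k; rewrite -(ger0_norm (exprn_ge0 k (ltW r0))) -normrM.
  by apply: hM => //; rewrite (le_lt_trans (ler_norm _)) // ltrDl.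
have M0 : 0 <= M by apply: le_trans (hM 0%N); rewrite mulr_ge0 // exprn_ge0 // ltW.
exists (2 * M / r ^+ n.+1) => t /andP[t0 tr].
have t01 : 0 <= t <= r by rewrite t0 /=; apply: le_trans tr _; clear -r0; lra.
pose x := t / r; have x0 : 0 <= x by rewrite divr_ge0 // ltW.
have x2 : x <= 2^-1 by rewrite /x ler_pdivrMr // mulrC.
have geom m : \sum_(k < m) x ^+ k <= 2.
  have h := subrXX 1 x m; rewrite expr1n in h.
  rewrite (eq_bigr (fun k : 'I_m => x ^+ k)) in h; last by move=> k _; rewrite expr1n mul1r.
  have x1 : 2^-1 <= 1 - x by lra.
  have s0 : 0 <= \sum_(k < m) x ^+ k by apply: sumr_ge0 => k _; exact: exprn_ge0.
  have xm : 0 <= x ^+ m by exact: exprn_ge0.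
  by have := ler_wpM2r s0 x1; rewrite -h; lra.
have tail m : `|\sum_(k < n.+1 + m) b k * t ^+ k - \sum_(k < n.+1) b k * t ^+ k| <=
    2 * M / r ^+ n.+1 * t ^+ n.+1.
  rewrite (_ : _ - _ = \sum_(k < m) b (n.+1 + k)%N * t ^+ (n.+1 + k)); last first.
    by rewrite (@big_split_ord _ _ _ n.+1 m) /= addrAC subrr add0r.
  rewrite (le_trans (ler_norm_sum _ _ _)) //.
  apply: (@le_trans _ _ (\sum_(k < m) M * x ^+ n.+1 * x ^+ k)).
    apply: ler_sum => k _; rewrite normrM normrX (ger0_norm t0).
    rewrite -mulrA -exprD (_ : t = r * x); last by rewrite /x mulrCA mulfV ?mulr1 // gt_eqF.
    by rewrite exprMn mulrA ler_wpM2r // exprn_ge0.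
  rewrite -mulr_sumr (_ : 2 * M / _ * _ = M * x ^+ n.+1 * 2); last first.
    by rewrite /x expr_div_n; ring.
  by apply: ler_wpM2l; [rewrite mulr_ge0 // exprn_ge0|exact: geom].
have lim : (fun m => \sum_(k < n.+1 + m) b k * t ^+ k) @ \oo --> f t.
  have := bf t t01; rewrite -(cvg_shiftn n.+1); apply: cvg_trans.
  apply: near_eq_cvg; near=> m; rewrite /series /= addnC.
  by rewrite big_mkord.
have lim' : (fun m => `|\sum_(k < n.+1 + m) b k * t ^+ k - \sum_(k < n.+1) b k * t ^+ k|)
    @ \oo --> `|f t - \sum_(k < n.+1) b k * t ^+ k|.
  by apply: cvg_norm; apply: cvgB lim _; exact: cvg_cst.
rewrite -(cvg_lim (@Rhausdorff R) lim'); apply: limr_le; last by apply: nearW; exact: tail.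
by apply/cvg_ex; eexists; exact: lim'.
Unshelve. all: by end_near. Qed.

Lemma recursive_sequence (a : nat -> R) : exists c : nat -> R, c 0%N = 1 /\
  forall n, n.+1%:R * c n.+1 = \sum_(k < n.+1) a k.+1 * c (n - k)%N.
Proof.
(* Course-of-values recursion: [G n] is a table whose entries up to [n] are final. *)
pose G := fix G n : nat -> R := if n is n'.+1 then
  fun i => if (i <= n')%N then G n' i
           else n'.+1%:R^-1 * \sum_(k < n'.+1) a k.+1 * G n' (n' - k)%N
  else fun=> 1.
have Gst m i : (i <= m)%N -> G m i = G i i.
  elim: m => [|m IH]; first by rewrite leqn0 => /eqP ->.
  by rewrite leq_eqVlt ltnS => /predU1P[->//|im] /=; rewrite im IH.
exists (fun n => G n n); split => // n /=; rewrite ltnn mulrA mulfV ?pnatr_eq0 // mul1r.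
by apply: eq_bigr => k _; rewrite Gst // leq_subr.
Qed.

End power_series.

(** * Gamma noise *)

Lemma evaluation_measurable {R : realType} (E : tvsType R) (f : E) :
  measurable_fun setT (fun w : borel (dual E) => w f).
Proof.
apply: (@continuous_borel_measurable R (dual E) (fun w => w f)) => w.
have := @continuous_comp (dual E) (prod_topology (fun _ : E => R)) R
  (fun w => (w : prod_topology (fun _ : E => R))) (fun u => u f) w.
apply; first exact: initial_continuous.
exact: (@proj_continuous E (fun=> R) f).
Qed.

Section logarithm.
Context {R : realType} {d : nat}.
Local Notation Rd := (borel 'rV[R]_d).
Local Notation D := (testfun R 1 d).
Variable sigma : {sigma_finite_measure set Rd -> \bar R}.
Hypothesis rsigma : radon sigma.
Implicit Types (phi psi : D).

Lemma continuous_supported_integrable (A : R) (f : 'rV[R]_d -> R) :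
  continuous f -> supported_in (box A) f -> sigma.-integrable setT (EFin \o (f : Rd -> R)).
Proof.
move=> cf fA.
have /compact_bounded[M [_ hM]] : compact (f @` box A).
  by apply: continuous_compact; [exact: continuous_subspaceT|exact: box_compact].
apply: (bounded_supported_integrable (@box_measurable R d A) (box_finite rsigma A)
  (M := `|M| + 1) _ _ _).1 => //; first exact: continuous_borel_measurable.
move=> x; have [xA|xA] := pselect (box A x); last by rewrite fA // normr0 addr_ge0.
by apply: hM; [rewrite (le_lt_trans (ler_norm _)) // ltrDl|exists x].
Qed.

Lemma ln_supported_integrable (A : R) (f : 'rV[R]_d -> R) :
  continuous f -> supported_in (box A) f -> (forall x, f x < 1) ->
  sigma.-integrable setT (EFin \o (fun x : Rd => ln (1 - f x))).
Proof.
move=> cf fA f1; apply: (continuous_supported_integrable (A := A)).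
  move=> x; apply: (@continuous_comp _ _ _ (fun x => 1 - f x) (@ln R)).
    by apply: continuousB; [exact: cst_continuous|exact: cf].
  have fx : 0 < 1 - f x by rewrite subr_gt0.
  exact: (continuous_ln fx).
by move=> x xA; rewrite fA // subr0 ln1.
Qed.

Lemma ln_testfun_has_integral phi : (forall x, phi x < 1) ->
  has_integral sigma (fun x : Rd => ln (1 - phi x)) (\int[sigma]_x ln (1 - phi x)).
Proof.
move=> phi1; apply: integrable_has_integral; have [A A0 phiA] := testfun_box phi.
by apply: ln_supported_integrable => //; [exact/smooth_continuous/testfun_smooth|exact: phiA].
Qed.

Lemma ln_testfunM_has_integral phi psi (u : R) :
  (forall x, u * (phi x * psi x) < 1) ->
  has_integral sigma (fun x : Rd => ln (1 - u * (phi x * psi x)))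
    (\int[sigma]_x ln (1 - u * (phi x * psi x))).
Proof.
move=> h; apply: integrable_has_integral; have [A A0 phiA] := testfun_box phi.
apply: (ln_supported_integrable (f := fun x => u * (phi x * psi x)) (A := A)) => //.
  move=> x; apply: (@continuousM _ _ (cst u) (testfun_val phi * testfun_val psi)).
    exact: cst_continuous.
  by apply: continuousM; exact/smooth_continuous/testfun_smooth.
by move=> x xA; rewrite phiA // mul0r mulr0.
Qed.

Lemma ln_testfunM_taylor phi psi N : exists C r, 0 < r /\ forall u, 0 <= u <= r ->
  (forall x, u * (phi x * psi x) < 1) /\
  `|(- \int[sigma]_x ln (1 - u * (phi x * psi x))) -
    \sum_(k < N) \int[sigma]_x (phi x * psi x) ^+ k.+1 * (u ^+ k.+1 / k.+1%:R)|
  <= C * u ^+ N.+1.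
Proof.
have [A A0 phiA] := testfun_box phi.
have [M1 M10 phiM] := testfun_bounded phi; have [M2 M20 psiM] := testfun_bounded psi.
pose M := M1 * M2; have M0 : 0 <= M by exact: mulr_ge0.
have bM x : `|phi x * psi x| <= M by rewrite normrM ler_pM.
(* The radius gives [u * |phi x * psi x| <= 1/2] for all [x] at once, and the remainder lives in
   [box A], so integrating it costs the factor [sigma (box A)]. *)
exists (2 * M ^+ N.+1 * fine (sigma (box A))), (2^-1 / (M + 1)).
have M1p : 0 < M + 1 by rewrite ltr_wpDl.
split; first by rewrite divr_gt0 ?invr_gt0.
move=> u /andP[u0]; rewrite ler_pdivlMr // => uM.
have ub x : u * `|phi x * psi x| <= 2^-1.
  apply: le_trans uM; rewrite ler_wpM2l // (le_trans (bM x)) //.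
  by rewrite lerDl.
have u1 x : u * (phi x * psi x) < 1.
  apply: le_lt_trans (_ : 2^-1 < 1); last by rewrite invf_lt1 ?ltr1n.
  by apply: le_trans (ub x); rewrite ler_wpM2l // ler_norm.
split => //.
pose rem x := ln (1 - u * (phi x * psi x)) +
  \sum_(k < N) (phi x * psi x) ^+ k.+1 * (u ^+ k.+1 / k.+1%:R).
have hrem : has_integral sigma rem (\int[sigma]_x ln (1 - u * (phi x * psi x)) +
    \sum_(k < N) \int[sigma]_x (phi x * psi x) ^+ k.+1 * (u ^+ k.+1 / k.+1%:R)).
  apply: has_integralD; first exact: ln_testfunM_has_integral.
  apply: has_integral_sum => k _.
  have := has_integralZ (u ^+ k.+1 / k.+1%:R)
    (testfunM_has_integral rsigma phi psi (ltn0Sn k)).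
  rewrite [X in has_integral _ _ X -> _]mulrC.
  by apply: has_integral_ext => x; rewrite [LHS]mulrC.
rewrite -opprD normrN -(has_integral_Rintegral hrem).
rewrite mulrAC; apply: (bounded_supported_integrable (@box_measurable R d A)
  (box_finite rsigma A) (has_integral_measurable hrem) _ _).2 => x.
  apply: le_trans (ln_taylor N u0 (ub x)) _.
  by rewrite ler_wpM2r ?exprn_ge0 // ler_wpM2l // lerXn2r ?nnegrE.
move=> xA; rewrite /rem phiA // mul0r mulr0 subr0 ln1 add0r big1 // => k _.
by rewrite expr0n mul0r.
Qed.

End logarithm.

Section normalized_exponential.
Context {R : realType} {d : nat}.
Local Notation Rd := (borel 'rV[R]_d).
Local Notation D := (testfun R 1 d).
Local Notation D' := (borel (dual D)).
Variable sigma : {sigma_finite_measure set Rd -> \bar R}.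
Variable mu : probability D' R.
Hypothesis rsigma : radon sigma.
Hypothesis gmu : gamma_noise sigma mu.
Implicit Types (phi psi : D).

(** [gamma_noise] prescribes a real-valued integral, which would be 0 if the extended one were
    infinite. The prescribed exponential is positive, so the integral is finite. *)
Lemma laplace_has_integral phi : (forall x, phi x < 1) ->
  has_integral mu (fun w => expR (w phi)) (laplace mu phi).
Proof.
move=> phi1; apply: ge0_has_integral => [w||]; first exact: expR_ge0.
  by apply: measurableT_comp => //; exact: evaluation_measurable.
have : 0 < laplace mu phi by rewrite gmu // expR_gt0.
rewrite /laplace /Rintegral; case: (\int[mu]_w _)%E => [r||] //=; by rewrite ltxx.
Qed.

(* Total version of [normalized_exp], with junk value 0 when phi < 1 fails. *)
Definition nexp phi (w : D') : R :=
  if pselect (forall x, phi x < 1) is left phi1 then normalized_exp mu phi1 w else 0.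

Lemma nexpE phi (phi1 : forall x, phi x < 1) w : nexp phi w = normalized_exp mu phi1 w.
Proof.
rewrite /nexp; case: pselect => [h|/(_ phi1)[]].
by rewrite (Prop_irrelevance h phi1).
Qed.

Lemma nexp_measurable phi : measurable_fun setT (nexp phi).
Proof.
have [phi1|nphi1] := pselect (forall x, phi x < 1).
  rewrite (_ : nexp phi = normalized_exp mu phi1).
    apply: measurable_funM => //; apply: measurableT_comp => //.
    exact: evaluation_measurable.
  by apply/funext => w; exact: nexpE.
by rewrite (_ : nexp phi = cst 0) //; apply/funext => w; rewrite /nexp; case: pselect.
Qed.

Lemma alpha_subr (p : R) : p < 1 -> 1 - p / (p - 1) = (1 - p)^-1.
Proof. move=> p1; have p0 : p - 1 != 0 by rewrite subr_eq0 lt_eqF.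
by have p0' : 1 - p != 0 by [rewrite subr_eq0 gt_eqF]; field; rewrite ?p0 ?p0'.
Qed.

Lemma laplace_alpha phi (phi1 : forall x, phi x < 1) :
  laplace mu (alpha phi1) = expR (\int[sigma]_x ln (1 - phi x)).
Proof.
rewrite gmu => [|x /=]; last first.
  by rewrite -subr_gt0 alpha_subr // invr_gt0 subr_gt0.
congr expR; have h := has_integralZ (-1) (ln_testfun_has_integral rsigma phi1).
apply: oppr_inj; rewrite opprK -mulN1r -(has_integral_Rintegral h).
apply: eq_Rintegral => x _ /=.
by rewrite alpha_subr // lnV ?mulN1r // posrE subr_gt0.
Qed.

(** The bounds are on absolute values because [phi < 1] and [psi < 1] would still allow
    [phi * psi >= 1], and then the sum of the two [alpha] leaves the domain of the Laplace
    transform. *)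
Lemma nexpM_has_integral phi psi :
  (forall x, `|phi x| < 1) -> (forall x, `|psi x| < 1) ->
  has_integral mu (fun w => nexp phi w * nexp psi w)
    (expR (- \int[sigma]_x ln (1 - phi x * psi x))).
Proof.
move=> nphi npsi.
have phi1 x : phi x < 1 by apply: le_lt_trans (nphi x); rewrite ler_norm.
have psi1 x : psi x < 1 by apply: le_lt_trans (npsi x); rewrite ler_norm.
have pp x : phi x * psi x < 1.
  apply: le_lt_trans (ler_norm _) _; rewrite normrM.
  have [->|p0] := eqVneq (psi x) 0; first by rewrite normr0 mulr0.
  by rewrite -[ltRHS]mulr1 ltr_pM.
have sumE x : 1 - (alpha phi1 + alpha psi1) x =
    (1 - phi x * psi x) / ((1 - phi x) * (1 - psi x)).
  have := phi1 x; have := psi1 x; rewrite testfunD /=.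
  move: (phi x) (psi x) => a b b1 a1.
  have a0 : a - 1 != 0 by rewrite subr_eq0 lt_eqF.
  have b0 : b - 1 != 0 by rewrite subr_eq0 lt_eqF.
  have a0' : 1 - a != 0 by rewrite subr_eq0 gt_eqF.
  have b0' : 1 - b != 0 by rewrite subr_eq0 gt_eqF.
  by field; rewrite ?a0 ?b0 ?a0' ?b0'.
have p0 x : 0 < 1 - phi x by rewrite subr_gt0.
have q0 x : 0 < 1 - psi x by rewrite subr_gt0.
have pq0 x : 0 < 1 - phi x * psi x by rewrite subr_gt0.
have sum1 x : (alpha phi1 + alpha psi1) x < 1.
  by rewrite -subr_gt0 sumE divr_gt0 // mulr_gt0.
have lapE : laplace mu (alpha phi1 + alpha psi1) =
    expR (\int[sigma]_x ln (1 - phi x)) * expR (\int[sigma]_x ln (1 - psi x)) *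
    expR (- \int[sigma]_x ln (1 - phi x * psi x)).
  rewrite gmu // -!expRD; congr expR.
  have h1 := ln_testfun_has_integral rsigma phi1.
  have h2 := ln_testfun_has_integral rsigma psi1.
  have h3 : has_integral sigma (fun x : Rd => ln (1 - phi x * psi x))
      (\int[sigma]_x ln (1 - phi x * psi x)).
    have h3 : forall x, 1 * (phi x * psi x) < 1 by move=> x; rewrite mul1r.
    apply: integrable_has_integral.
    apply: (has_integral_ext _ (ln_testfunM_has_integral rsigma h3)).1 => x.
    by rewrite mul1r.
  have h := has_integralD h3 (has_integralZ (-1) (has_integralD h1 h2)).
  transitivity (- (\int[sigma]_x ln (1 - phi x * psi x) + -1 *
    (\int[sigma]_x ln (1 - phi x) + \int[sigma]_x ln (1 - psi x)))); last first.
    by rewrite mulN1r opprD opprK addrC.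
  congr (- _); rewrite -(has_integral_Rintegral h).
  apply: eq_Rintegral => x _; rewrite sumE mulN1r ln_div ?posrE ?mulr_gt0 //.
  by rewrite lnM ?posrE.
have := has_integralZ ((laplace mu (alpha phi1))^-1 * (laplace mu (alpha psi1))^-1)
  (laplace_has_integral sum1).
rewrite lapE !laplace_alpha -invfM mulrA mulVf ?mul1r; last first.
  by rewrite mulf_neq0 // gt_eqF // expR_gt0.
apply: has_integral_ext => w; rewrite !nexpE /normalized_exp !laplace_alpha.
by rewrite raddfD expRD [RHS]mulrACA -invfM [RHS]mulrC.
Qed.

End normalized_exponential.

(** * Laguerre polynomials on tensor powers *)

Section laguerre_tensor.
Context {R : realType} {d : nat}.
Local Notation Rd := (borel 'rV[R]_d).
Local Notation D := (testfun R 1 d).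
Local Notation D' := (borel (dual D)).
Variable sigma : {sigma_finite_measure set Rd -> \bar R}.
Variable mu : probability D' R.
Variable L : forall n, D' -> dual (testfun R n d).
Hypothesis rsigma : radon sigma.
Hypothesis gmu : gamma_noise sigma mu.
Hypothesis muL : laguerre_kernels mu L.
Implicit Types (phi psi : D).

Lemma tensorZ n (t : R) phi : tensor n (t *: phi) = t ^+ n *: tensor n phi.
Proof.
apply: val_inj; apply/funext => x /=; rewrite fctE /tensor_pow.
under eq_bigr do rewrite testfunZ.
by rewrite big_split /= prodr_const card_ord.
Qed.

(** A seminorm ball around 0 meets the ray through [phi] in an interval; its length depends on
    [w]. *)
Lemma nexp_taylor phi w : exists r, 0 < r /\ forall t, 0 <= t <= r ->
  series (fun k => (k`!%:R^-1 * L k w (tensor k phi)) * t ^+ k) @ \oo --> nexp mu (t *: phi) w.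
Proof.
have [_ /(_ w)[p hp [e e0 pe]]] := muL.
have p0 := lf_seminorm_ge0 hp phi.
have p1 : 0 < p phi + 1 by rewrite ltr_wpDl.
exists (e / 2 / (p phi + 1)); split; first by rewrite !divr_gt0.
move=> t /andP[t0 tr].
have [|phi1] := pe (t *: phi).
  case: hp => _ pZ _; rewrite /= subr0 pZ (ger0_norm t0).
  apply: (@le_lt_trans _ _ (t * (p phi + 1))); first by rewrite ler_wpM2l // lerDl.
  rewrite ler_pdivlMr // in tr; apply: le_lt_trans tr _.
  by rewrite ltr_pdivrMr // ltr_pMr ?ltr1n.
rewrite (nexpE _ phi1).
rewrite (_ : (fun k => k`!%:R^-1 * L k w (tensor k phi) * t ^+ k) =
  (fun k => k`!%:R^-1 * L k w (tensor k (t *: phi)))) //.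
by apply/funext => k; rewrite tensorZ linearZ -mulrA [X in _ * X = _]mulrC.
Qed.

(** The steps serve all [w] and are small from [k = 0] on, so every difference quotient has explicit
    pairings. *)
Lemma small_steps n phi : exists h : nat -> R, [/\ forall k, 0 < h k, h @ \oo --> 0
  & forall k j x, (j < n.+1)%N -> `|((j%:R * h k) *: phi) x| < 1].
Proof.
have [M M0 phiM] := testfun_bounded phi.
have M1 : 0 < n.+1%:R * (M + 1) by rewrite mulr_gt0 // ltr_wpDl.
exists (fun k => (n.+1%:R * (M + 1))^-1 * k.+1%:R^-1); split => [k||k j x jn].
- by rewrite mulr_gt0 ?invr_gt0.
- by rewrite -[X in _ --> X](mulr0 (n.+1%:R * (M + 1))^-1); apply: cvgMr; exact: cvg_harmonic.
rewrite testfunZ normrM ger0_norm ?mulr_ge0 ?invr_ge0 // ?ltW //.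
apply: (@le_lt_trans _ _ (j%:R * (n.+1%:R * (M + 1))^-1 * M)).
  apply: ler_pM => //; first by rewrite !mulr_ge0 ?invr_ge0 // ltW.
  rewrite mulrA ler_piMr ?mulr_ge0 ?invr_ge0 // ?(ltW M1) //.
  by rewrite invf_le1 // ler1n.
rewrite mulrAC ltr_pdivrMr // mul1r.
apply: (@le_lt_trans _ _ (n.+1%:R * M)); last by rewrite ltr_pM2l // ltrDl.
by rewrite ler_wpM2r // ler_nat ltnW.
Qed.

Definition laguerre_fd n phi (h : nat -> R) k (w : D') : R :=
  \sum_(j < n.+1) fd_weights n j * nexp mu ((j%:R * h k) *: phi) w / h k ^+ n.

Lemma laguerre_fd_cvg n phi (h : nat -> R) w : (forall k, 0 < h k) -> h @ \oo --> 0 ->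
  laguerre_fd n phi h ^~ w @ \oo --> n`!%:R^-1 * L n w (tensor n phi).
Proof.
move=> h0 hcvg; have [r [r0 /(power_series_remainder n r0)[C hC]]] := nexp_taylor phi w.
have r20 : 0 < r / 2 by rewrite divr_gt0.
exact: (@fd_cvg R n (fun k => k`!%:R^-1 * L k w (tensor k phi)) _ _
  (fun t => nexp mu (t *: phi) w) nat \oo _ h r20 hC h0 hcvg).
Qed.

Lemma laguerre_fd_measurable n phi (h : nat -> R) k : measurable_fun setT (laguerre_fd n phi h k).
Proof.
apply: measurable_sum => j; apply: measurable_funM => //.
by apply: measurable_funM => //; exact: nexp_measurable.
Qed.

Lemma laguerre_fd_has_integral n m phi psi (h h' : nat -> R) k l :
  (forall j x, (j < n.+1)%N -> `|((j%:R * h k) *: phi) x| < 1) ->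
  (forall j x, (j < m.+1)%N -> `|((j%:R * h' l) *: psi) x| < 1) ->
  has_integral mu (fun w => laguerre_fd n phi h k w * laguerre_fd m psi h' l w)
    (\sum_(i < n.+1) \sum_(j < m.+1) fd_weights n i * fd_weights m j *
      expR (- \int[sigma]_x ln (1 - (i%:R * h k) * (j%:R * h' l) * (phi x * psi x))) /
      (h k ^+ n * h' l ^+ m)).
Proof.
move=> hk hl.
apply: (@has_integral_ext _ _ _ _ (fun w => \sum_(i < n.+1) \sum_(j < m.+1)
    fd_weights n i * fd_weights m j / (h k ^+ n * h' l ^+ m) *
    (nexp mu ((i%:R * h k) *: phi) w * nexp mu ((j%:R * h' l) *: psi) w))).
  move=> w; rewrite /laguerre_fd mulr_suml; apply: eq_bigr => i _.
  rewrite mulr_sumr; apply: eq_bigr => j _; rewrite invfM.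
  move: (fd_weights _ _) (fd_weights _ _) (nexp _ _ _) (nexp _ _ _) (_ ^- _) (_ ^- _).
  by move=> a b c e f g; ring.
apply: has_integral_sum => i _; apply: has_integral_sum => j _.
rewrite [X in has_integral _ _ X]mulrAC; apply: has_integralZ.
rewrite (_ : \int[sigma]_x _ =
    \int[sigma]_x ln (1 - ((i%:R * h k) *: phi) x * ((j%:R * h' l) *: psi) x)).
  by apply: nexpM_has_integral => // x; [exact: hk|exact: hl].
by apply: eq_Rintegral => x _; rewrite !testfunZ mulrACA.
Qed.

Lemma laguerre_fd_gram_cvg n m phi psi c (h h' : nat -> R) :
  c 0%N = 1 ->
  (forall n, n.+1%:R * c n.+1 =
     \sum_(k < n.+1) \int[sigma]_x (phi x * psi x) ^+ k.+1 * c (n - k)%N) ->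
  (forall k, 0 < h k) -> h @ \oo --> 0 -> (forall k, 0 < h' k) -> h' @ \oo --> 0 ->
  (fun kl : nat * nat => \sum_(i < n.+1) \sum_(j < m.+1) fd_weights n i * fd_weights m j *
      expR (- \int[sigma]_x ln (1 - (i%:R * h kl.1) * (j%:R * h' kl.2) * (phi x * psi x))) /
      (h kl.1 ^+ n * h' kl.2 ^+ m)) @ filter_prod \oo \oo --> (n == m)%:R * c n.
Proof.
move=> c0 cS h0 hcvg h'0 h'cvg.
have [C [r [r0 hC]]] := ln_testfunM_taylor rsigma phi psi (n + m).
have [C' [r' [r'0 hC']]] := exp_taylor
  (a := fun k => \int[sigma]_x (phi x * psi x) ^+ k) r0 c0 cS (fun u hu => (hC u hu).2).
apply: (fd2_cvg (h := h \o fst) (h' := h' \o snd) r'0 hC').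
- by move=> t; exact: h0.
- exact: cvg_comp cvg_fst hcvg.
- by move=> t; exact: h'0.
- exact: cvg_comp cvg_snd h'cvg.
Qed.

(** [L] is given pointwise in [w]; measurability is inherited from the difference quotients. *)
Lemma laguerre_tensor_measurable n phi :
  measurable_fun setT (fun w => L n w (tensor n phi)).
Proof.
have [h [h0 hcvg _]] := small_steps n phi.
have : measurable_fun setT (fun w => n`!%:R * (n`!%:R^-1 * L n w (tensor n phi))).
  apply: measurable_funM => //.
  apply: (measurable_fun_cvg (h := laguerre_fd n phi h)).
    by move=> k; exact: laguerre_fd_measurable.
  by move=> w _; exact: laguerre_fd_cvg.
by under eq_fun do rewrite mulrA mulfV ?mul1r ?pnatr_eq0 -?lt0n ?fact_gt0 //.
Qed.

Lemma laguerre_tensor_has_integral n m phi psi :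
  has_integral mu (fun w => L n w (tensor n phi) * L m w (tensor m psi))
    (if m =P n is ReflectT e then n`!%:R * ExpG_inner sigma (tensor n phi) (tensor n psi) else 0).
Proof.
have [h [h0 hcvg h1]] := small_steps n phi; have [h' [h'0 h'cvg h'1]] := small_steps m psi.
have [c [c0 cS]] := recursive_sequence (fun k => \int[sigma]_x (phi x * psi x) ^+ k).
have [cX [cX0 cXS]] := recursive_sequence (fun k => \int[sigma]_x (phi x * phi x) ^+ k).
have [cY [cY0 cYS]] := recursive_sequence (fun k => \int[sigma]_x (psi x * psi x) ^+ k).
have := L2_limit2
  (fun w => @laguerre_fd_cvg n phi h w h0 hcvg)
  (fun w => @laguerre_fd_cvg m psi h' w h'0 h'cvg)
  (@laguerre_fd_measurable n phi h) (@laguerre_fd_measurable m psi h')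
  (fun k l => @laguerre_fd_has_integral n n phi phi h h k l (h1 k) (h1 l))
  (fun k l => @laguerre_fd_has_integral m m psi psi h' h' k l (h'1 k) (h'1 l))
  (fun k l => @laguerre_fd_has_integral n m phi psi h h' k l (h1 k) (h'1 l))
  (@laguerre_fd_gram_cvg n n phi phi cX h h cX0 cXS h0 hcvg h0 hcvg)
  (@laguerre_fd_gram_cvg m m psi psi cY h' h' cY0 cYS h'0 h'cvg h'0 h'cvg)
  (@laguerre_fd_gram_cvg n m phi psi c h h' c0 cS h0 hcvg h'0 h'cvg).
(* The quotients converge to the kernels divided by [n!] and [m!]. *)
move=> /(has_integralZ (n`!%:R * m`!%:R)) H.
have f0 k : k`!%:R != 0 :> R by rewrite pnatr_eq0 -lt0n fact_gt0.
suff -> : (if m =P n is ReflectT e then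
    n`!%:R * ExpG_inner sigma (tensor n phi) (tensor n psi) else 0) =
    n`!%:R * m`!%:R * ((n == m)%:R * c n).
  apply: has_integral_ext H => w; move: (f0 n) (f0 m).
  move: (n`!%:R) (m`!%:R) (L _ _ _) (L _ _ _) => a b x y a0 b0.
  by field; rewrite a0 b0.
case: eqP => [->|/nesym/eqP/negbTE ->]; last by rewrite mul0r mulr0.
by rewrite eqxx mul1r (@ExpG_inner_tensor _ _ _ rsigma n _ _ c c0 cS) mulrA.
Qed.

Lemma laguerre_tensor_combE n s w :
  L n w (tensor_comb n s) = \sum_(q <- s) q.1 * L n w (tensor n q.2).
Proof. by rewrite /tensor_comb linear_sum; apply: eq_bigr => q _; rewrite linearZ. Qed.

Lemma laguerre_tensor_comb_measurable n s :
  measurable_fun setT (fun w => L n w (tensor_comb n s)).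
Proof.
under eq_fun do rewrite laguerre_tensor_combE.
apply: measurable_sum => q; apply: measurable_funM => //.
exact: laguerre_tensor_measurable.
Qed.

Lemma laguerre_tensor_comb_has_integral n m s t :
  has_integral mu (fun w => L n w (tensor_comb n s) * L m w (tensor_comb m t))
    (if m =P n is ReflectT e
     then n`!%:R * ExpG_inner sigma (tensor_comb n s) (tensor_comb n t) else 0).
Proof.
have bilinear (G : D -> D -> R) :
    (forall phi psi, has_integral mu
       (fun w => L n w (tensor n phi) * L m w (tensor m psi)) (G phi psi)) ->
    has_integral mu (fun w => L n w (tensor_comb n s) * L m w (tensor_comb m t))
      (\sum_(p <- s) \sum_(q <- t) p.1 * q.1 * G p.2 q.2).
  move=> H; apply: (has_integral_ext _ (has_integral_sum s (fun p _ =>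
    has_integral_sum t (fun q _ => has_integralZ (p.1 * q.1) (H p.2 q.2))))) => w.
  rewrite !laguerre_tensor_combE mulr_suml; apply: eq_bigr => p _.
  by rewrite mulr_sumr; apply: eq_bigr => q _; rewrite mulrACA.
have := laguerre_tensor_has_integral n m; case: (m =P n) => [_|_] /bilinear.
  rewrite ExpG_inner_tensor_comb // mulr_sumr; congr (has_integral _ _ _).
  apply: eq_bigr => p _. rewrite mulr_sumr; apply: eq_bigr => q _.
  by rewrite mulrCA.
by rewrite big1 // => p _; rewrite big1 // => q _; rewrite mulr0.
Qed.

End laguerre_tensor.

(** * Symmetric test functions *)

Section symmetric_approximation.
Context {R : realType} {d : nat}.
Local Notation D := (testfun R 1 d).

Definition polarized n (s : seq (R * ('I_n -> D))) : seq (R * D) :=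
  [seq (n`!%:R^-1 * q.1 * (-1) ^+ #|(~: T)%SET|, \sum_(j in T) q.2 j)
    | q <- s, T <- index_enum {set 'I_n}].

Lemma tensor_comb_polarized n (s : seq (R * ('I_n -> D))) :
  tensor_comb n (polarized s) = n`!%:R^-1 *: \sum_(q <- s) q.1 *: polarize q.2.
Proof.
rewrite /tensor_comb /polarized big_allpairs_dep scaler_sumr; apply: eq_bigr => q _.
by rewrite /polarize !scaler_sumr; apply: eq_bigr => T _ /=; rewrite !scalerA.
Qed.

Lemma tensor_comb_polarizedE n (s : seq (R * ('I_n -> D))) x :
  tensor_comb n (polarized s) x = n`!%:R^-1 *
    \sum_(t : 'S_n) (\sum_(q <- s) q.1 *: tensor_family q.2) (row_perm (t^-1)%g x).
Proof.
rewrite tensor_comb_polarized testfunZ; congr (_ * _); rewrite testfun_sum.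
under [RHS]eq_bigr do rewrite testfun_sum.
rewrite [RHS]exchange_big; apply: eq_bigr => q _.
rewrite testfunZ polarizeE testfun_sum mulr_sumr; apply: eq_bigr => t _.
by rewrite testfunZ tensor_family_perm.
Qed.

(** A symmetric functional takes the same value on all [n!] permuted terms, and the factor [n!^-1]
    cancels their number. *)
Lemma dual_tensor_comb_polarized n (w : dual (testfun R n d)) (s : seq (R * ('I_n -> D))) :
  symmetric_dual w ->
  w (tensor_comb n (polarized s)) = w (\sum_(q <- s) q.1 *: tensor_family q.2).
Proof.
move=> sw; rewrite tensor_comb_polarized linearZ !linear_sum /= mulr_sumr.
apply: eq_bigr => q _; rewrite !linearZ symmetric_dual_polarize //.
by rewrite [RHS]/= [LHS]/= mulrCA [X in _ * X]mulrA mulVf ?mul1r //.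
Qed.

(** On functions supported in one compact set, an LF seminorm is controlled by the derivatives up to
    some order [N]; the hypothesis covers them as soon as [k >= N]. *)
Lemma lf_cvg n (g : nat -> testfun R n d) (phi : testfun R n d) (A : R) :
  supported_in (box A) phi -> (forall k, supported_in (box A) (g k)) ->
  (forall k t x, (size t <= k)%N -> `|pderiv t (g k - phi) x| <= k.+1%:R^-1) ->
  g @ \oo --> phi.
Proof.
move=> phiA gA gphi U [p hp [e e0 pU]].
have [_ _ /(_ _ (@box_compact R n d A))[N [C hC]]] := hp.
suff : \forall k \near \oo, p (g k - phi) < e by apply: filterS => k; exact: pU.
near=> k; apply: (@le_lt_trans _ _ (C * k.+1%:R^-1)).
  apply: hC => [x xA|t x tN]; first by rewrite testfunB phiA // gA // subrr.
  apply: gphi; apply: leq_trans tN _; near: k; exact: nbhs_infty_ge.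
near: k; have : C * k.+1%:R^-1 @[k --> \oo] --> C * (0 : R).
  by apply: cvgMr; exact: cvg_harmonic.
by rewrite mulr0 => /cvgr_lt/(_ _ e0).
Unshelve. all: by end_near. Qed.

(** The approximants are symmetrizations of functions [g k] converging to [phi] in D. As [phi] is
    its own symmetrization, uniform errors are averaged; and a symmetric [w] agrees on [g k] and on
    its symmetrization, so convergence in D is needed only before symmetrizing. *)
Lemma symmetric_approximation n (phi : testfun R n d) : symmetric_testfun phi ->
  exists A (s : nat -> seq (R * D)),
  [/\ supported_in (box A) phi, forall k, supported_in (box A) (tensor_comb n (s k)),
    forall e : R, 0 < e -> \forall k \near \oo, forall x, `|tensor_comb n (s k) x - phi x| <= e
    & forall w : dual (testfun R n d), symmetric_dual w ->
      (fun k => w (tensor_comb n (s k))) @ \oo --> w phi].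
Proof.
move=> sphi; have [A [A0 phiA dense]] := tensor_family_dense phi.
have /choice[s sP] : forall k : nat, exists s : seq (R * ('I_n -> D)),
    let g := \sum_(q <- s) q.1 *: tensor_family q.2 in
    supported_in (box A) g /\
    forall t x, (size t <= k)%N -> `|pderiv t (g - phi) x| <= k.+1%:R^-1.
  by move=> k; apply: dense; rewrite invr_gt0.
pose g k := \sum_(q <- s k) q.1 *: tensor_family q.2.
have gA k : supported_in (box A) (g k) := (sP k).1.
have gphi k x : `|g k x - phi x| <= k.+1%:R^-1.
  by rewrite -testfunB; exact: ((sP k).2 [::]).
exists A, (fun k => polarized (s k)); split => //.
- move=> k x xA; rewrite tensor_comb_polarizedE big1 ?mulr0 // => t _; apply: gA.
  by apply: contra_not xA => xA i j; have := xA (t i) j; rewrite mxE permK.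
- move=> e e0; have := @cvg_harmonic R; move=> /cvgr_le/(_ _ e0); apply: filterS => k ke x.
  apply: le_trans ke; rewrite tensor_comb_polarizedE.
  have f0 : 0 < n`!%:R :> R by rewrite ltr0n fact_gt0.
  have -> : phi x = n`!%:R^-1 * \sum_(t : 'S_n) phi (row_perm (t^-1)%g x).
    rewrite (eq_bigr (fun=> phi x)) => [|t _]; last exact: sphi.
    by rewrite sumr_const card_Sn -[phi x *+ _]mulr_natl mulrA mulVf ?mul1r // gt_eqF.
  rewrite -mulrBr -sumrB normrM gtr0_norm ?invr_gt0 // ler_pdivrMl //.
  apply: le_trans (ler_norm_sum _ _ _) _.
  rewrite -[n`!]card_Sn mulr_natl -sumr_const; apply: ler_sum => t _; exact: gphi.
move=> w sw; under eq_cvg do rewrite dual_tensor_comb_polarized //.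
apply: (cvg_comp _ _ (@lf_cvg n g phi A phiA gA _)); last exact: dual_continuous.
by move=> k t x tk; exact: (sP k).2.
Qed.

End symmetric_approximation.

Theorem proposition4p6 (R : realType) (d : nat)
    (sigma : {sigma_finite_measure set (borel 'rV[R]_d) -> \bar R})
    (mu : probability (borel (dual (testfun R 1 d))) R)
    (L : forall n, borel (dual (testfun R 1 d)) -> dual (testfun R n d)) :
  radon sigma -> non_atomic sigma ->
  gamma_noise sigma mu -> laguerre_kernels mu L ->
  forall (n m : nat) (phi : testfun R n d) (psi : testfun R m d),
    symmetric_testfun phi -> symmetric_testfun psi ->
    (\int[mu]_w (L n w phi * L m w psi)%:E)%E =
    (if m =P n is ReflectT e
     then n`!%:R * ExpG_inner sigma phi (ecast k (testfun R k d) e psi)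
     else 0)%:E.
Proof.
move=> rsigma _ gmu muL n m phi psi sphi spsi.
have [A [s [phiA sA sphi_cvg Ls]]] := symmetric_approximation sphi.
have [B [t [psiB tB tpsi_cvg Lt]]] := symmetric_approximation spsi.
pose AB := Num.max A B.
have boxS p (f : testfun R p d) C : supported_in (box C) f -> C <= AB ->
    supported_in (box AB) f.
  move=> fC CAB x xAB; apply: fC => xC; apply: xAB => i j.
  exact: le_trans (xC i j) CAB.
have AAB : A <= AB by rewrite le_max lexx.
have BAB : B <= AB by rewrite le_max lexx orbT.
have hasI := @laguerre_tensor_comb_has_integral R d sigma mu L rsigma gmu muL.
have meas := @laguerre_tensor_comb_measurable R d mu L muL.
have limXX : (fun k : nat * nat => if n =P n is ReflectT _ then
      n`!%:R * ExpG_inner sigma (tensor_comb n (s k.1)) (tensor_comb n (s k.2)) else 0)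
    @ filter_prod \oo \oo --> n`!%:R * ExpG_inner sigma phi phi.
  case: (n =P n) => // _; apply: cvgMr; apply: (ExpG_inner_cvg rsigma (A := A)) => //.
have limYY : (fun k : nat * nat => if m =P m is ReflectT _ then
      m`!%:R * ExpG_inner sigma (tensor_comb m (t k.1)) (tensor_comb m (t k.2)) else 0)
    @ filter_prod \oo \oo --> m`!%:R * ExpG_inner sigma psi psi.
  case: (m =P m) => // _; apply: cvgMr; apply: (ExpG_inner_cvg rsigma (A := B)) => //.
have limXY : (fun k : nat * nat => if m =P n is ReflectT _ then
      n`!%:R * ExpG_inner sigma (tensor_comb n (s k.1)) (tensor_comb n (t k.2)) else 0)
    @ filter_prod \oo \oo --> (if m =P n is ReflectT e
     then n`!%:R * ExpG_inner sigma phi (ecast k (testfun R k d) e psi) else 0).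
  case: (m =P n) => [e|_]; last exact: cvg_cst.
  (* Destructing [e] identifies [m] with [n] and removes the cast; [AB] then gives both sequences a
     common box. *)
  destruct e => /=; apply: cvgMr; apply: (ExpG_inner_cvg rsigma (A := AB)) => //.
  - by move=> k; apply: boxS AAB.
  - by move=> k; apply: boxS BAB.
  - exact: boxS AAB.
  - exact: boxS BAB.
have Lsym p w : symmetric_dual (L p w) := muL.1 p w.
suff [_ //] : has_integral mu (fun w => L n w phi * L m w psi)
  (if m =P n is ReflectT e
     then n`!%:R * ExpG_inner sigma phi (ecast k (testfun R k d) e psi) else 0).
apply: (L2_limit2 (fun w => Ls _ (Lsym n w)) (fun w => Lt _ (Lsym m w))
  (fun k => meas n (s k)) (fun k => meas m (t k))
  (fun k l => hasI n n (s k) (s l)) (fun k l => hasI m m (t k) (t l))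
  (fun k l => hasI n m (s k) (t l)) limXX limYY limXY).
Qed.
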